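(* The space of $\mathrm{Sp}(2)$-invariant $\mathrm{G}_2$-structures (inducing the fixed orientation) on $\mathbb{S}^7\simeq \mathrm{Sp}(2)/\mathrm{Sp}(1)$ is described by the homogeneous manifold $$\Omega^3_+(\mathbb{S}^7)^{\mathrm{Sp}(2)}\simeq \mathbb{R}^+\times \mathrm{Gl}^+(3,\mathbb{R}),$$ via the isomorphism $\Omega^3_+(\mathbb{S}^7)^{\mathrm{Sp}(2)}\simeq \Lambda^3_+(\mathfrak{p}^* )^{\mathrm{Ad}(\mathrm{Sp}(1))}$ (evaluation at the base point $o$) and the map $$\Phi:\ \mathbb{R}^+\times\mathrm{Gl}^+(3,\mathbb{R})\to \Lambda^3_+(\mathfrak{p}^* )^{\mathrm{Ad}(\mathrm{Sp}(1))},\qquad (a,D)\mapsto \Phi(a,D)=\varphi_{a,D},$$ which is an isomorphism. The corresponding space of $\mathrm{Sp}(2)$-invariant $\mathrm{G}_2$-metrics (Riemannian metrics induced by these $\mathrm{G}_2$-structures) is $$\mathrm{Sym}^2_+(T^*\mathbb{S}^7)^{\mathrm{Sp}(2)}\simeq \mathbb{R}^+\times\big(\mathrm{Gl}^+(3,\mathbb{R})/\mathrm{SO}(3)\big),$$ where $(a,D\cdot \mathrm{SO}(3))$ corresponds to the metric induced by $\varphi_{a,D}$. In particular, the moduli space of $\mathrm{Sp}(2)$-invariant Riemannian metrics (described by Ziller) corresponds to the $4$-manifold $$\mathrm{Aut}(\mathbb{S}^7)\backslash \mathrm{Sym}^2_+(T^*\mathbb{S}^7)^{\mathrm{Sp}(2)}\simeq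 \mathbb{R}^+\times \mathrm{SO}(3)\backslash\big(\mathrm{Gl}^+(3,\mathbb{R})/\mathrm{SO}(3)\big),$$ where $\mathrm{SO}(3)$ acts on $\mathrm{Gl}^+(3,\mathbb{R})/\mathrm{SO}(3)$ by left multiplication.
   Context: $\mathfrak{sp}(2)=\{A\in\mathfrak{gl}(2,\mathbb{H}): A+A^*=0\}$, where $A^*=\bar A^T$. $\mathrm{Sp}(1)$ is embedded in $\mathrm{Sp}(2)$ by $h\mapsto\mathrm{diag}(h,1)$, and $\mathbb{S}^7=\mathrm{Sp}(2)/\mathrm{Sp}(1)$, $o=1\cdot\mathrm{Sp}(1)$. The orthogonal complement $\mathfrak{p}$ of $\mathfrak{sp}(1)$ in $\mathfrak{sp}(2)$ for $\langle A_1,A_2\rangle=\mathrm{Re}\,\mathrm{tr}(A_1A_2^* )$ has basis $e_1=\mathrm{diag}(0,i)$, $e_2=\mathrm{diag}(0,j)$, $e_3=\mathrm{diag}(0,k)$, $e_4=\frac1{\sqrt2}\begin{pmatrix}0&i\\ i&0\end{pmatrix}$, $e_5=\frac1{\sqrt2}\begin{pmatrix}0&j\\ j&0\end{pmatrix}$, $e_6=\frac1{\sqrt2}\begin{pmatrix}0&k\\ k&0\end{pmatrix}$, $e_7=\frac1{\sqrt2}\begin{pmatrix}0&1\\-1&0\end{pmatrix}$, and is identified with $T_o\mathbb{S}^7$. Dual basis $e^1,\dots,e^7$, $e^{ij\cdots}=e^i\wedge e^j\wedge\cdots$, and $\omega_1=e^{47}+e^{56}$, $\omega_2=e^{46}-e^{57}$,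 $\omega_3=e^{45}+e^{67}$. $\mathrm{Sp}(2)$-invariant tensors on $\mathbb{S}^7$ correspond to $\mathrm{Ad}(\mathrm{Sp}(1))$-invariant tensors on $\mathfrak{p}$. $\Lambda^3_+(\mathfrak{p}^* )$ denotes the $\mathrm{G}_2$-structures ($3$-forms $\varphi$ with $(u\lrcorner\varphi)\wedge(v\lrcorner\varphi)\wedge\varphi$ definite) inducing the fixed orientation $e^{1\cdots7}>0$; $\Omega^3_+(\mathbb{S}^7)$ likewise. The metric of $\varphi$ is $g_{ij}=6^{-2/9}B_{ij}/\det(B)^{1/9}$ with $B_{ij}=\big((e_i\lrcorner\varphi)\wedge(e_j\lrcorner\varphi)\wedge\varphi\big)(e_1,\dots,e_7)$. The map $\Phi$: for $a>0$ and $D\in\mathrm{Gl}^+(3,\mathbb{R})$ (matrices of positive determinant), $$\varphi_{a,D}=a^3e^{123}+\sum_{i,l=1}^3 (D^{-1})_{il}\,e^l\wedge\omega_i .$$ $\mathrm{Aut}(\mathbb{S}^7)$ denotes the group of $\mathrm{Sp}(2)$-equivariant diffeomorphisms $f$ of $\mathbb{S}^7$ (i.e. automorphisms of $\mathrm{Sp}(2)$ preserving the subgroup $\mathrm{Sp}(1)$) such that $(f^{-1})^*g$ is an $\mathrm{Sp}(2)$-invariant metric whenever $g$ is one; it acts on invariant metrics by $g\mapsto (f^{-1})^*g$.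
   Formalization: The moduli space is shown to be a topological 4-manifold with boundary instead of a 4-manifold: it is R⁺ times the closed chamber of ordered positive eigenvalues, whose boundary is non-empty; the last ≃ is read as a homeomorphism. *)

(* Defs.v *)
From HB Require Import structures.
From mathcomp Require Import all_boot all_order all_algebra.
From mathcomp Require Import perm ring.
From mathcomp Require Import all_classical all_reals all_analysis.

Set Implicit Arguments.
Unset Strict Implicit.
Unset Printing Implicit Defensive.
Import Order.TTheory GRing.Theory Num.Theory.
Import numFieldNormedType.Exports.
Local Open Scope classical_set_scope.
Local Open Scope ring_scope.

(** * Quaternions *)

Record quat (R : Type) := Quat { qr : R; qi : R; qj : R; qk : R }.

Section QuatRing.
Variable R : realType.
Local Notation H := (quat R).

Definition quat_tuple (x : H) := (qr x, qi x, qj x, qk x).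
Definition tuple_quat (t : R * R * R * R) : H :=
  Quat t.1.1.1 t.1.1.2 t.1.2 t.2.

Lemma quat_tupleK : cancel quat_tuple tuple_quat.
Proof. by case. Qed.

HB.instance Definition _ := Choice.copy H (can_type quat_tupleK).

Definition qadd (x y : H) :=
  Quat (qr x + qr y) (qi x + qi y) (qj x + qj y) (qk x + qk y).
Definition qopp (x : H) := Quat (- qr x) (- qi x) (- qj x) (- qk x).
Definition qmul (x y : H) := Quat
  (qr x * qr y - qi x * qi y - qj x * qj y - qk x * qk y)
  (qr x * qi y + qi x * qr y + qj x * qk y - qk x * qj y)
  (qr x * qj y - qi x * qk y + qj x * qr y + qk x * qi y)
  (qr x * qk y + qi x * qj y - qj x * qi y + qk x * qr y).
Definition qre (c : R) : H := Quat c 0 0 0.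

Fact qaddA : associative qadd.
Proof. by move=> [????] [????] [????]; rewrite /qadd /= !addrA. Qed.
Fact qaddC : commutative qadd.
Proof. by move=> [????] [????]; congr Quat; apply: addrC. Qed.
Fact qadd0 : left_id (qre 0) qadd.
Proof. by move=> [????]; rewrite /qadd /= !add0r. Qed.
Fact qaddN : left_inverse (qre 0) qopp qadd.
Proof. by move=> [????]; rewrite /qadd /= !addNr. Qed.

HB.instance Definition _ := GRing.isZmodule.Build H qaddA qaddC qadd0 qaddN.

Fact qmulA : associative qmul.
Proof. by move=> [????] [????] [????]; congr Quat => /=; ring. Qed.
Fact qmul1 : left_id (qre 1) qmul.
Proof. by move=> [????]; congr Quat => /=; ring. Qed.
Fact qmulr1 : right_id (qre 1) qmul.
Proof. by move=> [????]; congr Quat => /=; ring. Qed.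
Fact qmulDl : left_distributive qmul qadd.
Proof. by move=> [????] [????] [????]; congr Quat => /=; ring. Qed.
Fact qmulDr : right_distributive qmul qadd.
Proof. by move=> [????] [????] [????]; congr Quat => /=; ring. Qed.
Fact qone_neq0 : qre 1 != 0 :> H.
Proof. by apply/eqP => -[/eqP]; rewrite oner_eq0. Qed.

HB.instance Definition _ := GRing.Zmodule_isNzRing.Build H
  qmulA qmul1 qmulr1 qmulDl qmulDr qone_neq0.

Definition qconj (x : H) : H := Quat (qr x) (- qi x) (- qj x) (- qk x).

End QuatRing.

Definition adjm (R : realType) m n (A : 'M[quat R]_(m, n)) :
  'M[quat R]_(n, m) := map_mx (@qconj R) A^T.

Definition ip (R : realType) m n (A B : 'M[quat R]_(m, n)) : R :=
  qr (\tr (A *m adjm B)).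

Definition rcoord (R : realType) m n (A : 'M[quat R]_(m, n)) :
    ('M[R]_(m, n) * 'M[R]_(m, n) * 'M[R]_(m, n) * 'M[R]_(m, n))%type :=
  (map_mx (@qr R) A, map_mx (@qi R) A, map_mx (@qj R) A, map_mx (@qk R) A).

(** * Smooth maps *)

Section Smooth.
Variable R : realType.

Fixpoint Ck (V W : normedModType R) (k : nat) (U : set V) (f : V -> W) : Prop :=
  match k with
  | 0 => forall x, U x -> {for x, continuous f}
  | k'.+1 => (forall x, U x -> differentiable f x) /\
             forall v, Ck k' U (fun x => 'D_v f x)
  end.

(* Smoothness of a map defined on an arbitrary subset A (a submanifold, in all
   uses): it extends locally to a C^oo map between open sets of the ambient
   spaces.  The sets E and F are seen as subsets of finite-dimensional spaces
   V and W through the coordinate maps cE and cF. *)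
Definition smooth_map (E F : Type) (V W : normedModType R)
    (cE : E -> V) (cF : F -> W) (A : set E) (f : E -> F) : Prop :=
  forall x, A x -> exists (U : set V) (G : V -> W),
    [/\ open U, U (cE x), (forall k, Ck k U G) &
        forall y, A y -> U (cE y) -> cF (f y) = G (cE y)].

Definition diffeo (E F : Type) (V W : normedModType R)
    (cE : E -> V) (cF : F -> W) (A : set E) (B : set F) (f : E -> F) : Prop :=
  exists f' : F -> E,
    [/\ set_fun A B f, set_fun B A f',
        (forall x, A x -> f' (f x) = x) /\ (forall y, B y -> f (f' y) = y),
        smooth_map cE cF A f & smooth_map cF cE B f'].

(* M is a diffeomorphism from a quotient manifold A/~ onto B, where q is the
   submersion A -> A/~: smooth maps out of A/~ are those whose composite with
   q is smooth, smooth maps into A/~ are those that lift locally to smooth maps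
   into A. *)
Definition quotient_diffeo (E F Q : Type) (V W : normedModType R)
    (cE : E -> V) (cF : F -> W) (A : set E) (q : E -> Q) (B : set F)
    (M : Q -> F) : Prop :=
  [/\ set_bij (q @` A) B M,
      smooth_map cE cF A (M \o q) &
      forall y, B y -> exists (U : set W) (s : F -> E),
        [/\ open U, U (cF y),
            smooth_map cF cE (B `&` cF @^-1` U) s &
            forall z, B z -> U (cF z) -> A (s z) /\ M (q (s z)) = z]].

End Smooth.

(** * Tensors on real subspaces of quaternionic matrices *)

Definition tensor (R V : Type) (k : nat) : Type := ('I_k -> V) -> R.

Section Tensors.
Variable R : realType.

Definition restr (V : Type) k (W : set V) (t : tensor R V k) : tensor R V k :=
  fun v => if `[< forall i, W (v i) >] then t v else 0.

Definition upd (V : Type) k (v : 'I_k -> V) (i : 'I_k) (u : V) : 'I_k -> V :=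
  fun j => if j == i then u else v j.

(* A k-tensor on the real subspace W is encoded by the function on k-tuples of
   ambient vectors that extends it by 0, so that tensors on W are equal iff
   they agree on W. *)
Definition is_tensor m n k (W : set 'M[quat R]_(m, n))
    (t : tensor R 'M[quat R]_(m, n) k) : Prop :=
  restr W t = t /\
  forall v i u w (c : R), (forall j, W (v j)) -> W u -> W w ->
    t (upd v i (qre c *: u + w)) = c * t (upd v i u) + t (upd v i w).

Definition alternating_tensor (V : Type) k (t : tensor R V k) : Prop :=
  forall v i j, i != j -> v i = v j -> t v = 0.

Definition symmetric_tensor (V : Type) k (t : tensor R V k) : Prop :=
  forall v (s : 'S_k), t (v \o s) = t v.

Definition posdef m n (W : set 'M[quat R]_(m, n))
    (t : tensor R 'M[quat R]_(m, n) 2) : Prop :=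
  forall u, W u -> u != 0 -> 0 < t (fun=> u).

(* Normalized so that (e^1 /\ ... /\ e^k)(e_1, ..., e_k) = 1. *)
Definition wedge (V : Type) p q (s : tensor R V p) (t : tensor R V q) :
    tensor R V (p + q) := fun v =>
  (p`! * q`!)%:R^-1 *
  \sum_(w : 'S_(p + q)) (-1) ^+ w *
     s (fun i => v (w (lshift q i))) * t (fun j => v (w (rshift p j))).

Definition contract (V : Type) k (u : V) (t : tensor R V k.+1) : tensor R V k :=
  fun v => t (fun i => if unlift ord0 i is Some j then v j else u).

End Tensors.

(** * Sp(2), Sp(1) and p *)

Section Sp2.
Variable R : realType.
Local Notation H := (quat R).
Local Notation M2 := 'M[quat R]_2.

Definition mx2 (a b c d : H) : M2 :=
  \matrix_(i, j) if i == 0 then if j == 0 then a else b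
                 else if j == 0 then c else d.

Definition Sp2 : set M2 := [set A | A *m adjm A = 1%:M /\ adjm A *m A = 1%:M].
Definition sp2 : set M2 := [set A | A + adjm A = 0].

Definition Sp1 : set M2 := [set mx2 h 0 0 1 | h in [set h | h * qconj h = 1]].
Definition sp1 : set M2 := [set mx2 q 0 0 0 | q in [set q | q + qconj q = 0]].

Definition pp : set M2 := [set A | sp2 A /\ forall B, sp1 B -> ip A B = 0].

(* e_i, with the index i running from 1 to 7 *)
Definition bas (i : nat) : M2 :=
  let qI := Quat 0 1 0 0 in let qJ := Quat 0 0 1 0 in let qK := Quat 0 0 0 1 in
  let r := qre (Num.sqrt 2)^-1 in
  nth 0 [:: mx2 0 0 0 qI; mx2 0 0 0 qJ; mx2 0 0 0 qK;
            r *: mx2 0 qI qI 0; r *: mx2 0 qJ qJ 0; r *: mx2 0 qK qK 0;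
            r *: mx2 0 1 (- 1) 0] i.-1.

(* The basis e_1, ..., e_7 of p is orthonormal, so its dual basis is given by
   e^i = <_, e_i>. *)
Definition de (i : nat) : tensor R M2 1 :=
  restr pp (fun v => ip (v ord0) (bas i)).
Definition de2 i j : tensor R M2 2 := wedge (de i) (de j).
Definition de3 i j k : tensor R M2 3 := wedge (de2 i j) (de k).

Definition omega (i : 'I_3) : tensor R M2 2 := fun v =>
  tnth [tuple de2 4 7 v + de2 5 6 v;
              de2 4 6 v - de2 5 7 v;
              de2 4 5 v + de2 6 7 v] i.

Definition Phi (z : R * 'M[R]_3) : tensor R M2 3 := fun v =>
  z.1 ^+ 3 * de3 1 2 3 v +
  \sum_(i < 3) \sum_(l < 3) invmx z.2 i l * wedge (de l.+1) (omega i) v.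

(* Ad(h) A = h A h^-1, where h^-1 = h^* *)
Definition Ad_invariant k (t : tensor R M2 k) : Prop :=
  forall h v, Sp1 h -> (forall i, pp (v i)) ->
    t (fun i => h *m v i *m adjm h) = t v.

(* (u _| phi) /\ (v _| phi) /\ phi, evaluated on (e_1, ..., e_7) *)
Definition Bform (phi : tensor R M2 3) (u v : M2) : R :=
  (wedge (wedge (contract u phi) (contract v phi)) phi : tensor R M2 7)
    (fun i => bas i.+1).

(* The orientation induced by phi is the one for which the definite form
   (u _| phi) /\ (v _| phi) /\ phi is positive; it is required to be the
   orientation e^{1...7} > 0. *)
Definition Lambda3p : set (tensor R M2 3) :=
  [set phi | [/\ is_tensor pp phi, alternating_tensor phi &
                 forall u, pp u -> u != 0 -> 0 < Bform phi u u]].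

Definition Lambda3p_inv : set (tensor R M2 3) :=
  [set phi | Lambda3p phi /\ Ad_invariant phi].

Definition G2_metric (phi : tensor R M2 3) : tensor R M2 2 := fun v =>
  let B := \matrix_(i < 7, j < 7) Bform phi (bas i.+1) (bas j.+1) in
  \sum_i \sum_j 6 `^ (- (2 / 9)) * B i j / (\det B) `^ (1 / 9) *
    de i.+1 (fun=> v ord0) * de j.+1 (fun=> v ord_max).

(* Linear coordinates on the space of k-tensors on p: the values on the tuples
   of basis vectors *)
Definition tcoord k (t : tensor R M2 k) : 'rV[R]_#|{ffun 'I_k -> 'I_7}| :=
  \row_s t (fun i => bas ((enum_val s : {ffun 'I_k -> 'I_7}) i).+1).

Definition RGLp : set (R * 'M[R]_3) := [set z | 0 < z.1 /\ 0 < \det z.2].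
Definition SO3 : set 'M[R]_3 := [set Q | Q *m Q^T = 1%:M /\ \det Q = 1].

Definition coset (D : 'M[R]_3) : set 'M[R]_3 := [set D *m Q | Q in SO3].
Definition pcoset (z : R * 'M[R]_3) : R * set 'M[R]_3 := (z.1, coset z.2).

(* The orbit of a coset C under left multiplication by SO(3) *)
Definition SO3orbit (C : set 'M[R]_3) : set (set 'M[R]_3) :=
  [set [set Q *m D | D in C] | Q in SO3].
Definition porbit (z : R * 'M[R]_3) : R * set (set 'M[R]_3) :=
  (z.1, SO3orbit (coset z.2)).

End Sp2.

(** * Tensor fields on the sphere *)

Section Sphere.
Variable R : realType.
Local Notation M2 := 'M[quat R]_2.
Local Notation H2 := 'cV[quat R]_2.

(* S^7 = Sp(2)/Sp(1) is realized as the unit sphere of H^2, the orbit of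
   o = (0, 1), whose stabilizer in Sp(2) is Sp(1); a vector A of p is
   identified with the tangent vector A o at o. *)
Definition S7 : set H2 := [set x | ip x x = 1].
Definition T7 (x : H2) : set H2 := [set v | ip v x = 0].
Definition o7 : H2 := \col_i (i != 0)%:R.

Definition tfield (k : nat) : Type := H2 -> tensor R H2 k.

Definition smooth_tfield k (t : tfield k) : Prop :=
  forall X : 'I_k -> H2 -> H2,
    (forall i, smooth_map (@rcoord R 2 1) (@rcoord R 2 1) S7 (X i)) ->
    (forall i x, S7 x -> T7 x (X i x)) ->
    smooth_map (@rcoord R 2 1) (id : R -> R) S7 (fun x => t x (X^~ x)).

(* Off the sphere, the value is irrelevant and set to 0. *)
Definition is_tfield k (t : tfield k) : Prop :=
  [/\ forall x, S7 x -> is_tensor (T7 x) (t x),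
      forall x v, ~ S7 x -> t x v = 0 &
      smooth_tfield t].

Definition Sp2_invariant k (t : tfield k) : Prop :=
  forall A x v, Sp2 A -> S7 x -> (forall i, T7 x (v i)) ->
    t (A *m x) (fun i => A *m v i) = t x v.

(* The tensor t_x at x = A o, transported to p by the isometry A *)
Definition pull k (A : M2) (t : tfield k) : tensor R M2 k :=
  restr (@pp R) (fun v => t (A *m o7) (fun i => A *m v i *m o7)).

Definition ev k (t : tfield k) : tensor R M2 k :=
  restr (@pp R) (fun v => t o7 (fun i => v i *m o7)).

(* S^7 carries the Sp(2)-invariant orientation extending e^{1...7} > 0, so that
   (A e_1 o, ..., A e_7 o) is an oriented basis of the tangent space at A o. *)
Definition Omega3p : set (tfield 3) :=
  [set phi | [/\ is_tfield phi, forall x, alternating_tensor (phi x) &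
                 forall A, Sp2 A -> Lambda3p (pull A phi)]].

Definition Omega3p_inv : set (tfield 3) :=
  [set phi | Omega3p phi /\ Sp2_invariant phi].

Definition Riemannian : set (tfield 2) :=
  [set g | [/\ is_tfield g, forall x, symmetric_tensor (g x) &
               forall x, S7 x -> posdef (T7 x) (g x)]].

Definition Sym2p_inv : set (tfield 2) :=
  [set g | Riemannian g /\ Sp2_invariant g].

(* g_ij = 6^(-2/9) B_ij / det(B)^(1/9) in the oriented bases A e_i o *)
Definition induces (phi : tfield 3) (g : tfield 2) : Prop :=
  Riemannian g /\ forall A, Sp2 A -> pull A g = G2_metric (pull A phi).

Definition G2_metrics_inv : set (tfield 2) :=
  [set g | exists2 phi, Omega3p_inv phi & induces phi g].

(** * Aut(S^7) and its action on metrics *)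

(* For v tangent to S^7 at x, the curve (x + t v) / |x + t v| on S^7 has
   initial velocity v. *)
Definition arc (x v : H2) (t : R) : H2 :=
  let y := x + qre t *: v in qre (Num.sqrt (ip y y))^-1 *: y.

(* The differential at x of a smooth map f from S^7 to S^7 *)
Definition dS7 (f : H2 -> H2) (x v : H2) : H2 :=
  \col_i Quat (derive1 (fun t => qr (f (arc x v t) i 0)) 0)
              (derive1 (fun t => qi (f (arc x v t) i 0)) 0)
              (derive1 (fun t => qj (f (arc x v t) i 0)) 0)
              (derive1 (fun t => qk (f (arc x v t) i 0)) 0).

Definition pullback k (f : H2 -> H2) (t : tfield k) : tfield k := fun x =>
  restr [set v | S7 x /\ T7 x v] (fun v => t (f x) (fun i => dS7 f x (v i))).

(* (f^-1)^* t *)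
Definition push k (f : H2 -> H2) (t : tfield k) : tfield k :=
  pullback ('pinv_id S7 f) t.

(* Diffeomorphisms g Sp(1) |-> alpha(g) Sp(1) of Sp(2)/Sp(1), where alpha is an
   automorphism of the Lie group Sp(2) preserving Sp(1), that map invariant
   metrics to invariant metrics.  The values of f and alpha off the sphere and
   off Sp(2) are irrelevant. *)
Definition AutS7 : set (H2 -> H2) :=
  [set f | [/\ diffeo (@rcoord R 2 1) (@rcoord R 2 1) S7 S7 f,
    exists alpha : M2 -> M2,
      [/\ diffeo (@rcoord R 2 2) (@rcoord R 2 2) (@Sp2 R) (@Sp2 R) alpha,
          forall A B, Sp2 A -> Sp2 B -> alpha (A *m B) = alpha A *m alpha B,
          alpha @` (@Sp1 R) = @Sp1 R &
          forall A, Sp2 A -> f (A *m o7) = alpha A *m o7] &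
    forall g, Sym2p_inv g -> Sym2p_inv (push f g)]].

Definition Aut_orbit (g : tfield 2) : set (tfield 2) :=
  [set push f g | f in AutS7].

End Sphere.

(** * Quotient spaces and manifolds with boundary *)

(* The image of A under q : E -> Q, where A has the topology induced by the
   coordinates c : E -> V *)
Definition qspace (E : Type) (Q : choiceType) (V : topologicalType)
  (c : E -> V) (A : set E) (q : E -> Q) : Type := set_type (q @` A).

Section Qspace.
Context {E : Type} {Q : choiceType} {V : topologicalType}.
Context (c : E -> V) (A : set E) (q : E -> Q).
Local Notation X := (qspace c A q).

HB.instance Definition _ := Choice.on X.

Definition qclass (x : E) (Ax : A x) : X := exist _ (q x) (mem_set (imageP q Ax)).

Definition qopen (O : set X) : Prop :=
  exists2 U : set V, open U & forall x (Ax : A x), U (c x) <-> O (qclass Ax).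

Fact qopenT : qopen setT.
Proof. by exists setT; [exact: openT | ]. Qed.

Fact qopenI : setI_closed qopen.
Proof.
move=> O O' [U oU UO] [U' oU' UO']; exists (U `&` U'); first exact: openI.
by move=> x Ax; split=> -[] /UO ? /UO' ?; split.
Qed.

Fact qopen_bigU (I : Type) (O : I -> set X) :
  (forall i, qopen (O i)) -> qopen (\bigcup_i O i).
Proof.
move=> oO; have /choice[U UP] : forall i, exists U : set V, open U /\
    forall x (Ax : A x), U (c x) <-> O i (qclass Ax).
  by move=> i; have [U oU UO] := oO i; exists U.
exists (\bigcup_i U i); first by apply: bigcup_open => i _; exact: (UP i).1.
by move=> x Ax; split=> -[i _ /(UP i).2 ?]; exists i.
Qed.

HB.instance Definition _ :=
  @isOpenTopological.Build X qopen qopenT qopenI qopen_bigU.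

End Qspace.

Definition homeomorphism (X Y : topologicalType) (f : X -> Y) : Prop :=
  continuous f /\ exists f' : Y -> X, [/\ continuous f', cancel f f' & cancel f' f].

Definition half_space (R : realType) n : set 'rV[R]_n :=
  [set y | forall i : 'I_n, val i = 0%N -> 0 <= y 0 i].

Definition manifold_with_boundary (R : realType) n (X : topologicalType) : Prop :=
  [/\ hausdorff_space X, @second_countable X &
      forall x : X, exists (O : set X) (U : set 'rV[R]_n)
          (h : X -> 'rV[R]_n) (h' : 'rV[R]_n -> X),
        [/\ open O, O x, open U &
          [/\ set_bij O (U `&` @half_space R n) h, {in O, cancel h h'},
              {within O, continuous h} &
              {within U `&` @half_space R n, continuous h'}]]].

(** * The parameter space and the moduli space of invariant metrics *)

Section Moduli.
Variable R : realType.

Definition RGL_coord (z : R * 'M[R]_3) : (R * 'M[R]_3)%type := z.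

(* An invariant metric is determined by its value at o. *)
Definition metric_coord (g : tfield R 2) := tcoord (ev g).

(* R^+ x SO(3)\(Gl^+(3,R)/SO(3)) *)
Definition double_quotient :=
  qspace RGL_coord (@RGLp R) (@porbit R).

(* Aut(S^7)\Sym^2_+(T^*S^7)^{Sp(2)} *)
Definition moduli :=
  qspace metric_coord (@Sym2p_inv R) (@Aut_orbit R).

HB.instance Definition _ := Topological.on double_quotient.
HB.instance Definition _ := Topological.on moduli.

Definition double_class (z : R * 'M[R]_3) (Az : RGLp z) : double_quotient :=
  qclass RGL_coord (@porbit R) Az.
Definition moduli_class (g : tfield R 2) (Ag : Sym2p_inv g) : moduli :=
  qclass metric_coord (@Aut_orbit R) Ag.

End Moduli.

(* Main.v *)
Require Import Defs.
From HB Require Import structures.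
From mathcomp Require Import all_boot all_order all_algebra.
From mathcomp Require Import perm ring lra.
From mathcomp Require Import all_classical all_reals all_analysis.
Set Implicit Arguments.
Unset Strict Implicit.
Unset Printing Implicit Defensive.
Import Order.TTheory GRing.Theory Num.Theory.
Import numFieldNormedType.Exports.
Local Open Scope classical_set_scope.
Local Open Scope ring_scope.

(* An element of Sp(1) acts on p = p_1 + p_2 trivially on p_1 = <e_1, e_2, e_3> and by left
   multiplication on p_2 = H. Invariance under -1, i and j already forces a 3-form to be
   C e^123 + sum A_il e^l /\ omega_i, and a symmetric form to be P on p_1 plus lam times the
   identity on p_2. The bilinear form B of the 3-form is 6 C A^T A on p_1 and 6 det A on p_2,
   so definiteness and the orientation mean C > 0 and det A > 0, and for C = a^3 the metric has
   lam = (det A)^(1/3) / a and P = lam^-2 A^T A. The Cholesky factor U of P recovers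
   A = lam U up to SO(3) and a = (det U)^(1/3). Invariant tensors on p extend to the
   sphere at x through the Sp(2)-invariant forms x^* v and v^* w - (x^* v)^* (x^* w).

   An equivariant diffeomorphism acts on the pairs (P, lam) through SO(3). Let k be its inverse
   and beta the associated endomorphism of Sp(2). On a great circle cos t o + sin t v with v in
   p_1 or p_2, the real part c(t) of the second component of k satisfies
   c(2t) = 2 c(t)^2 - 1; comparing it with cos at the points t / 2^n gives c(t) = cos (rho t),
   and injectivity gives rho = 1. On p_1 this makes beta a multiplicative isometry of the unit
   quaternions, hence a rotation, and on p_2 it shows that lam is preserved. Conversely the
   rotation by a unit quaternion q is realized by x |-> diag(1, q) x q^-1.

   The moduli are therefore lam and the ordered eigenvalues of P; the largest eigenvalue is
   Lipschitz in P, being a supremum of quadratic forms, which gives continuity of the chart. *)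

(** * Smooth functions between normed spaces *)

(** In terms of A = D^-1 the two SO(3) actions separate: replacing D by D Q replaces A by Q^T A and
    keeps A^T A, hence the metric, while replacing D by Q D turns P into Q P Q^T, which is what
    automorphisms do. Three obstacles shape the proof. The form B is a sum over all permutations of
    seven letters; grouping them by shuffles, then by the 35 increasing triples of indices, leaves a
    polynomial identity. An element of [AutS7] comes with a group automorphism, not with its
    differential; instead of passing to the Lie algebra, the doubling identity turns
    multiplicativity in the group into a functional equation for one real function, and the
    differential enters only through its length on a unit vector. Finally, smooth maps between
    subsets are given by local extensions to ambient coordinates, so every inverse map is an
    explicit formula on an open set of coordinates; the Cholesky factor provides such a formula for
    the section from metrics to parameters. *)

Section SmoothCalculus.
Variable R : realType.
Implicit Types V W : normedModType R.

Definition smooth_on V W (U : set V) (f : V -> W) := forall k, Ck k U f.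

Lemma Ck_sub V W k (U U' : set V) (f : V -> W) :
  U' `<=` U -> Ck k U f -> Ck k U' f.
Proof.
move=> UU; elim: k f => [|k IH] f /=; first by move=> H x /UU; exact: H.
by move=> [H1 H2]; split=> [x /UU/H1 //|v]; exact: IH.
Qed.

(** The first order expansion of f at x is also one of g, and uniqueness of the differential
    identifies its linear part. *)
Lemma near_eq_differentiable V W (f g : V -> W) x :
  {near x, f =1 g} -> differentiable f x -> differentiable g x.
Proof.
move=> fg df; have [cf ef] := (diff_locallyP _ _).1 df.
have eg : g \o shift x = cst (g x) + 'd f x +o_ 0 id.
  apply/eqaddoP => _/posnumP[e].
  have := (eqaddoP _ _ _ _).1 ef e%:num (ltac:(done)) => H.
  have fg0 : \forall h \near (0 : V), f (h + x) = g (h + x).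
    by move: fg; rewrite (near_shift 0) /=; apply: filterS => h; rewrite subr0.
  move: H fg0; apply: filterS2 => h /= H fgh; move: H.
  rewrite -[((_ \o _) - _) h]/((f (h + x)) - (f x + 'd f x h)).
  rewrite -[((_ \o _) - _) h]/((g (h + x)) - (g x + 'd f x h)).
  by rewrite fgh (nbhs_singleton fg).
apply/diff_locallyP; have /= E := diff_unique cf eg.
by rewrite E; split.
Qed.

(** Openness of U turns equality on U into equality near each of its points, so all directional
    derivatives agree there too. *)
Lemma Ck_ext V W k (U : set V) (f g : V -> W) : open U ->
  (forall x, U x -> f x = g x) -> Ck k U f -> Ck k U g.
Proof.
move=> oU fg; have nfg x : U x -> {near x, f =1 g}.
  by move=> Ux; near=> y; apply: fg; near: y; exact: open_nbhs_nbhs.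
elim: k f g fg nfg => [|k IH] f g fg nfg /=.
  move=> H x Ux; have := H x Ux; rewrite /prop_for /continuous_at -fg //.
  by apply: cvg_trans; apply: near_eq_cvg; exact: nfg.
move=> [H1 H2]; split.
  by move=> x Ux; apply: (near_eq_differentiable (nfg x Ux)); exact: H1.
have nD v x : U x -> 'D_v f x = 'D_v g x.
  by move=> Ux; apply: near_eq_derive; exact: nfg.
move=> v; apply: IH (H2 v) => [|x Ux]; first exact: nD.
by near=> y; apply: nD; near: y; exact: open_nbhs_nbhs.
Unshelve. all: by end_near. Qed.

Lemma Ck_le V W k (U : set V) (f : V -> W) : Ck k.+1 U f -> Ck k U f.
Proof.
elim: k f => [|k IH] f; first by move=> [H _] x /H; exact: differentiable_continuous.
move=> H; have [H1 H2] := H; split=> // v.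
by apply: IH; exact: H2.
Qed.

Lemma Ck_cst V W k (U : set V) (c : W) : Ck k U (fun=> c).
Proof.
elim: k c => [|k IH] c /=; first by move=> x _; exact: cst_continuous.
split=> [x _|v]; first exact: differentiable_cst.
have -> : (fun x => 'D_v (fun=> c) x) = (fun _ : V => 0 : W).
  by apply/funext => x; exact: derive_cst.
exact: IH.
Qed.

Lemma Ck_lin V W k (U : set V) (L : {linear V -> W}) :
  continuous L -> Ck k U L.
Proof.
move=> cL; case: k => [|k]; first by move=> x _; exact: cL.
split=> [x _|v]; first exact: linear_differentiable.
rewrite (_ : (fun x => _) = fun=> L v); first exact: Ck_cst.
apply/funext => x; rewrite deriveE; last exact: linear_differentiable.
by rewrite diff_lin.
Qed.

Lemma CkD V W k (U : set V) (f g : V -> W) : open U ->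
  Ck k U f -> Ck k U g -> Ck k U (fun x => f x + g x).
Proof.
move=> oU; elim: k f g => [|k IH] f g /=.
  by move=> Hf Hg x Ux; apply: continuousD; [exact: Hf|exact: Hg].
move=> [f1 f2] [g1 g2]; split=> [x Ux|v].
  by apply: differentiableD; [exact: f1|exact: g1].
apply: (@Ck_ext _ _ _ _ (fun x => 'D_v f x + 'D_v g x)) => //.
  by move=> x Ux; rewrite -deriveD //; apply: diff_derivable; [exact: f1|exact: g1].
exact: IH.
Qed.

Lemma Ck_linc V W W' k (U : set V) (f : V -> W) (L : {linear W -> W'}) :
  open U -> continuous L -> Ck k U f -> Ck k U (fun x => L (f x)).
Proof.
move=> oU cL; elim: k f => [|k IH] f /=.
  by move=> H x /H; move/continuous_comp; apply; exact: cL.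
move=> [f1 f2]; have dL y : differentiable L y by exact: linear_differentiable.
split=> [x Ux|v]; first by apply: differentiable_comp => //; exact: f1.
apply: (@Ck_ext _ _ _ _ (fun x => L ('D_v f x))) => //; last exact: IH.
move=> x Ux; have dfx := f1 x Ux.
have dLf : differentiable (L \o f) x by exact: differentiable_comp.
rewrite !deriveE //.
have -> := diff_comp dfx (dL (f x)).
have -> := diff_lin (f x) cL.
by [].
Qed.

Lemma CkM V k (U : set V) (f g : V -> R) : open U ->
  Ck k U f -> Ck k U g -> Ck k U (fun x => f x * g x).
Proof.
move=> oU; elim: k f g => [|k IH] f g.
  by move=> Hf Hg x Ux; apply: continuousM; [exact: Hf|exact: Hg].
move=> Hf Hg; have [f1 f2] := Hf; have [g1 g2] := Hg; split=> [x Ux|v].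
  by apply: differentiableM; [exact: f1|exact: g1].
apply: (@Ck_ext _ _ _ _ (fun x => f x * 'D_v g x + g x * 'D_v f x)) => //.
  by move=> x Ux; rewrite deriveM //; apply: diff_derivable; [exact: f1|exact: g1].
by apply: CkD => //; apply: IH => //; [exact: Ck_le|exact: g2|exact: Ck_le|exact: f2].
Qed.

Lemma CkV V k (U : set V) (f : V -> R) : open U ->
  (forall x, U x -> f x != 0) -> Ck k U f -> Ck k U (fun x => (f x)^-1).
Proof.
move=> oU f0; elim: k => [|k IH].
  by move=> Hf x Ux; apply: continuousV; [exact: f0|exact: Hf].
move=> Hf; have [f1 f2] := Hf; split=> [x Ux|v].
  by apply: differentiableV; [exact: f1|exact: f0].
apply: (@Ck_ext _ _ _ _ (fun x => -1 * ((f x)^-1 * (f x)^-1) * 'D_v f x)) => //.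
  move=> x Ux; rewrite deriveV //; [|exact: f0|apply: diff_derivable; exact: f1].
  by rewrite -expr2 -exprVn mulN1r.
apply: CkM (f2 v) => //; apply: CkM => //; first exact: Ck_cst.
by apply: CkM => //; apply: IH; exact: Ck_le.
Qed.

(* An ODE h' = q h^-1 or h' = a h / x: a function of one variable whose derivative is
   expressed through itself composes smoothly. *)
Lemma Ck_comp1 V k (U : set V) (f : V -> R) (h dh : R -> R) : open U ->
  (forall x, U x -> is_derive (f x) (1 : R) h (dh (f x))) ->
  (forall k, Ck k U f -> Ck k U (h \o f) -> Ck k U (dh \o f)) ->
  Ck k U f -> Ck k U (h \o f).
Proof.
move=> oU Hh Hdh; have dh1 x : U x -> differentiable h (f x).
  by move=> Ux; apply/derivable1_diffP; have [] := Hh x Ux.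
elim: k => [|k IH].
  move=> Hf x Ux; apply: continuous_comp; first exact: Hf.
  by apply: differentiable_continuous; exact: dh1.
move=> Hf; have [f1 f2] := Hf; split=> [x Ux|v].
  by apply: differentiable_comp; [exact: f1|exact: dh1].
apply: (@Ck_ext _ _ _ _ (fun x => dh (f x) * 'D_v f x)) => //; last first.
  apply: CkM (f2 v) => //; apply: Hdh; first exact: Ck_le.
  by apply: IH; exact: Ck_le.
move=> x Ux; have dfx := f1 x Ux; have dhx := dh1 x Ux.
rewrite !deriveE //; last exact: differentiable_comp.
have [Dh Eh] := Hh x Ux.
transitivity ('d h (f x) ('d f x v)); last first.
  exact/esym/(congr1 (@^~ v) (diff_comp dfx dhx)).
transitivity ('d f x v *: derive1 h (f x)); first by rewrite derive1E Eh mulrC.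
exact/esym/(congr1 (@^~ _) (deriv1E Dh)).
Qed.

Lemma Ck_sqrt V k (U : set V) (f : V -> R) : open U ->
  (forall x, U x -> 0 < f x) -> Ck k U f -> Ck k U (fun x => Num.sqrt (f x)).
Proof.
move=> oU f0; apply: (@Ck_comp1 _ _ _ _ _ (fun y => (2 * Num.sqrt y)^-1)) => //.
  by move=> x Ux; exact: is_derive1_sqrt (f0 x Ux).
move=> {}k _ Hs; apply: CkV => //; last by apply: CkM => //; exact: Ck_cst.
by move=> x Ux; rewrite mulf_neq0 // gt_eqF // sqrtr_gt0 f0.
Qed.

Lemma Ck_powR V k (U : set V) (f : V -> R) a : open U ->
  (forall x, U x -> 0 < f x) -> Ck k U f -> Ck k U (fun x => f x `^ a).
Proof.
move=> oU f0.
have /= := @Ck_comp1 V k U f (fun y => y `^ a) (fun y => a * (y `^ a * y^-1)) oU.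
apply => //.
  move=> x Ux; have := is_derive1_powR a (f0 x Ux).
  by rewrite powRB ?(gt_eqF (f0 _ Ux)) ?implybT// powRr1 // ltW // f0.
move=> {}k Hf Hs; apply: CkM => //; first exact: Ck_cst.
by apply: CkM => //; apply: CkV => // x /f0/gt_eqF/negbT.
Qed.

Lemma sm_cst V W (U : set V) (c : W) : smooth_on U (fun=> c).
Proof. by move=> k; exact: Ck_cst. Qed.

Lemma sm_lin V W (U : set V) (L : {linear V -> W}) :
  continuous L -> smooth_on U L.
Proof. by move=> cL k; exact: Ck_lin. Qed.

Section OpenDomain.
Variables (V : normedModType R) (U : set V).
Hypothesis oU : open U.

Lemma smD W (f g : V -> W) : smooth_on U f -> smooth_on U g ->
  smooth_on U (fun x => f x + g x).
Proof. by move=> Hf Hg k; exact: CkD. Qed.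

Lemma sm_linc W W' (f : V -> W) (L : {linear W -> W'}) :
  continuous L -> smooth_on U f -> smooth_on U (fun x => L (f x)).
Proof. by move=> cL Hf k; exact: Ck_linc. Qed.

Lemma smN W (f : V -> W) : smooth_on U f -> smooth_on U (fun x => - f x).
Proof.
by move=> Hf; apply: (sm_linc (L := -%R)) => //; exact: opp_continuous.
Qed.

Lemma smB W (f g : V -> W) : smooth_on U f -> smooth_on U g ->
  smooth_on U (fun x => f x - g x).
Proof. by move=> Hf Hg; apply: smD => //; exact: smN. Qed.

Lemma smM (f g : V -> R) : smooth_on U f -> smooth_on U g ->
  smooth_on U (fun x => f x * g x).
Proof. by move=> Hf Hg k; exact: CkM. Qed.

Lemma smX (f : V -> R) n : smooth_on U f -> smooth_on U (fun x => f x ^+ n).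
Proof.
move=> Hf; elim: n => [|n IH]; first exact: sm_cst.
by under eq_fun do rewrite exprS; exact: smM.
Qed.

Lemma smV (f : V -> R) : (forall x, U x -> f x != 0) -> smooth_on U f ->
  smooth_on U (fun x => (f x)^-1).
Proof. by move=> f0 Hf k; exact: CkV. Qed.

Lemma sm_sqrt (f : V -> R) : (forall x, U x -> 0 < f x) -> smooth_on U f ->
  smooth_on U (fun x => Num.sqrt (f x)).
Proof. by move=> f0 Hf k; exact: Ck_sqrt. Qed.

Lemma sm_powR (f : V -> R) a : (forall x, U x -> 0 < f x) -> smooth_on U f ->
  smooth_on U (fun x => f x `^ a).
Proof. by move=> f0 Hf k; exact: Ck_powR. Qed.

Lemma sm_sum W I (r : seq I) (P : pred I) (f : I -> V -> W) :
  (forall i, P i -> smooth_on U (f i)) ->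
  smooth_on U (fun x => \sum_(i <- r | P i) f i x).
Proof.
move=> Hf; elim: r => [|i r IH].
  by under eq_fun do rewrite big_nil; exact: sm_cst.
under eq_fun do rewrite big_cons.
case: (boolP (P i)) => // Pi.
by apply: smD => //; exact: Hf.
Qed.

Lemma sm_linf W W' (f : V -> W) (L : W -> W') : linear L ->
  continuous L -> smooth_on U f -> smooth_on U (fun x => L (f x)).
Proof.
move=> lL; pose L' : {linear W -> W'} := HB.pack L (GRing.isLinear.Build _ _ _ _ L lL).
exact: (@sm_linc _ _ _ L').
Qed.

Lemma sm_scale W (f : V -> R) (w : W) : smooth_on U f ->
  smooth_on U (fun x => f x *: w).
Proof.
apply: (@sm_linf R W f ( *:%R^~ w)).
  by move=> a u v; rewrite scalerDl scalerA.
by move=> r; apply: continuousZr_tmp; exact: cvg_id.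
Qed.

Lemma sm_pair W W' (f : V -> W) (g : V -> W') : smooth_on U f -> smooth_on U g ->
  smooth_on U (fun x => (f x, g x)).
Proof.
move=> Hf Hg; rewrite (_ : (fun x => _) =
    (fun x => (f x, 0 : W') + (0 : W, g x))); last first.
  by apply/funext => x; congr pair; rewrite ?addr0 ?add0r.
apply: smD.
  apply: (@sm_linf W _ f (fun y => (y, 0))) Hf => [a u v|y].
    by rewrite -[RHS]/(_, _) /= scaler0 addr0.
  by apply: cvg_pair; [exact: cvg_id|exact: cvg_cst].
apply: (@sm_linf W' _ g (fun y => (0, y))) Hg => [a u v|y].
  by rewrite -[RHS]/(_, _) /= scaler0 addr0.
by apply: cvg_pair; [exact: cvg_cst|exact: cvg_id].
Qed.

Lemma sm_mx m n (f : V -> 'M[R]_(m, n)) :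
  (forall i j, smooth_on U (fun x => f x i j)) -> smooth_on U f.
Proof.
move=> Hf; rewrite (_ : f = fun x => \sum_i \sum_j f x i j *: delta_mx i j).
  by apply: sm_sum => i _; apply: sm_sum => j _; exact: sm_scale.
by apply/funext => x; exact: matrix_sum_delta.
Qed.

Lemma sm_entry m n (f : V -> 'M[R]_(m, n)) i j :
  smooth_on U f -> smooth_on U (fun x => f x i j).
Proof.
apply: (@sm_linf _ R f (fun A => A i j)); last exact: coord_continuous.
by move=> a A B; rewrite !mxE.
Qed.

Lemma sm_fst W W' (f : V -> W * W') : smooth_on U f -> smooth_on U (fun x => (f x).1).
Proof.
by apply: (@sm_linf _ W f fst) => // y; exact: cvg_fst.
Qed.

Lemma sm_snd W W' (f : V -> W * W') : smooth_on U f -> smooth_on U (fun x => (f x).2).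
Proof.
by apply: (@sm_linf _ W' f snd) => // y; exact: cvg_snd.
Qed.

Lemma sm_id : smooth_on U (@id V).
Proof. by apply: (@sm_lin _ _ _ idfun) => x; exact: cvg_id. Qed.

Lemma sm_ext W (f g : V -> W) : (forall x, U x -> f x = g x) ->
  smooth_on U f -> smooth_on U g.
Proof. by move=> fg Hf k; exact: Ck_ext (Hf k). Qed.

Lemma sm_sub W U' (f : V -> W) : U `<=` U' -> smooth_on U' f -> smooth_on U f.
Proof. by move=> UU Hf k; exact: Ck_sub (Hf k). Qed.

Lemma sm_diff W (f : V -> W) x : smooth_on U f -> U x -> differentiable f x.
Proof. by move=> /(_ 1)[+ _] Ux; exact. Qed.

Lemma sm_cont W (f : V -> W) x : smooth_on U f -> U x -> {for x, continuous f}.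
Proof. by move=> /(_ 0) + Ux; exact. Qed.

End OpenDomain.

End SmoothCalculus.

(** * Quaternionic matrices and the space p *)

Section Quaternions.
Variable R : realType.
Local Notation H := (quat R).
Local Notation M2 := 'M[quat R]_2.
Local Notation H2 := 'cV[quat R]_2.
Implicit Types x y q : H.

Lemma quat_ext x y : qr x = qr y -> qi x = qi y -> qj x = qj y -> qk x = qk y ->
  x = y.
Proof. by case: x y => [????] [????] /= -> -> -> ->. Qed.

Lemma qrM x y : qr (x * y) = qr x * qr y - qi x * qi y - qj x * qj y - qk x * qk y.
Proof. by []. Qed.
Lemma qiM x y : qi (x * y) = qr x * qi y + qi x * qr y + qj x * qk y - qk x * qj y.
Proof. by []. Qed.
Lemma qjM x y : qj (x * y) = qr x * qj y - qi x * qk y + qj x * qr y + qk x * qi y.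
Proof. by []. Qed.
Lemma qkM x y : qk (x * y) = qr x * qk y + qi x * qj y - qj x * qi y + qk x * qr y.
Proof. by []. Qed.
Lemma qrD x y : qr (x + y) = qr x + qr y. Proof. by []. Qed.
Lemma qiD x y : qi (x + y) = qi x + qi y. Proof. by []. Qed.
Lemma qjD x y : qj (x + y) = qj x + qj y. Proof. by []. Qed.
Lemma qkD x y : qk (x + y) = qk x + qk y. Proof. by []. Qed.
Lemma qrN x : qr (- x) = - qr x. Proof. by []. Qed.
Lemma qiN x : qi (- x) = - qi x. Proof. by []. Qed.
Lemma qjN x : qj (- x) = - qj x. Proof. by []. Qed.
Lemma qkN x : qk (- x) = - qk x. Proof. by []. Qed.
Lemma qr0 : qr (0 : H) = 0. Proof. by []. Qed.
Lemma qi0 : qi (0 : H) = 0. Proof. by []. Qed.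
Lemma qj0 : qj (0 : H) = 0. Proof. by []. Qed.
Lemma qk0 : qk (0 : H) = 0. Proof. by []. Qed.
Lemma qr1 : qr (1 : H) = 1. Proof. by []. Qed.
Lemma qi1 : qi (1 : H) = 0. Proof. by []. Qed.
Lemma qj1 : qj (1 : H) = 0. Proof. by []. Qed.
Lemma qk1 : qk (1 : H) = 0. Proof. by []. Qed.
Lemma qrC x : qr (qconj x) = qr x. Proof. by []. Qed.
Lemma qiC x : qi (qconj x) = - qi x. Proof. by []. Qed.
Lemma qjC x : qj (qconj x) = - qj x. Proof. by []. Qed.
Lemma qkC x : qk (qconj x) = - qk x. Proof. by []. Qed.
Lemma qrQ (c : R) : qr (qre c) = c. Proof. by []. Qed.
Lemma qiQ (c : R) : qi (qre c) = 0. Proof. by []. Qed.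
Lemma qjQ (c : R) : qj (qre c) = 0. Proof. by []. Qed.
Lemma qkQ (c : R) : qk (qre c) = 0. Proof. by []. Qed.

Definition qE := (qrM, qiM, qjM, qkM, qrD, qiD, qjD, qkD, qrN, qiN, qjN, qkN,
  qr0, qi0, qj0, qk0, qr1, qi1, qj1, qk1, qrC, qiC, qjC, qkC, qrQ, qiQ, qjQ, qkQ).

Lemma qconjD x y : qconj (x + y) = qconj x + qconj y.
Proof. by apply: quat_ext; rewrite !qE; ring. Qed.
Lemma qconjN x : qconj (- x) = - qconj x.
Proof. by apply: quat_ext; rewrite !qE; ring. Qed.
Lemma qconjM x y : qconj (x * y) = qconj y * qconj x.
Proof. by apply: quat_ext; rewrite !qE; ring. Qed.
Lemma qconjK x : qconj (qconj x) = x.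
Proof. by apply: quat_ext; rewrite !qE; ring. Qed.
Lemma qconj0 : qconj (0 : H) = 0.
Proof. by apply: quat_ext; rewrite !qE; ring. Qed.
Lemma qconj1 : qconj (1 : H) = 1.
Proof. by apply: quat_ext; rewrite !qE; ring. Qed.
Lemma qconjQ (c : R) : qconj (qre c) = qre c.
Proof. by apply: quat_ext; rewrite !qE; ring. Qed.
Lemma qreC (c : R) x : x * qre c = qre c * x.
Proof. by apply: quat_ext; rewrite !qE; ring. Qed.
Lemma qreM (c d : R) : qre (c * d) = qre c * qre d.
Proof. by apply: quat_ext; rewrite !qE; ring. Qed.
Lemma qreD (c d : R) : qre (c + d) = qre c + qre d.
Proof. by apply: quat_ext; rewrite !qE; ring. Qed.
Lemma qre1 : qre 1 = 1 :> H. Proof. by []. Qed.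

Definition qnorm2 x : R := qr x ^+ 2 + qi x ^+ 2 + qj x ^+ 2 + qk x ^+ 2.

Lemma qmulCr x : x * qconj x = qre (qnorm2 x).
Proof. by apply: quat_ext; rewrite /qnorm2 !qE; ring. Qed.
Lemma qmulCl x : qconj x * x = qre (qnorm2 x).
Proof. by apply: quat_ext; rewrite /qnorm2 !qE; ring. Qed.
Lemma qnorm2M x y : qnorm2 (x * y) = qnorm2 x * qnorm2 y.
Proof. by rewrite /qnorm2 !qE; ring. Qed.
Lemma qnorm2C x : qnorm2 (qconj x) = qnorm2 x.
Proof. by rewrite /qnorm2 !qE; ring. Qed.
Lemma qnorm2_ge0 x : 0 <= qnorm2 x.
Proof. by rewrite /qnorm2 !addr_ge0 ?sqr_ge0. Qed.
Lemma qnorm2_eq0 x : (qnorm2 x == 0) = (x == 0).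
Proof.
apply/eqP/eqP => [|->]; last by rewrite /qnorm2 !qE; ring.
rewrite /qnorm2 => h; have := (sqr_ge0 (qr x), sqr_ge0 (qi x), sqr_ge0 (qj x), sqr_ge0 (qk x)).
move=> [[[h1 h2] h3] h4].
by apply: quat_ext; rewrite ?qE; apply/eqP; rewrite -sqrf_eq0; apply/eqP; lra.
Qed.

Lemma qreal x : qi x = 0 -> qj x = 0 -> qk x = 0 -> x = qre (qr x).
Proof. by move=> ? ? ?; exact: quat_ext. Qed.

Lemma qreI : injective (@qre R).
Proof. by move=> a b []. Qed.

Lemma unitqP x : x * qconj x = 1 <-> qnorm2 x = 1.
Proof. by rewrite qmulCr -qre1; split=> [/qreI|->]. Qed.

Lemma ord2P (i : 'I_2) : i = 0 \/ i = 1.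
Proof. by case: i => [[|[|//]] ?]; [left|right]; exact/val_inj. Qed.

Lemma mulmx2E m n (A : 'M[H]_(m, 2)) (B : 'M[H]_(2, n)) i j :
  (A *m B) i j = A i 0 * B 0 j + A i 1 * B 1 j.
Proof.
rewrite mxE !big_ord_recl big_ord0 addr0; congr (_ + A i _ * B _ j); exact/val_inj.
Qed.

Lemma tr2E (A : M2) : \tr A = A 0 0 + A 1 1.
Proof. by rewrite /mxtrace !big_ord_recl big_ord0 addr0; congr (_ + A _ _); exact/val_inj. Qed.

Lemma mx2_00 (a b c d : H) : mx2 a b c d 0 0 = a. Proof. by rewrite mxE. Qed.
Lemma mx2_01 (a b c d : H) : mx2 a b c d 0 1 = b. Proof. by rewrite mxE. Qed.
Lemma mx2_10 (a b c d : H) : mx2 a b c d 1 0 = c. Proof. by rewrite mxE. Qed.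
Lemma mx2_11 (a b c d : H) : mx2 a b c d 1 1 = d. Proof. by rewrite mxE. Qed.
Definition mx2E := (mx2_00, mx2_01, mx2_10, mx2_11).

Lemma mx2_ext (A B : M2) : A 0 0 = B 0 0 -> A 0 1 = B 0 1 -> A 1 0 = B 1 0 ->
  A 1 1 = B 1 1 -> A = B.
Proof.
by move=> ? ? ? ?; apply/matrixP => i j; case: (ord2P i) (ord2P j) => -> [] ->.
Qed.

Lemma cv2_ext (x y : H2) : x 0 0 = y 0 0 -> x 1 0 = y 1 0 -> x = y.
Proof.
by move=> ? ?; apply/matrixP => i j; rewrite !ord1; case: (ord2P i) => ->.
Qed.

Lemma adjmE m n (A : 'M[H]_(m, n)) i j : adjm A i j = qconj (A j i).
Proof. by rewrite !mxE. Qed.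

Lemma addmxE m n (A B : 'M[H]_(m, n)) i j : (A + B) i j = A i j + B i j.
Proof. by rewrite mxE. Qed.
Lemma oppmxE m n (A : 'M[H]_(m, n)) i j : (- A) i j = - A i j.
Proof. by rewrite mxE. Qed.
Lemma scalemxE m n (a : H) (A : 'M[H]_(m, n)) i j : (a *: A) i j = a * A i j.
Proof. by rewrite mxE. Qed.
Lemma zeromxE m n i j : (0 : 'M[H]_(m, n)) i j = 0.
Proof. by rewrite mxE. Qed.
Lemma id00 : (1%:M : M2) 0 0 = 1. Proof. by rewrite mxE. Qed.
Lemma id01 : (1%:M : M2) 0 1 = 0. Proof. by rewrite mxE. Qed.
Lemma id10 : (1%:M : M2) 1 0 = 0. Proof. by rewrite mxE. Qed.
Lemma id11 : (1%:M : M2) 1 1 = 1. Proof. by rewrite mxE. Qed.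
Lemma o7_0 : o7 R 0 0 = 0. Proof. by rewrite mxE. Qed.
Lemma o7_1 : o7 R 1 0 = 1. Proof. by rewrite mxE. Qed.
Definition mxsE := (mulmx2E, adjmE, addmxE, oppmxE, scalemxE, zeromxE, mx2E,
  id00, id01, id10, id11, o7_0, o7_1).

Lemma ip2E (A B : M2) : ip A B = qr (A 0 0 * qconj (B 0 0)) + qr (A 0 1 * qconj (B 0 1))
  + (qr (A 1 0 * qconj (B 1 0)) + qr (A 1 1 * qconj (B 1 1))).
Proof. by rewrite /ip tr2E !mxsE. Qed.

Lemma ip1E (x y : H2) : ip x y = qr (x 0 0 * qconj (y 0 0)) + qr (x 1 0 * qconj (y 1 0)).
Proof.
rewrite /ip /mxtrace !big_ord_recl big_ord0 addr0 !mxE !big_ord1 !adjmE.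
by congr (qr _ + qr (x _ _ * qconj (y _ _))); exact/val_inj.
Qed.

Lemma adjmM m n p (A : 'M[H]_(m, n)) (B : 'M[H]_(n, p)) :
  adjm (A *m B) = adjm B *m adjm A.
Proof.
apply/matrixP => i j; rewrite adjmE !mxE.
rewrite (big_morph (@qconj R) qconjD qconj0); apply: eq_bigr => k _.
by rewrite qconjM !adjmE.
Qed.
Lemma adjmK m n (A : 'M[H]_(m, n)) : adjm (adjm A) = A.
Proof. by apply/matrixP => i j; rewrite !adjmE qconjK. Qed.
Lemma adjm1 : adjm (1%:M : M2) = 1%:M.
Proof. by apply: mx2_ext; rewrite !mxsE ?qconj0 ?qconj1. Qed.

(* (q, d) is the second column, i.e., the image of the base point o. *)
Definition pmat (q d : H) : M2 := mx2 0 q (- qconj q) d.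

(** Skew-Hermitian symmetry ties the off-diagonal entries together and makes the diagonal imaginary;
    orthogonality to diag(b, 0) for b = i, j, k kills the upper left entry. *)
Lemma ppP (v : M2) : pp v <-> exists q d, qr d = 0 /\ v = pmat q d.
Proof.
split=> [[sv vo]|[q [d [d0 ->]]]]; last first.
  split.
    apply: mx2_ext; rewrite !mxsE ?qconjN ?qconjK ?qconj0 ?addr0 ?subrr ?addNr //.
    by apply: quat_ext; rewrite !qE ?d0; ring.
  move=> _ [b b0 <-]; rewrite ip2E !mxsE.
  by rewrite !qE; ring.
exists (v 0 1), (v 1 1).
have e i j : v i j + qconj (v j i) = 0.
  by move: sv => /(congr1 (fun A : M2 => A i j)); rewrite !mxsE.
have e11 := congr1 (@qr R) (e 1 1); rewrite !qE in e11.
split; first by lra.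
apply: mx2_ext; rewrite !mxsE //; last by apply/eqP; rewrite -addr_eq0 e.
have e00 := congr1 (@qr R) (e 0 0); rewrite !qE in e00.
have H (a b c : R) : ip v (mx2 (Quat 0 a b c) 0 0 0) = 0.
  apply: vo; exists (Quat 0 a b c) => //.
  by rewrite /=; apply: quat_ext; rewrite !qE /=; ring.
have := H 1 0 0; have := H 0 1 0; have := H 0 0 1.
rewrite !ip2E !mxsE !qE /= => *; apply: quat_ext; rewrite !qE; lra.
Qed.

Lemma sqrt2_gt0 : 0 < Num.sqrt (2 : R).
Proof. by rewrite sqrtr_gt0 ltr0n. Qed.
Lemma sqrt2_sqr : Num.sqrt (2 : R) * Num.sqrt 2 = 2.
Proof. by rewrite -expr2 sqr_sqrtr // ler0n. Qed.
Lemma sqrt2_inv : (Num.sqrt (2 : R))^-1 = Num.sqrt 2 / 2.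
Proof.
by rewrite -[X in _ / X]sqrt2_sqr invfM mulrA divff ?mul1r // gt_eqF ?sqrt2_gt0.
Qed.

(** Coordinates are numbered from 0, so [co i] is e^(i+1). Unlike [de], they are not truncated to p
    and stay linear on all matrices. *)
Definition co (i : nat) (v : M2) : R := ip v (bas R i.+1).

(** The factor sqrt 2 appears because both off-diagonal entries pair with the normalizing 1 / sqrt
    2. *)
Lemma co_pmat i q d : qr d = 0 -> co i (pmat q d) =
  nth 0 [:: qi d; qj d; qk d; Num.sqrt 2 * qi q; Num.sqrt 2 * qj q; Num.sqrt 2 * qk q;
            Num.sqrt 2 * qr q] i.
Proof.
move=> d0; rewrite /co.
do 7?[case: i => [|i]; first by rewrite /bas /= ip2E !mxsE !qE /= ?sqrt2_inv; field].
rewrite /bas nth_default // ip2E !mxsE !qE nth_default //; ring.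
Qed.

Lemma pmat_pp q d : qr d = 0 -> pp (pmat q d).
Proof. by move=> d0; apply/ppP; exists q, d. Qed.

End Quaternions.

(* Unlike [\sum_(i < n)], this sum computes. *)
Fixpoint nsum (R : nmodType) n (F : nat -> R) : R :=
  if n is m.+1 then nsum m F + F m else 0.

Lemma nsumE (R : nmodType) n (F : nat -> R) : \sum_(i < n) F i = nsum n F.
Proof. by elim: n => [|n IH]; rewrite ?big_ord0 // big_ord_recr IH. Qed.

Lemma eq_nsum (R : nmodType) n (F G : nat -> R) :
  (forall i, (i < n)%N -> F i = G i) -> nsum n F = nsum n G.
Proof.
elim: n => //= n IH FG; rewrite FG // IH // => i lin; exact/FG/ltnW.
Qed.

Lemma mulr_nsumr (R : nzRingType) n (c : R) (F : nat -> R) :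
  c * nsum n F = nsum n (fun i => c * F i).
Proof. by elim: n => [|n IH] /=; rewrite ?mulr0 // mulrDr IH. Qed.

(** * Alternating forms and the bilinear form B *)

Section AlternatingSums.
Variables (R : realType) (T : Type) (x0 : T).
Implicit Types (L : seq T) (G : seq T -> R).

Definition delnth i L := take i L ++ drop i.+1 L.

(** The signed sum of G over all orderings of L, by recursion on the entry put last: moving entry i
    past the m - i entries after it has sign (-1) ^ (m + i). Unlike a sum over permutations, it
    computes. *)
Fixpoint altsum n L G : R :=
  if n is m.+1 then
    foldr (fun i acc => (-1) ^+ (m + i) *
      altsum m (delnth i L) (fun l => G (rcons l (nth x0 L i))) + acc) 0 (iota 0 n)
  else G [::].

Lemma altsumS m L G : altsum m.+1 L G =
  \sum_(i < m.+1) (-1) ^+ (m + i) *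
      altsum m (delnth i L) (fun l => G (rcons l (nth x0 L i))).
Proof.
rewrite -(big_mkord xpredT (fun i => (-1) ^+ (m + i) *
      altsum m (delnth i L) (fun l => G (rcons l (nth x0 L i))))).
by rewrite /index_iota subn0 unlock.
Qed.

Lemma altsum_nsum m L G : altsum m.+1 L G =
  nsum m.+1 (fun i => (-1) ^+ (m + i) *
      altsum m (delnth i L) (fun l => G (rcons l (nth x0 L i)))).
Proof. by rewrite altsumS -nsumE. Qed.

Lemma nth_delnth i j L : nth x0 (delnth i L) j = nth x0 L (bump i j).
Proof.
rewrite /delnth nth_cat size_take.
case: (ltnP i (size L)) => [iL|Li]; last first.
  rewrite drop_oversize ?take_oversize ?(leq_trans Li) // /bump.
  case: ltnP => [jL|Lj]; first by rewrite leqNgt (leq_trans jL Li).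
  by rewrite nth_nil nth_default // (leq_trans Lj) ?leq_addl.
rewrite /bump; case: (ltnP j i) => ij; first by rewrite nth_take.
by rewrite nth_drop addSn subnKC.
Qed.

(** Lifting permutations of n points is a bijection onto the permutations with s i0 = j0; [ulsf]
    gives its inverse, deleting i0 and its image. *)
Lemma sum_lift_perm n i0 j0 (F : 'S_n.+1 -> R) :
  \sum_(s : 'S_n.+1 | s i0 == j0) F s = \sum_(s : 'S_n) F (lift_perm i0 j0 s).
Proof.
rewrite (reindex (lift_perm i0 j0)); last first.
  pose ulsf i (s : 'S_n.+1) k := odflt k (unlift (s i) (s (lift i k))).
  have ulsfK i (s : 'S_n.+1) k: lift (s i) (ulsf i s k) = s (lift i k).
    rewrite /ulsf; have:= neq_lift i k.
    by rewrite -(can_eq (permK s)) => /unlift_some[] ? ? ->.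
  have inj_ulsf: injective (ulsf i0 _).
    move=> s; apply: can_inj (ulsf (s i0) s^-1%g) _ => k'.
    by rewrite {1}/ulsf ulsfK !permK liftK.
  exists (fun s => perm (inj_ulsf s)) => [s _ | s].
    by apply/permP=> k'; rewrite permE /ulsf lift_perm_lift lift_perm_id liftK.
  move/(s _ =P _) => si0; apply/permP=> k.
  case: (unliftP i0 k) => [k'|] ->; rewrite ?lift_perm_id //.
  by rewrite lift_perm_lift -si0 permE ulsfK.
by apply: eq_bigl => s; rewrite lift_perm_id eqxx.
Qed.

(** Permutations are grouped by the image of the last index; [lift_perm] turns each group into the
    permutations of the remaining entries. *)
Lemma altsumE n L G : size L = n ->
  \sum_(w : 'S_n) (-1) ^+ w * G [seq nth x0 L (w i) | i <- enum 'I_n] = altsum n L G.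
Proof.
elim: n L G => [|n IH] L G sL.
  rewrite (big_pred1 (1%g : 'S_0)) => [|s]; last by apply/esym/eqP/permP; case.
  by rewrite odd_perm1 mul1r enum_ord0.
rewrite altsumS (partition_big (fun w : 'S_n.+1 => w ord_max) xpredT) //=.
apply: eq_bigr => i _; rewrite -IH; last first.
  by rewrite size_cat size_take size_drop sL ltn_ord subSS subnKC // -ltnS.
rewrite sum_lift_perm mulr_sumr; apply: eq_bigr => s _.
rewrite enum_ordSr map_rcons lift_perm_id -map_comp odd_lift_perm.
rewrite !signr_addb !signr_odd exprD !mulrA; congr (_ * G (rcons _ _)).
apply: eq_map => j /=; rewrite nth_delnth.
rewrite (_ : widen_ord _ j = lift ord_max j) ?lift_perm_lift //.
by apply: val_inj; rewrite /= /bump leqNgt ltn_ord.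
Qed.

End AlternatingSums.

(** * Wedge products as alternating sums over sequences *)

Section Wedges.
Variables (R : realType) (V : Type).

(** The value of a tensor on a list, so that [altsum] applies; missing entries are read as x0. *)
Definition tseq (k : nat) (x0 : V) (t : tensor R V k) (l : seq V) : R :=
  t (fun i => nth x0 l i).

Lemma wedge_altsum p q (s : tensor R V p) (t : tensor R V q) (x0 : V) (l : seq V) :
  size l = (p + q)%N ->
  tseq x0 (wedge s t) l = (p`! * q`!)%:R^-1 *
    altsum x0 (p + q) l (fun l => tseq x0 s (take p l) * tseq x0 t (drop p l)).
Proof.
move=> sl; rewrite -altsumE // /tseq /wedge; congr (_ * _).
apply: eq_bigr => w _; rewrite -mulrA; congr (_ * (s _ * t _)).
  apply/funext => i; rewrite nth_take //.
  rewrite -[RHS]/(nth x0 _ (val (lshift q i))) (nth_map (lshift q i)) ?nth_ord_enum //.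
  by rewrite size_enum_ord ltn_ord.
apply/funext => i; rewrite nth_drop.
rewrite -[RHS]/(nth x0 _ (val (rshift p i))) (nth_map (rshift p i)) ?nth_ord_enum //.
by rewrite size_enum_ord ltn_ord.
Qed.

Lemma tseqE k (x0 : V) (t : tensor R V k) v : t v = tseq x0 t (codom v).
Proof.
rewrite /tseq; congr t; apply/funext => i.
by rewrite codomE (nth_map i) ?nth_ord_enum // size_enum_ord.
Qed.

End Wedges.

(** * The form B as a sum over shuffles *)

Section BformExpansion.
Variable R : realType.
Local Notation M2 := 'M[quat R]_2.
Implicit Types (phi : tensor R M2 3) (s t : tensor R M2 2).

(** By antisymmetry of f and g the 24 orderings fall into six (2,2)-shuffles, each counted 2! 2! = 4
    times. *)
Lemma altsum4 (T : Type) (x0 : T) (f g : T -> T -> R) (a b c d : T) :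
  (forall x y, f y x = - f x y) -> (forall x y, g y x = - g x y) ->
  altsum x0 4 [:: a; b; c; d]
    (fun l => f (nth x0 l 0) (nth x0 l 1) * g (nth x0 l 2) (nth x0 l 3)) =
  4 * (f a b * g c d - f a c * g b d + f a d * g b c
       + f b c * g a d - f b d * g a c + f c d * g a b).
Proof.
move=> fC gC; rewrite /altsum /=.
rewrite (fC a b) (fC a c) (fC a d) (fC b c) (fC b d) (fC c d).
rewrite (gC a b) (gC a c) (gC a d) (gC b c) (gC b d) (gC c d).
ring.
Qed.

(** The wedge product of two 2-forms, summed over the six (2,2)-shuffles. *)
Definition wedge22 (V : Type) (f g : V -> V -> R) (a b c d : V) : R :=
  f a b * g c d - f a c * g b d + f a d * g b c
       + f b c * g a d - f b d * g a c + f c d * g a b.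

(** [wedge22] is alternating, so the 24 orderings contribute equally. *)
Lemma altsum4_wedge22 (T : Type) (x0 : T) (f g : T -> T -> R) (a b c d : T) :
  (forall x y, f y x = - f x y) -> (forall x y, g y x = - g x y) ->
  altsum x0 4 [:: a; b; c; d]
    (fun l => wedge22 f g (nth x0 l 0) (nth x0 l 1) (nth x0 l 2) (nth x0 l 3)) =
  24 * wedge22 f g a b c d.
Proof.
move=> fC gC; rewrite /altsum /= /wedge22.
rewrite (fC a b) (fC a c) (fC a d) (fC b c) (fC b d) (fC c d).
rewrite (gC a b) (gC a c) (gC a d) (gC b c) (gC b d) (gC c d).
ring.
Qed.

Lemma altsum_ext (T : Type) (x0 : T) n (L : seq T) (G G' : seq T -> R) : size L = n ->
  (forall l, size l = n -> G l = G' l) -> altsum x0 n L G = altsum x0 n L G'.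
Proof.
move=> sL GG; rewrite -!altsumE //; apply: eq_bigr => w _.
by rewrite GG // size_map size_enum_ord.
Qed.

Lemma altsumZ (T : Type) (x0 : T) n (L : seq T) (G : seq T -> R) c : size L = n ->
  altsum x0 n L (fun l => G l * c) = altsum x0 n L G * c.
Proof.
by move=> sL; rewrite -!altsumE // mulr_suml; apply: eq_bigr => w _; rewrite mulrA.
Qed.

Lemma size_delnth (T : Type) n i (L : seq T) : size L = n.+1 -> (i < n.+1)%N ->
  size (delnth i L) = n.
Proof. by move=> sL iL; rewrite size_cat size_take size_drop sL iL subSS subnKC. Qed.

Definition ev3 phi (u a b : M2) : R := tseq 0 phi [:: u; a; b].
Definition ebas (a : nat) : M2 := bas R a.+1.

Definition E7 : seq M2 := [seq ebas a | a <- iota 0 7].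

(** The 4-form made of f and g, wedged with h: only the entries given to h are chosen, in order,
    while the four left over are not permuted. This leaves 7 * 6 * 5 terms instead of 5040. *)
Definition shuffle_sum (T : Type) (x0 : T) (L : seq T) (f g : T -> T -> R)
    (h : T -> T -> T -> R) : R :=
  nsum 7 (fun i => (-1) ^+ (6 + i) * nsum 6 (fun j => (-1) ^+ (5 + j) *
  nsum 5 (fun k => (-1) ^+ (4 + k) *
    let L1 := delnth i L in let L2 := delnth j L1 in let L3 := delnth k L2 in
    (wedge22 f g (nth x0 L3 0) (nth x0 L3 1) (nth x0 L3 2) (nth x0 L3 3) *
     h (nth x0 L2 k) (nth x0 L1 j) (nth x0 L i))))).

(** The wedge of the two contractions is exactly [wedge22], since its normalization 1/4 cancels the
    4 of [altsum4]. In the outer wedge 1 / (4! 3!) meets the 24 of [altsum4_wedge22], which leaves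
    1/6. *)
Lemma Bform_shuffle phi u v : (forall x a b, ev3 phi x b a = - ev3 phi x a b) ->
  Bform phi u v = 6^-1 * shuffle_sum 0 E7 (ev3 phi u) (ev3 phi v) (ev3 phi).
Proof.
move=> aC; have sE : size E7 = 7%N by [].
have cE x a b : tseq 0 (Defs.contract x phi) [:: a; b] = ev3 phi x a b.
  rewrite /ev3 /tseq /Defs.contract; congr phi; apply/funext => i.
  by case: (unliftP ord0 i) => [j ->|->].
have w22 l : size l = 4%N -> tseq 0 (wedge (Defs.contract u phi) (Defs.contract v phi)) l =
   wedge22 (ev3 phi u) (ev3 phi v) (nth 0 l 0) (nth 0 l 1) (nth 0 l 2) (nth 0 l 3).
  move=> sl; rewrite wedge_altsum //.
  case: l sl => [|a [|b [|c [|d [|]]]]] // sl.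
  rewrite (altsum_ext _ (G' := fun l => ev3 phi u (nth 0 l 0) (nth 0 l 1) *
     ev3 phi v (nth 0 l 2) (nth 0 l 3))) //; last first.
    by case=> [|a' [|b' [|c' [|d' [|]]]]] // _; rewrite /= !cE.
  rewrite altsum4 // /wedge22 /= (_ : (2`! * 2`!)%N = 4%N) //.
  by field.
rewrite /Bform (tseqE 0) (_ : codom _ = E7); last first.
  by rewrite codomE /E7 -val_enum_ord -map_comp.
rewrite (@wedge_altsum _ _ 4 3) //.
rewrite (altsum_ext _ (G' := fun l =>
    wedge22 (ev3 phi u) (ev3 phi v) (nth 0 l 0) (nth 0 l 1) (nth 0 l 2) (nth 0 l 3) *
    ev3 phi (nth 0 l 4) (nth 0 l 5) (nth 0 l 6))) //; last first.
  move=> l sl; rewrite w22 ?size_takel ?sl // !nth_take //; congr (_ * _).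
  by case: l sl => [|a [|b [|c [|d [|a' [|b' [|c' [|]]]]]]]].
transitivity ((4`! * 3`!)%:R^-1 * (24 *
    shuffle_sum 0 E7 (ev3 phi u) (ev3 phi v) (ev3 phi))); last first.
  by rewrite mulrA; congr (_ * _); rewrite (_ : (4`! * 3`!)%N = 144%N) //; field.
congr (_ * _); rewrite altsum_nsum.
rewrite mulr_nsumr; apply: eq_nsum => i i7.
rewrite mulrCA; congr (_ * _); rewrite altsum_nsum.
rewrite mulr_nsumr; apply: eq_nsum => j j6.
rewrite mulrCA; congr (_ * _); rewrite altsum_nsum.
rewrite mulr_nsumr; apply: eq_nsum => k k5.
rewrite mulrCA; congr (_ * _).
have s1 : size (delnth i E7) = 6%N by exact: (size_delnth sE i7).
have s2 : size (delnth j (delnth i E7)) = 5%N by exact: (size_delnth s1 j6).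
have s3 : size (delnth k (delnth j (delnth i E7))) = 4%N by exact: (size_delnth s2 k5).
cbv zeta.
move: (nth 0 (delnth j _) _) (nth 0 _ j) (nth 0 _ i) => a b c.
move: s3; case: (delnth k _) => [|x [|y [|z [|t [|]]]]] // sl.
rewrite (altsum_ext _ (G' := fun l => wedge22 (ev3 phi u) (ev3 phi v)
  (nth 0 l 0) (nth 0 l 1) (nth 0 l 2) (nth 0 l 3) * ev3 phi a b c)) //; last first.
  by case=> [|a' [|b' [|c' [|d' [|]]]]].
by rewrite altsumZ // altsum4_wedge22 // mulrA.
Qed.

End BformExpansion.

(** * Tensors on p are determined by their values on e_1, ..., e_7 *)

Section TensorExt.
Variable R : realType.
Local Notation M2 := 'M[quat R]_2.

Lemma pp0 : pp (0 : M2).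
Proof.
apply/ppP; exists 0, 0; split=> //.
by apply: mx2_ext; rewrite !mxsE ?qconj0 ?oppr0.
Qed.

Lemma pp_lin (c : R) (u w : M2) : pp u -> pp w -> pp (qre c *: u + w).
Proof.
move=> /ppP[q [d [d0 ->]]] /ppP[q' [d' [d0' ->]]]; apply/ppP.
exists (qre c * q + q'), (qre c * d + d'); split; first by rewrite !qE d0 d0'; ring.
apply: mx2_ext; rewrite !mxsE //; first by rewrite mulr0 addr0.
by apply: quat_ext; rewrite !qE; ring.
Qed.

Lemma co_lin i (c : R) (u w : M2) : co i (qre c *: u + w) = c * co i u + co i w.
Proof. by rewrite /co !ip2E !mxsE !qE; ring. Qed.

Let qI : quat R := Quat 0 1 0 0.
Let qJ : quat R := Quat 0 0 1 0.
Let qK : quat R := Quat 0 0 0 1.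
Let r2 : quat R := qre (Num.sqrt 2)^-1.

Lemma ebas_pmat a : (a < 7)%N -> ebas R a = pmat
  (nth 0 [:: 0; 0; 0; r2 * qI; r2 * qJ; r2 * qK; r2] a)
  (nth 0 [:: qI; qJ; qK; 0; 0; 0; 0] a).
Proof.
rewrite /ebas /bas => a7; apply: mx2_ext.
all: do 7?[case: a a7 => [|a] a7;
  first by rewrite /= !mxsE //=; apply: quat_ext; rewrite !qE /=; ring]; by case: a a7.
Qed.

Lemma ebas_im a : (a < 7)%N -> qr (nth 0 [:: qI; qJ; qK; 0; 0; 0; 0] a) = 0.
Proof. by do 7?[case: a => //= a]. Qed.

Lemma ebas_pp a : (a < 7)%N -> pp (ebas R a).
Proof. by move=> a7; rewrite ebas_pmat //; apply: pmat_pp; exact: ebas_im. Qed.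

Lemma co_ebas i a : (i < 7)%N -> (a < 7)%N -> co i (ebas R a) = if i == a then 1 else 0.
Proof.
move=> i7 a7; rewrite ebas_pmat // co_pmat ?ebas_im // /r2.
have s0 : Num.sqrt (2 : R) != 0 by rewrite gt_eqF ?sqrt2_gt0.
do 7?[case: a a7 => [|a] a7 //];
  do 7?[case: i i7 => [|i] i7 //]; rewrite /= ; do ?[rewrite !qE /=]; rewrite ?mulr0 //; field; done.
Qed.

Lemma pp_co_ext (u v : M2) : pp u -> pp v -> (forall i : 'I_7, co i u = co i v) -> u = v.
Proof.
move=> /ppP[q [d [d0 ->]]] /ppP[q' [d' [d0' ->]]] e.
have {}e i : (i < 7)%N -> co i (pmat q d) = co i (pmat q' d').
  by move=> i7; exact: (e (Ordinal i7)).
have s0 := lt0r_neq0 (sqrt2_gt0 R).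
have := e 0 isT; have := e 1 isT; have := e 2%N isT; have := e 3%N isT.
have := e 4%N isT; have := e 5%N isT; have := e 6%N isT.
rewrite !co_pmat //= => /(mulfI s0) ? /(mulfI s0) ? /(mulfI s0) ? /(mulfI s0) ? ? ? ?.
by congr pmat; apply: quat_ext => //; rewrite d0 d0'.
Qed.

Lemma pp_comb n (c : nat -> R) : (n <= 7)%N ->
  pp (\sum_(0 <= a < n) qre (c a) *: ebas R a).
Proof.
elim: n => [|n IH] n7; first by rewrite big_geq //; exact: pp0.
rewrite big_nat_recr //= addrC; apply: pp_lin; first exact: ebas_pp.
by apply: IH; exact: ltnW.
Qed.

Lemma co_comb n (c : nat -> R) i : (n <= 7)%N -> (i < 7)%N ->
  co i (\sum_(0 <= a < n) qre (c a) *: ebas R a) = if (i < n)%N then c i else 0.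
Proof.
move=> + i7; elim: n => [|n IH] n7.
  by rewrite big_geq // /co ip2E !mxsE !qE; ring.
rewrite big_nat_recr //; set e := ebas R n; rewrite /= addrC co_lin.
rewrite (IH (ltnW n7)) /e co_ebas // ltnS.
by case: ltngtP => [| |->]; rewrite ?mulr0 ?mulr1 ?addr0 ?add0r.
Qed.

Lemma pp_sum (v : M2) : pp v -> v = \sum_(0 <= a < 7) qre (co a v) *: ebas R a.
Proof.
move=> ppv; apply: pp_co_ext => // [|i]; first exact: pp_comb.
by rewrite co_comb // ltn_ord.
Qed.

Variables (k : nat).
Implicit Types s t : tensor R M2 k.

Lemma upd_id (v : 'I_k -> M2) j : upd v j (v j) = v.
Proof. by apply/funext => i; rewrite /upd; case: eqP => // ->. Qed.

(** Slots are expanded in the basis one at a time: the outer induction treats tuples whose entries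
    from position m on are basis vectors, the inner one the partial sums of the expansion of a
    single slot. *)
Lemma tensor_ext s t : is_tensor (@pp R) s -> is_tensor (@pp R) t ->
  (forall f : 'I_k -> 'I_7, s (fun i => ebas R (f i)) = t (fun i => ebas R (f i))) ->
  s = t.
Proof.
move=> [rs ls] [rt lt] st; apply/funext => v.
have [ppv|nppv] := pselect (forall i, pp (v i)); last first.
  by rewrite -rs -rt /restr asboolF.
suff H m w : (forall j, pp (w j)) ->
    (forall j : 'I_k, (m <= j)%N -> exists a : 'I_7, w j = ebas R a) -> s w = t w.
  by apply: (H k) => // j; rewrite leqNgt ltn_ord.
elim: m w => [|m IH] w ppw bw.
  have /choice[f fP] : forall j, exists a : 'I_7, w j = ebas R a by move=> j; exact: bw.
  by have -> : w = (fun i => ebas R (f i)) by apply/funext.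
have [km|mk] := leqP k m.
  by apply: IH => // j mj; move: (leq_trans km mj); rewrite leqNgt ltn_ord.
pose j0 := Ordinal mk.
have ppu u : pp u -> forall j, pp (upd w j0 u j).
  by move=> pu j; rewrite /upd; case: ifP.
have z0 (r : tensor R M2 k) : (forall v i u w (c : R), (forall j, pp (v j)) -> pp u -> pp w ->
    r (upd v i (qre c *: u + w)) = c * r (upd v i u) + r (upd v i w)) -> r (upd w j0 0) = 0.
  move=> lr; have := lr w j0 0 0 0 ppw pp0 pp0.
  by rewrite scaler0 addr0 mul0r add0r => _; have := lr w j0 0 0 1 ppw pp0 pp0;
     rewrite scaler0 addr0 mul1r => /eqP; rewrite -subr_eq0 opprD addNKr oppr_eq0 => /eqP.
suff G n : (n <= 7)%N ->
    s (upd w j0 (\sum_(0 <= a < n) qre (co a (w j0)) *: ebas R a)) =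
    t (upd w j0 (\sum_(0 <= a < n) qre (co a (w j0)) *: ebas R a)).
  by have := G 7%N isT; rewrite -pp_sum // upd_id.
elim: n => [|n IHn] n7; first by rewrite big_geq // !z0.
have ppS := pp_comb (fun a => co a (w j0)) (ltnW n7).
have pe : pp (ebas R n) by exact: ebas_pp.
rewrite big_nat_recr //= addrC ls ?lt //.
rewrite IHn 1?ltnW //; congr (_ * _ + _); apply: IH => [|j mj]; first exact/ppu.
rewrite /upd; case: eqP => [_|/eqP jj0]; first by exists (Ordinal n7).
by apply: bw; rewrite ltn_neqAle mj andbT; apply: contra jj0 => /eqP mj0; apply/eqP/val_inj.
Qed.

End TensorExt.

Notation j0 := (@Ordinal 3 0 isT).
Notation j1 := (@Ordinal 3 1 isT).
Notation j2 := (@Ordinal 3 2 isT).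

Lemma ord3P (i : 'I_3) : [\/ i = j0, i = j1 | i = j2].
Proof.
by case: i => [[|[|[|//]]] ?]; [apply: Or31|apply: Or32|apply: Or33]; exact/val_inj.
Qed.

Lemma sum3E (V : nmodType) (F : 'I_3 -> V) : \sum_i F i = F j0 + F j1 + F j2.
Proof.
rewrite !big_ord_recl big_ord0 addr0 addrA; congr (F _ + F _ + F _); exact/val_inj.
Qed.

(** * The model 3-form and explicit wedge products of low degree *)

Section Forms.
Variables (R : realType) (V : Type).
Implicit Types (e : nat -> V -> R) (w : nat -> V -> V -> R) (A : 'M[R]_3).

Definition etaf A e i (a : V) : R := A i j0 * e 0%N a + A i j1 * e 1%N a + A i j2 * e 2%N a.

Definition tri e (a b c : V) : R :=
  e 0%N a * (e 1%N b * e 2%N c - e 2%N b * e 1%N c)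
  - e 1%N a * (e 0%N b * e 2%N c - e 2%N b * e 0%N c)
  + e 2%N a * (e 0%N b * e 1%N c - e 1%N b * e 0%N c).

(** The form C e^123 + sum_i eta_i /\ w_i with eta_i = sum_l A_il e^l, written out on (a, b, c). The
    coordinate functions e and the 2-forms w are parameters, so that one formula serves on p and on
    every tangent space of the sphere. *)
Definition f3 C A e w (a b c : V) : R := C * tri e a b c
  + (etaf A e j0 a * w 0%N b c - etaf A e j0 b * w 0%N a c + etaf A e j0 c * w 0%N a b)
  + (etaf A e j1 a * w 1%N b c - etaf A e j1 b * w 1%N a c + etaf A e j1 c * w 1%N a b)
  + (etaf A e j2 a * w 2%N b c - etaf A e j2 b * w 2%N a c + etaf A e j2 c * w 2%N a b).

Definition form3 C A e w : tensor R V 3 := fun v => f3 C A e w (v j0) (v j1) (v j2).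

Definition prt (x : nat -> V -> R) a b (v w : V) : R := x a v * x b w - x b v * x a w.

(** [om x i] is omega_(i+1), with all coordinate indices lowered by one. *)
Definition om (x : nat -> V -> R) (i : nat) (v w : V) : R :=
  match i with
  | 0 => prt x 3 6 v w + prt x 4 5 v w
  | 1 => prt x 3 5 v w - prt x 4 6 v w
  | _ => prt x 3 4 v w + prt x 5 6 v w
  end.

Lemma f3_alt C A e w : (forall i a b, w i b a = - w i a b) ->
  (forall a b, f3 C A e w a a b = 0) /\ (forall a b, f3 C A e w a b a = 0) /\
  (forall a b, f3 C A e w b a a = 0).
Proof.
move=> wC; have w0 i a : w i a a = 0.
  by have := wC i a a; lra.
split; [|split] => a b; rewrite /f3 !w0 /tri;
  rewrite ?(wC _ b a); ring.
Qed.

Lemma form3_alt C A e w : (forall i a b, w i b a = - w i a b) ->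
  alternating_tensor (form3 C A e w).
Proof.
move=> /(f3_alt C A e)[h1 [h2 h3]] v i j ij vij; rewrite /form3.
case: (ord3P i) (ord3P j) ij vij => -> [] -> // _; [| | move/esym| | move/esym | move/esym];
  by move=> ->; rewrite ?h1 ?h2 ?h3.
Qed.

Lemma om_alt (x : nat -> V -> R) i a b : om x i b a = - om x i a b.
Proof. by case: i => [|[|i]]; rewrite /om /prt; ring. Qed.

Lemma codom2 (v : 'I_2 -> V) : codom v = [:: v 0; v 1].
Proof.
by rewrite codomE !enum_ordSl enum_ord0 /=; congr [:: v _; v _]; exact/val_inj.
Qed.

Lemma codom3 (v : 'I_3 -> V) : codom v = [:: v j0; v j1; v j2].
Proof.
by rewrite codomE !enum_ordSl enum_ord0 /=; congr [:: v _; v _; v _]; exact/val_inj.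
Qed.

Lemma tseq1 (s : tensor R V 1) (f : V -> R) (x0 : V) l :
  (forall v, s v = f (v ord0)) -> tseq x0 s l = f (nth x0 l 0).
Proof. by move=> sf; rewrite /tseq sf. Qed.

Lemma tseq2 (s : tensor R V 2) (f : V -> V -> R) (x0 : V) l :
  (forall v, s v = f (v 0) (v 1)) -> tseq x0 s l = f (nth x0 l 0) (nth x0 l 1).
Proof. by move=> sf; rewrite /tseq sf. Qed.

Lemma wedge11 (s t : tensor R V 1) (f g : V -> R) :
  (forall v, s v = f (v ord0)) -> (forall v, t v = g (v ord0)) ->
  forall v : 'I_2 -> V, wedge s t v = f (v 0) * g (v 1) - f (v 1) * g (v 0).
Proof.
move=> sf tg v; have sE := tseq1 (v 0) _ sf; have tE := tseq1 (v 0) _ tg.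
rewrite (tseqE (v 0)) codom2 (@wedge_altsum _ _ 1 1) // /altsum /= !sE !tE /=.
by rewrite (_ : (1`! * 1`!)%N = 1%N) // expr0 expr1; field.
Qed.

Lemma wedge21 (s : tensor R V 2) (t : tensor R V 1) (f : V -> V -> R) (g : V -> R) :
  (forall v, s v = f (v 0) (v 1)) -> (forall v, t v = g (v ord0)) ->
  (forall a b, f b a = - f a b) ->
  forall v : 'I_3 -> V, wedge s t v =
    f (v j0) (v j1) * g (v j2) - f (v j0) (v j2) * g (v j1) + f (v j1) (v j2) * g (v j0).
Proof.
move=> sf tg fC v; have sE l := tseq2 (v j0) l sf; have tE l := tseq1 (v j0) l tg.
rewrite (tseqE (v j0)) codom3 (@wedge_altsum _ _ 2 1) // /altsum /= !sE !tE /=.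
rewrite (fC (v j0) (v j1)) (fC (v j0) (v j2)) (fC (v j1) (v j2)).
by rewrite (_ : (2`! * 1`!)%N = 2%N) //; field.
Qed.

Lemma wedge12 (s : tensor R V 1) (t : tensor R V 2) (f : V -> R) (g : V -> V -> R) :
  (forall v, s v = f (v ord0)) -> (forall v, t v = g (v 0) (v 1)) ->
  (forall a b, g b a = - g a b) ->
  forall v : 'I_3 -> V, wedge s t v =
    f (v j0) * g (v j1) (v j2) - f (v j1) * g (v j0) (v j2) + f (v j2) * g (v j0) (v j1).
Proof.
move=> sf tg gC v; have sE l := tseq1 (v j0) l sf; have tE l := tseq2 (v j0) l tg.
rewrite (tseqE (v j0)) codom3 (@wedge_altsum _ _ 1 2) // /altsum /= !sE !tE /=.
rewrite (gC (v j0) (v j1)) (gC (v j0) (v j2)) (gC (v j1) (v j2)).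
by rewrite (_ : (1`! * 2`!)%N = 2%N) //; field.
Qed.

End Forms.

(** * The map Phi in coordinates *)

Section PhiForm.
Variable R : realType.
Local Notation M2 := 'M[quat R]_2.

Definition dd (l : nat) (x : M2) : R := if `[< pp x >] then co l x else 0.

Lemma deE l (v : 'I_1 -> M2) : de l.+1 v = dd l (v ord0).
Proof.
rewrite /de /restr /dd (_ : (forall i, pp (v i)) = pp (v ord0)) //.
by apply/propext; split=> // p0 i; rewrite ord1.
Qed.

Definition T3 C A : tensor R M2 3 := restr (@pp R) (form3 C A (@co R) (om (@co R))).

Lemma de2E a b (v : 'I_2 -> M2) : de2 a.+1 b.+1 v = prt dd a b (v 0) (v 1).
Proof. rewrite /de2 (wedge11 (deE a) (deE b)) /prt; congr (_ - _); exact: mulrC. Qed.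

Lemma omegaE i (v : 'I_2 -> M2) : omega i v = om dd i (v 0) (v 1).
Proof.
by rewrite /omega; case: (ord3P i) => ->; rewrite (tnth_nth 0) /= !de2E.
Qed.

Lemma Phi_form z (v : 'I_3 -> M2) :
  Phi z v = form3 (z.1 ^+ 3) (invmx z.2) dd (om dd) v.
Proof.
rewrite /Phi /de3 (wedge21 (de2E 0 1) (deE 2)); last by move=> a b; rewrite /prt; ring.
have W l i := wedge12 (deE l) (omegaE i) (om_alt dd i) v.
under eq_bigr => i _ do under eq_bigr => l _ do rewrite W.
case: z {W} => c D; rewrite /form3 [_.1]/= [_.2]/=.
move: (c ^+ 3) (invmx D) dd => C A e.
rewrite !sum3E.
by rewrite /f3 /etaf /tri /prt; ring.
Qed.

(** The two sides truncate to p at different places: [Phi] in each 1-form, [T3] as a whole. If an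
    argument lies outside p, every term of [Phi] has a factor evaluated there, so both sides
    vanish. *)
Lemma Phi_T3 z : Phi z = T3 (z.1 ^+ 3) (invmx z.2).
Proof.
apply/funext => v; rewrite Phi_form /T3 /restr.
case: asboolP => [ppv|nppv].
  have E i l : dd l (v i) = co l (v i) by rewrite /dd asboolT.
  by rewrite /form3 /f3 /etaf /tri /om /prt !E.
have [i npi] : exists i, ~ pp (v i) by apply/existsNP.
have E l : dd l (v i) = 0 by rewrite /dd asboolF.
rewrite /form3; move: (_ ^+ 3) (invmx _) (@dd) E => C A e.
case: (ord3P i) => -> E; by rewrite /f3 /etaf /tri /om /prt !E; ring.
Qed.

End PhiForm.

(** * Reduction to increasing triples of indices *)

Section SortedShuffles.
Variable R : realType.
Implicit Types (h : nat -> nat -> nat -> R) (f g : nat -> nat -> R).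

(* Unlike [ltn], [ltnb] computes without unfolding canonical structures. *)
Definition ltnb (a b : nat) : bool := if (b - a)%N is _.+1 then true else false.

Lemma ltnbE a b : ltnb a b = (a < b)%N.
Proof. by rewrite /ltnb -subn_gt0; case: (b - a)%N. Qed.

Definition sort3 h a b c : R :=
  if ltnb a b then
    if ltnb b c then h a b c else if ltnb a c then - h a c b else h c a b
  else
    if ltnb a c then - h b a c else if ltnb b c then h b c a else - h c b a.

Lemma sort3E h n : (forall a b c, (a < n)%N -> (b < n)%N -> (c < n)%N -> h b a c = - h a b c) ->
  (forall a b c, (a < n)%N -> (b < n)%N -> (c < n)%N -> h a c b = - h a b c) ->
  forall a b c, (a < n)%N -> (b < n)%N -> (c < n)%N -> h a b c = sort3 h a b c.
Proof.
move=> h12 h23 a b c an bn cn; have hl := (h12, h23).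
rewrite /sort3; do ! [case: ifP => _] => //.
- by rewrite (h23 a b c) ?opprK.
- by rewrite (h12 a c b) ?(h23 a b c) ?opprK.
- by rewrite (h12 a b c) ?opprK.
- by rewrite (h23 b a c) ?(h12 a b c) ?opprK.
- by rewrite (h12 b c a) ?(h23 b a c) ?(h12 a b c) ?opprK.
Qed.

Lemma ltn_nth n k (L : seq nat) : all (fun a => a < n)%N L -> (0 < n)%N -> (nth 0 L k < n)%N.
Proof.
move=> aL n0; have [kL|Lk] := ltnP k (size L); last by rewrite nth_default.
exact: (all_nthP 0%N aL).
Qed.

Lemma all_delnth n i (L : seq nat) : all (fun a => a < n)%N L ->
  all (fun a => a < n)%N (delnth i L).
Proof.
move=> /allP aL; apply/allP => a; rewrite mem_cat => /orP[/mem_take|/mem_drop];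
  exact: aL.
Qed.

Lemma eq_shuffle_sum (f g f' g' : nat -> nat -> R) (h h' : nat -> nat -> nat -> R) :
  (forall a b, (a < 7)%N -> (b < 7)%N -> f a b = f' a b) ->
  (forall a b, (a < 7)%N -> (b < 7)%N -> g a b = g' a b) ->
  (forall a b c, (a < 7)%N -> (b < 7)%N -> (c < 7)%N -> h a b c = h' a b c) ->
  shuffle_sum 0%N (iota 0 7) f g h = shuffle_sum 0%N (iota 0 7) f' g' h'.
Proof.
move=> ff gg hh; have a0 : all (fun a => a < 7)%N (iota 0 7) by [].
rewrite /shuffle_sum; apply: eq_nsum => i _; congr (_ * _).
have a1 := all_delnth i a0; apply: eq_nsum => j _; congr (_ * _).
have a2 := all_delnth j a1; apply: eq_nsum => k _; congr (_ * _).
have a3 := all_delnth k a2; cbv zeta; rewrite /wedge22.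
by congr (_ * _); rewrite ?ff ?gg ?hh //; exact: ltn_nth.
Qed.

Definition sorted_triples : seq (nat * nat * nat) :=
  [seq p <- [seq (p, c) | p <- [seq (a, b) | a <- iota 0 7, b <- iota 0 7], c <- iota 0 7] |
    ltnb p.1.1 p.1.2 && ltnb p.1.2 p.2].

(** The sum over (4,3)-shuffles. For a < b < c, moving these entries to the end takes (6 - c) + (5 -
    b) + (4 - a) transpositions, a number of the parity of a + b + c + 1; [L] lists the four other
    indices. *)
Definition sorted_shuffle_sum f g h : R :=
  foldr (fun p s => (-1) ^+ (p.1.1 + p.1.2 + p.2.+1) *
    (let L := [seq x <- iota 0 7 | ~~ [|| eqn x p.1.1, eqn x p.1.2 | eqn x p.2]] in
     wedge22 f g (nth 0 L 0) (nth 0 L 1) (nth 0 L 2) (nth 0 L 3))%N * h p.1.1 p.1.2 p.2 + s)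
    0 sorted_triples.

(** Each of the 35 sets {a, b, c} arises in six orders, which contribute equally by antisymmetry of
    h. *)
Lemma shuffle_sum_sorted f g h :
  (forall a b c, (a < 7)%N -> (b < 7)%N -> (c < 7)%N -> h b a c = - h a b c) ->
  (forall a b c, (a < 7)%N -> (b < 7)%N -> (c < 7)%N -> h a c b = - h a b c) ->
  shuffle_sum 0%N (iota 0 7) f g h = 6 * sorted_shuffle_sum f g h.
Proof.
move=> h12 h23.
rewrite (@eq_shuffle_sum f g f g h (sort3 h)) //; last exact: sort3E.
move=> {h12 h23}.
rewrite /shuffle_sum /sorted_shuffle_sum.
(* With W opaque, its values and those of h are atoms, and the identity is linear in their
   products. *)
move: (wedge22 f g) => W.
cbv beta iota zeta delta [nsum delnth iota take drop cat nth sort3 ltnb eqn subn subn_rec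
  Nat.sub sorted_triples seq.filter map flatten foldr allpairs_dep andb orb negb fst snd].
ring.
Qed.

End SortedShuffles.

(** * The form B of the model 3-form *)

Section BformT3.
Variable R : realType.
Local Notation M2 := 'M[quat R]_2.

Definition dlt (a : nat) : nat -> R := fun i => if eqn i a then 1 else 0.

(* [ev_coord u a b] is the value of the 3-form at (u, e_a, e_b), as a function of the
   coordinates of u. *)
Definition ev_coord C (A : 'M[R]_3) (u : nat -> R) (a b : nat) : R :=
  let h i := A i j0 * u 0%N + A i j1 * u 1%N + A i j2 * u 2%N in
  let x k (l : 'I_3) := match k with
    | 3 => A j0 l * u 6%N + A j1 l * u 5%N + A j2 l * u 4%N
    | 4 => A j0 l * u 5%N - A j1 l * u 6%N - A j2 l * u 3%N
    | 5 => A j2 l * u 6%N - A j0 l * u 4%N - A j1 l * u 3%N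
    | _ => A j1 l * u 4%N - A j0 l * u 3%N - A j2 l * u 5%N
    end in
  let t a b := match a, b with
    | 0, 1 => C * u 2%N | 0, 2 => - (C * u 1%N) | 1, 2 => C * u 0%N
    | 0, _ => x b j0 | 1, _ => x b j1 | 2, _ => x b j2
    | 3, 4 => h j2 | 3, 5 => h j1 | 3, _ => h j0
    | 4, 5 => h j0 | 4, _ => - h j1
    | _, _ => h j2
    end in
  match ltnb a b, ltnb b a with true, _ => t a b | _, true => - t b a | _, _ => 0 end.

Lemma f3_ev_coord C A (u : M2) a b : (a < 7)%N -> (b < 7)%N ->
  f3 C A (@co R) (om (@co R)) u (ebas R a) (ebas R b) = ev_coord C A (fun i => co i u) a b.
Proof.
move=> a7 b7.
have ea i : (i < 7)%N -> co i (ebas R a) = dlt a i by move=> ?; rewrite co_ebas.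
have eb i : (i < 7)%N -> co i (ebas R b) = dlt b i by move=> ?; rewrite co_ebas.
rewrite /f3 /etaf /tri /om /prt !ea // !eb // {ea eb}.
set x := fun i => co i u.
have ex i : co i u = x i by [].
rewrite !ex; move: x {ex} => x.
do 7?[case: a a7 => [|a] a7 //]; do 7?[case: b b7 => [|b] b7 //];
  rewrite /ev_coord /dlt /=; ring.
Qed.

(** The determinant as a polynomial in the entries, for use with [ring]. *)
Definition det3 (A : 'M[R]_3) : R :=
  A j0 j0 * (A j1 j1 * A j2 j2 - A j1 j2 * A j2 j1)
  - A j0 j1 * (A j1 j0 * A j2 j2 - A j1 j2 * A j2 j0)
  + A j0 j2 * (A j1 j0 * A j2 j1 - A j1 j1 * A j2 j0).

(** On p_1 one of the three factors supplies C e^123 or its contraction, and the other two supply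
    omega_i /\ omega_j, which is 2 e^4567 if i = j and 0 otherwise: three times 2 C. On p_2 the
    product eta_1 /\ eta_2 /\ eta_3 = det A e^123 appears. Mixed terms have the wrong degree. *)
Lemma sorted_shuffle_ev_coord C A (x y : nat -> R) :
  sorted_shuffle_sum (ev_coord C A x) (ev_coord C A y) (fun a => ev_coord C A (dlt a)) =
  6 * C * (
   (A j0 j0 * x 0%N + A j0 j1 * x 1%N + A j0 j2 * x 2%N) *
   (A j0 j0 * y 0%N + A j0 j1 * y 1%N + A j0 j2 * y 2%N) +
   (A j1 j0 * x 0%N + A j1 j1 * x 1%N + A j1 j2 * x 2%N) *
   (A j1 j0 * y 0%N + A j1 j1 * y 1%N + A j1 j2 * y 2%N) +
   (A j2 j0 * x 0%N + A j2 j1 * x 1%N + A j2 j2 * x 2%N) *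
   (A j2 j0 * y 0%N + A j2 j1 * y 1%N + A j2 j2 * y 2%N)) +
  6 * det3 A * (x 3%N * y 3%N + x 4%N * y 4%N + x 5%N * y 5%N + x 6%N * y 6%N).
Proof.
rewrite /det3 /ev_coord.
move: (A j0 j0) (A j0 j1) (A j0 j2) (A j1 j0) (A j1 j1) (A j1 j2) (A j2 j0) (A j2 j1) (A j2 j2).
move: (x 0%N) (x 1%N) (x 2%N) (x 3%N) (x 4%N) (x 5%N) (x 6%N).
move: (y 0%N) (y 1%N) (y 2%N) (y 3%N) (y 4%N) (y 5%N) (y 6%N).
move=> y0 y1 y2 y3 y4 y5 y6 x0 x1 x2 x3 x4 x5 x6 a00 a01 a02 a10 a11 a12 a20 a21 a22.
rewrite /sorted_shuffle_sum.
cbv beta iota zeta delta [nsum delnth iota take drop cat nth sort3 ltnb eqn subn subn_rec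
  Nat.sub wedge22 dlt sorted_triples seq.filter map flatten foldr allpairs_dep andb orb negb fst snd].
ring.
Qed.

Lemma shuffle_E7 (f g : M2 -> M2 -> R) (h : M2 -> M2 -> M2 -> R) :
  shuffle_sum 0 (E7 R) f g h = shuffle_sum 0%N (iota 0 7)
    (fun a b => f (ebas R a) (ebas R b)) (fun a b => g (ebas R a) (ebas R b))
    (fun a b c => h (ebas R a) (ebas R b) (ebas R c)).
Proof.
rewrite /shuffle_sum /E7 /wedge22; move: (ebas R) => e.
cbv beta iota zeta delta [nsum delnth iota take drop cat nth map].
reflexivity.
Qed.

Lemma ev3_T3 C A (u a b : M2) : pp u -> pp a -> pp b ->
  ev3 (T3 C A) u a b = f3 C A (@co R) (om (@co R)) u a b.
Proof.
move=> pu pa pb; rewrite /ev3 /tseq /T3 /restr asboolT // => i.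
by case: (ord3P i) => ->.
Qed.

Lemma ev3_T3_antisym C A (u a b : M2) : ev3 (T3 C A) u b a = - ev3 (T3 C A) u a b.
Proof.
have npp (x y z : M2) : ~ [/\ pp x, pp y & pp z] -> ev3 (T3 C A) x y z = 0.
  move=> np; rewrite /ev3 /tseq /T3 /restr asboolF // => allp; apply: np.
  by split; [exact: (allp j0)|exact: (allp j1)|exact: (allp j2)].
have [[pu pa pb]|np] := pselect [/\ pp u, pp a & pp b]; last first.
  by rewrite !npp ?oppr0 // => -[? ? ?]; apply: np.
rewrite !ev3_T3 // /f3 (om_alt _ 0 b a) (om_alt _ 1 b a) (om_alt _ 2 b a) /tri.
move: (om (@co R)) (@co R) => w e; ring.
Qed.

Lemma ev3_T3_swap C A (u a b : M2) : ev3 (T3 C A) a u b = - ev3 (T3 C A) u a b.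
Proof.
have npp (x y z : M2) : ~ [/\ pp x, pp y & pp z] -> ev3 (T3 C A) x y z = 0.
  move=> np; rewrite /ev3 /tseq /T3 /restr asboolF // => allp; apply: np.
  by split; [exact: (allp j0)|exact: (allp j1)|exact: (allp j2)].
have [[pu pa pb]|np] := pselect [/\ pp u, pp a & pp b]; last first.
  by rewrite !npp ?oppr0 // => -[? ? ?]; apply: np.
rewrite !ev3_T3 // /f3 (om_alt _ 0 u a) (om_alt _ 1 u a) (om_alt _ 2 u a) /tri.
move: (om (@co R)) (@co R) => w e; ring.
Qed.

(** The 1/6 of [Bform_shuffle] cancels against the six orders of each triple. *)
Lemma Bform_T3 C A (u v : M2) : pp u -> pp v -> Bform (T3 C A) u v =
  6 * C * (etaf A (@co R) j0 u * etaf A (@co R) j0 v + etaf A (@co R) j1 u * etaf A (@co R) j1 v +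
           etaf A (@co R) j2 u * etaf A (@co R) j2 v) +
  6 * det3 A * (co 3 u * co 3 v + co 4 u * co 4 v + co 5 u * co 5 v + co 6 u * co 6 v).
Proof.
move=> pu pv; rewrite Bform_shuffle; last exact: ev3_T3_antisym.
have ebp a : (a < 7)%N -> pp (ebas R a) by exact: ebas_pp.
have hE a b c : (a < 7)%N -> (b < 7)%N -> (c < 7)%N ->
    ev3 (T3 C A) (ebas R a) (ebas R b) (ebas R c) = ev_coord C A (dlt a) b c.
  move=> a7 b7 c7; rewrite (ev3_T3 _ _ (ebp a a7) (ebp b b7) (ebp c c7)) f3_ev_coord //.
  have ea i : (i < 7)%N -> co i (ebas R a) = dlt a i by move=> ?; rewrite co_ebas.
  by rewrite /ev_coord !ea.
have fE w : pp w -> forall a b, (a < 7)%N -> (b < 7)%N ->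
    ev3 (T3 C A) w (ebas R a) (ebas R b) = ev_coord C A (fun i => co i w) a b.
  by move=> pw a b a7 b7; rewrite (ev3_T3 _ _ pw (ebp a a7) (ebp b b7)) f3_ev_coord.
rewrite shuffle_E7 (eq_shuffle_sum (fE u pu) (fE v pv) hE) shuffle_sum_sorted.
- by rewrite sorted_shuffle_ev_coord mulKf // pnatr_eq0.
- by move=> a b c a7 b7 c7; rewrite -!hE // ev3_T3_swap.
- by move=> a b c a7 b7 c7; rewrite -!hE // ev3_T3_antisym.
Qed.

Lemma det3E (A : 'M[R]_3) : \det A = det3 A.
Proof.
transitivity (altsum j0 3 [:: j0; j1; j2] (fun l =>
  A j0 (nth j0 l 0) * A j1 (nth j0 l 1) * A j2 (nth j0 l 2))).
  rewrite -altsumE // /determinant; apply: eq_bigr => s _; congr (_ * _).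
  rewrite !big_ord_recl big_ord0 mulr1 mulrA !enum_ordSl enum_ord0 /=.
  have nL (i : 'I_3) : nth j0 [:: j0; j1; j2] i = i by case: (ord3P i) => ->.
  by rewrite !nL; congr (A _ (s _) * A _ (s _) * A _ (s _)); exact/val_inj.
by rewrite /altsum /det3 /=; ring.
Qed.

End BformT3.

Lemma basE (R : realType) a : bas R a.+1 = ebas R a. Proof. by []. Qed.

(* Comparing distinct basis vectors or coordinates by conversion would be very slow. *)
Opaque ebas co.

(** * Invariant 3-forms *)

Section TensorLaws.
Variable R : realType.
Local Notation H := (quat R).
Local Notation M2 := 'M[quat R]_2.

(** Scalars of these matrices are quaternions, so real linearity is expressed with [qre c]. *)
Definition rlin m n (f : 'M[H]_(m, n) -> R) :=
  forall (c : R) u w, f (qre c *: u + w) = c * f u + f w.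

Lemma upd_eq (T : Type) k (v : 'I_k -> T) i x : upd v i x i = x.
Proof. by rewrite /upd eqxx. Qed.
Lemma upd_neq (T : Type) k (v : 'I_k -> T) i j x : j != i -> upd v i x j = v j.
Proof. by rewrite /upd => /negbTE ->. Qed.

Lemma restrT (T : Type) k (W : set T) (t : tensor R T k) v : (forall i, W (v i)) ->
  restr W t v = t v.
Proof. by move=> Wv; rewrite /restr asboolT. Qed.

Lemma restr_restr (T : Type) k (W : set T) (t : tensor R T k) :
  restr W (restr W t) = restr W t.
Proof. by apply/funext => v; rewrite /restr; case: asboolP. Qed.

Section Form3Tensor.
Variables (m n : nat) (W : set 'M[H]_(m, n)).
Hypothesis Wlin : forall (c : R) u w, W u -> W w -> W (qre c *: u + w).

Lemma restr_tensor k (t : tensor R 'M[H]_(m, n) k) :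
  (forall v i u w (c : R), t (upd v i (qre c *: u + w)) = c * t (upd v i u) + t (upd v i w)) ->
  is_tensor W (restr W t).
Proof.
move=> tl; split; first exact: restr_restr.
move=> v i u w c Wv Wu Ww.
have WU x : W x -> forall j, W (upd v i x j) by move=> Wx j; rewrite /upd; case: ifP.
by rewrite !restrT ?tl //; apply: WU => //; exact: Wlin.
Qed.

Lemma form3_lin C (A : 'M[R]_3) (e : nat -> 'M[H]_(m, n) -> R) w :
  (forall l, rlin (e l)) -> (forall i a, rlin (w i a)) -> (forall i a b, w i b a = - w i a b) ->
  forall v i u u' (c : R), form3 C A e w (upd v i (qre c *: u + u')) =
    c * form3 C A e w (upd v i u) + form3 C A e w (upd v i u').
Proof.
move=> el wl wC v i u u' c; have wl' j x y b : w j (qre c *: x + y) b = c * w j x b + w j y b.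
  by rewrite wC wl (wC j b x) (wC j b y); ring.
rewrite /form3; case: (ord3P i) => ->.
- rewrite !(upd_eq v j0) !(upd_neq v) //; move: (v j1) (v j2) => b d.
  by rewrite /f3 /etaf /tri !el !wl'; ring.
- rewrite !(upd_eq v j1) !(upd_neq v) //; move: (v j0) (v j2) => b d.
  by rewrite /f3 /etaf /tri !el !wl' !wl; ring.
- rewrite !(upd_eq v j2) !(upd_neq v) //; move: (v j0) (v j1) => b d.
  by rewrite /f3 /etaf /tri !el !wl; ring.
Qed.

End Form3Tensor.

Lemma restr_alt (T : Type) k (W : set T) (t : tensor R T k) :
  alternating_tensor t -> alternating_tensor (restr W t).
Proof. by move=> ta v i j ij vij; rewrite /restr; case: ifP => // _; exact: (ta v i j). Qed.

Lemma om_lin m n (e : nat -> 'M[H]_(m, n) -> R) i a :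
  (forall l, rlin (e l)) -> rlin (om e i a).
Proof. by move=> el c u w; case: i => [|[|i]]; rewrite /om /prt !el; ring. Qed.

Lemma T3_tensor C (A : 'M[R]_3) : is_tensor (@pp R) (T3 C A).
Proof.
apply: restr_tensor; first exact: pp_lin.
apply: form3_lin => [l|i a|i a b]; [exact: co_lin| |exact: om_alt].
by apply: om_lin => l; exact: co_lin.
Qed.

Lemma T3_alt C (A : 'M[R]_3) : alternating_tensor (T3 C A).
Proof. by apply: restr_alt; apply: form3_alt => i a b; exact: om_alt. Qed.

Definition omq (i : nat) (p : H) : R :=
  match i with 0 => - (2 * qi p) | 1 => 2 * qj p | _ => - (2 * qk p) end.

Definition imq (l : nat) (p : H) : R :=
  match l with 0 => qi p | 1 => qj p | _ => qk p end.

(** On p_2 = H the forms omega_i are, up to sign and a factor 2, the imaginary components of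
    [qconj q * q']; the 2 is the square of the sqrt 2 in the coordinates. *)
Lemma om_pmat i (q d q' d' : H) : qr d = 0 -> qr d' = 0 ->
  om (@co R) i (pmat q d) (pmat q' d') = omq i (qconj q * q').
Proof.
move=> d0 d0'; have s2 := sqrt2_sqr R.
case: i => [|[|i]]; rewrite /om /prt /omq !qE !co_pmat //=; move: s2;
  move: (Num.sqrt 2) => s <-; ring.
Qed.

Lemma co_im l (q d : H) : (l < 3)%N -> qr d = 0 -> co l (pmat q d) = imq l d.
Proof. by move=> l3 d0; rewrite co_pmat //; case: l l3 => [|[|[|]]]. Qed.

Lemma Ad_pmat (h q d : H) : h * qconj h = 1 ->
  mx2 h 0 0 1 *m pmat q d *m adjm (mx2 h 0 0 1) = pmat (h * q) d.
Proof.
move=> hh; apply: mx2_ext; rewrite !mxsE ?qconj0 ?qconj1 ?qconjM ?(mul0r, mulr0, add0r, addr0, mulr1, mul1r) //.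
by rewrite mulNr.
Qed.

Lemma f3_ext (V V' : Type) C (A : 'M[R]_3) (e : nat -> V -> R) (e' : nat -> V' -> R) w w' a b c a' b' c' :
  (forall l, (l < 3)%N -> [/\ e l a = e' l a', e l b = e' l b' & e l c = e' l c']) ->
  (forall i, (i < 3)%N -> [/\ w i a b = w' i a' b', w i a c = w' i a' c' & w i b c = w' i b' c']) ->
  f3 C A e w a b c = f3 C A e' w' a' b' c'.
Proof.
move=> H1 H2; rewrite /f3 /etaf /tri.
have [-> -> ->] := H1 0 isT; have [-> -> ->] := H1 1%N isT; have [-> -> ->] := H1 2%N isT.
by have [-> -> ->] := H2 0 isT; have [-> -> ->] := H2 1%N isT; have [-> -> ->] := H2 2%N isT.
Qed.

(** Ad(h) fixes d and replaces q by h q, which changes no product [qconj q * q']. *)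
Lemma T3_inv C (A : 'M[R]_3) : Ad_invariant (T3 C A).
Proof.
move=> _ v [h /= hh <-] ppv.
have /choice[q /choice[d qd]] : forall i, exists q d, qr d = 0 /\ v i = pmat q d.
  by move=> i; exact/ppP.
have d0 i : qr (d i) = 0 by have [] := qd i.
have vE i : v i = pmat (q i) (d i) by have [] := qd i.
rewrite (_ : (fun i => _) = fun i => pmat (h * q i) (d i)); last first.
  by apply/funext => i; rewrite vE Ad_pmat.
rewrite (_ : v = fun i => pmat (q i) (d i)); last exact/funext.
rewrite /T3 !restrT /form3; try by move=> i; exact: pmat_pp.
have hh' : qconj h * h = 1 by rewrite qmulCl -qmulCr.
apply: f3_ext => i i3; first by rewrite !co_im.
by rewrite !om_pmat // !qconjM -!mulrA !(mulrA (qconj h)) hh' !mul1r.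
Qed.

Lemma ev3E (phi : tensor R M2 3) v : phi v = ev3 phi (v j0) (v j1) (v j2).
Proof.
rewrite /ev3 /tseq; congr phi; apply/funext => i.
by case: (ord3P i) => ->.
Qed.

(** Polarization: phi vanishes when v i + v j stands in both slots. *)
Lemma alternating_swap (phi : tensor R M2 3) i j v : alternating_tensor phi ->
  is_tensor (@pp R) phi -> (forall k, pp (v k)) -> i != j ->
  phi (upd (upd v i (v j)) j (v i)) = - phi v.
Proof.
move=> pa [_ pl] ppv ij; have ji : j != i by rewrite eq_sym.
set w := fun x y => upd (upd v i x) j y.
have ppu x : pp x -> forall k, pp (upd v i x k) by move=> px k; rewrite /upd; case: ifP.
have w0 x : pp x -> phi (w x x) = 0.
  by move=> px; apply: (pa _ i j) => //; rewrite /w upd_eq upd_neq // upd_eq.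
have wl x x' y : pp x -> pp x' -> pp y -> phi (w (x + x') y) = phi (w x y) + phi (w x' y).
  move=> px px' py; have wC z : w z y = upd (upd v j y) i z.
    by apply/funext => k; rewrite /w /upd; case: eqP => // ->; rewrite (negbTE ji).
  rewrite !wC; have := pl (upd v j y) i x x' 1; rewrite qre1 scale1r mul1r.
  by apply=> // k; rewrite /upd; case: ifP.
have wr x y y' : pp x -> pp y -> pp y' -> phi (w x (y + y')) = phi (w x y) + phi (w x y').
  move=> px py py'; have := pl (upd v i x) j y y' 1; rewrite qre1 scale1r mul1r.
  by apply=> //; exact: ppu.
have ppD : pp (v i + v j).
  by have := pp_lin 1 (ppv i) (ppv j); rewrite qre1 scale1r.
have := w0 _ ppD; rewrite wl // !wr // !w0 // add0r addr0.
have -> : w (v i) (v j) = v.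
  apply/funext => k; rewrite /w /upd; case: eqP => [->//|_].
  by case: eqP => // ->.
by move=> /eqP; rewrite addr_eq0 => /eqP ->; rewrite opprK.
Qed.

Lemma scaleNq m n (u : 'M[H]_(m, n)) : qre (-1) *: u = - u.
Proof.
by apply/matrixP => i j; rewrite scalemxE oppmxE; apply: quat_ext; rewrite !qE; ring.
Qed.

Lemma ppN (u : M2) : pp u -> pp (- u).
Proof. by move=> pu; have := pp_lin (-1) pu (pp0 R); rewrite scaleNq addr0. Qed.

(** * Classification of the invariant 3-forms *)

Section InvariantForms.
Variable phi : tensor R M2 3.
Hypotheses (tphi : is_tensor (@pp R) phi) (aphi : alternating_tensor phi)
  (iphi : Ad_invariant phi).

Let seq3_pp (u a b : M2) : pp u -> pp a -> pp b ->
  forall i : 'I_3, pp (nth 0 [:: u; a; b] i).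
Proof. by move=> ? ? ? i; case: (ord3P i) => ->. Qed.

Lemma ev3_swap12 u a b : pp u -> pp a -> pp b -> ev3 phi a u b = - ev3 phi u a b.
Proof.
move=> pu pa pb; have := alternating_swap aphi tphi (seq3_pp pu pa pb) (isT : j0 != j1).
by move=> <-; rewrite /ev3 /tseq; congr phi; apply/funext => i; case: (ord3P i) => ->.
Qed.

Lemma ev3_swap23 u a b : pp u -> pp a -> pp b -> ev3 phi u b a = - ev3 phi u a b.
Proof.
move=> pu pa pb; have := alternating_swap aphi tphi (seq3_pp pu pa pb) (isT : j1 != j2).
by move=> <-; rewrite /ev3 /tseq; congr phi; apply/funext => i; case: (ord3P i) => ->.
Qed.

Lemma ev3N1 u a b : pp u -> pp a -> pp b -> ev3 phi (- u) a b = - ev3 phi u a b.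
Proof.
move=> pu pa pb; have [_ pl] := tphi.
have := pl _ j0 u 0 (-1) (seq3_pp pu pa pb) pu (pp0 R).
have E x : upd (fun i : 'I_3 => nth 0 [:: u; a; b] i) j0 x = (fun i : 'I_3 => nth 0 [:: x; a; b] i).
  by apply/funext => i; case: (ord3P i) => ->.
rewrite !E addr0.
rewrite scaleNq.
have z : phi (fun i : 'I_3 => nth 0 [:: 0; a; b] i) = 0.
  have := pl _ j0 0 0 1 (seq3_pp pu pa pb) (pp0 R) (pp0 R).
  by rewrite !E scaler0 addr0 mul1r => h; lra.
by rewrite z addr0 mulN1r.
Qed.

Lemma ev3N2 u a b : pp u -> pp a -> pp b -> ev3 phi u (- a) b = - ev3 phi u a b.
Proof.
move=> pu pa pb; have pNa : pp (- a).
  exact: ppN.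
by rewrite ev3_swap12 // ev3N1 // ev3_swap12 // opprK.
Qed.

Lemma ev3N3 u a b : pp u -> pp a -> pp b -> ev3 phi u a (- b) = - ev3 phi u a b.
Proof.
move=> pu pa pb; have pNb : pp (- b).
  exact: ppN.
by rewrite ev3_swap23 // ev3N2 // ev3_swap23 // opprK.
Qed.

Lemma ev3_Ad h q d q' d' q'' d'' : h * qconj h = 1 -> qr d = 0 -> qr d' = 0 -> qr d'' = 0 ->
  ev3 phi (pmat (h * q) d) (pmat (h * q') d') (pmat (h * q'') d'') =
  ev3 phi (pmat q d) (pmat q' d') (pmat q'' d'').
Proof.
move=> hh d0 d0' d0''; rewrite /ev3 /tseq.
rewrite -[RHS](iphi (h := mx2 h 0 0 1)); last 2 first.
- by exists h.
- by apply: seq3_pp; exact: pmat_pp.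
congr phi; apply/funext => i; rewrite -!Ad_pmat //.
by case: (ord3P i) => ->.
Qed.

Let qI : H := Quat 0 1 0 0.
Let qJ : H := Quat 0 0 1 0.

Lemma pmatN (q d : H) : qr d = 0 -> pmat (- q) d = - pmat q (- d).
Proof.
move=> d0; by apply: mx2_ext; rewrite !mxsE ?oppr0 ?opprK // qconjN.
Qed.

(* The components of an invariant form at (e_a, e_b, e_c) for a < b < c: the sign of the
   action of -1 kills the forms of odd degree along p_2, and the actions of i and j relate
   the remaining ones. *)
Lemma ev3_invariant a b c : (a < 7)%N -> (b < 7)%N -> (c < 7)%N -> ltnb a b -> ltnb b c ->
  ev3 phi (ebas R a) (ebas R b) (ebas R c) =
  ev_coord (ev3 phi (ebas R 0) (ebas R 1) (ebas R 2))
    (\matrix_(i, l) ev3 phi (ebas R l) (ebas R 3) (ebas R (6 - i))) (dlt R a) b c.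
Proof.
have e7 k : (k < 7)%N -> pp (ebas R k) by exact: ebas_pp.
have w3 l : (l < 3)%N -> (l < 7)%N by move=> l3; exact: leq_trans l3 _.
have m1 : (-1 : H) * qconj (-1) = 1 by apply: quat_ext; rewrite !qE; ring.
have mI : qI * qconj qI = 1 by apply: quat_ext; rewrite !qE /=; ring.
have mJ : qJ * qconj qJ = 1 by apply: quat_ext; rewrite !qE /=; ring.
pose act (h : H) (k : nat) := mx2 h 0 0 1 *m ebas R k *m adjm (mx2 h 0 0 1).
have actE h x y z : h * qconj h = 1 -> (x < 7)%N -> (y < 7)%N -> (z < 7)%N ->
    ev3 phi (act h x) (act h y) (act h z) = ev3 phi (ebas R x) (ebas R y) (ebas R z).
  move=> hh x7 y7 z7; rewrite /act !ebas_pmat // !Ad_pmat // ev3_Ad //; exact: ebas_im.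
have fixd h k : h * qconj h = 1 -> (k < 3)%N -> act h k = ebas R k.
  move=> hh k3; rewrite /act ebas_pmat ?(ltn_trans k3) // Ad_pmat //.
  by case: k k3 => [|[|[|]]] //= _; rewrite mulr0.
(* If left multiplication by h takes the quaternion of e_k to that of e_l, up to the sign recorded
   by s, then Ad(h) does the same to the basis vectors. *)
have move1 h k l (s : bool) : h * qconj h = 1 -> (2 < k < 7)%N -> (2 < l < 7)%N ->
    h * nth 0 [:: 0; 0; 0; qI; qJ; Quat 0 0 0 1; 1] k =
    (if s then -1 else 1) * nth 0 [:: 0; 0; 0; qI; qJ; Quat 0 0 0 1; 1] l ->
    act h k = if s then - ebas R l else ebas R l.
  have eb x : (2 < x < 7)%N -> ebas R x =
      pmat (qre (Num.sqrt 2)^-1 * nth 0 [:: 0; 0; 0; qI; qJ; Quat 0 0 0 1; 1] x) 0.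
    case/andP=> x2 x7; rewrite ebas_pmat //; congr pmat.
      by do 7?[case: x x2 x7 => [|x] x2 x7 //=]; rewrite ?mulr1.
    by do 7?[case: x x2 x7 => [|x] x2 x7 //=].
  move=> hh k37 l37 hk; rewrite /act eb // Ad_pmat // mulrA qreC -mulrA hk eb //.
  case: s hk => _; last by rewrite mul1r.
  by rewrite mulN1r mulrN pmatN // oppr0.
have neg k : (2 < k < 7)%N -> act (-1) k = - ebas R k.
  by move=> k37; rewrite (move1 _ k k true).
have I3 : act qI 3 = - ebas R 6.
  by rewrite (move1 _ 3 6 true) //=; apply: quat_ext; rewrite !qE /=; ring.
have I4 : act qI 4 = ebas R 5.
  by rewrite (move1 _ 4 5 false) //=; apply: quat_ext; rewrite !qE /=; ring.
have I5 : act qI 5 = - ebas R 4.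
  by rewrite (move1 _ 5 4 true) //=; apply: quat_ext; rewrite !qE /=; ring.
have J3 : act qJ 3 = - ebas R 5.
  by rewrite (move1 _ 3 5 true) //=; apply: quat_ext; rewrite !qE /=; ring.
have J5 : act qJ 5 = ebas R 3.
  by rewrite (move1 _ 5 3 false) //=; apply: quat_ext; rewrite !qE /=; ring.
have J4 : act qJ 4 = - ebas R 6.
  by rewrite (move1 _ 4 6 true) //=; apply: quat_ext; rewrite !qE /=; ring.
clearbody act; move: (ebas R) e7 actE fixd move1 neg I3 I4 I5 J3 J5 J4.
move=> e e7 actE fixd _ neg I3 I4 I5 J3 J5 J4.
have Z1 l l' k : (l < 3)%N -> (l' < 3)%N -> (2 < k < 7)%N ->
    ev3 phi (e l) (e l') (e k) = 0.
  move=> l3 l3' /[dup] k37 /andP[_ k7].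
  have := actE (-1) l l' k m1 (w3 l l3) (w3 l' l3') k7.
  rewrite (fixd _ l) // (fixd _ l') // neg // ev3N3; [lra|exact: (e7 _ (w3 l l3))| |exact: e7].
  exact: (e7 _ (w3 l' l3')).
have Z3 k k' k'' : (2 < k < 7)%N -> (2 < k' < 7)%N -> (2 < k'' < 7)%N ->
    ev3 phi (e k) (e k') (e k'') = 0.
  move=> /[dup] h /andP[_ k7] /[dup] h' /andP[_ k7'] /[dup] h'' /andP[_ k7''].
  have := actE (-1) k k' k'' m1 k7 k7' k7''; rewrite !neg //.
  have := (e7 k k7, e7 k' k7', e7 k'' k7''); move=> [[p p'] p'']; have pN := ppN.
  rewrite (ev3N1 p (pN _ p') (pN _ p'')) (ev3N2 p p' (pN _ p'')) (ev3N3 p p' p''); lra.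
have pl l : (l < 3)%N -> pp (e l) by move=> l3; apply: e7; exact: w3.
(* This relation and the next two match the coefficients of the two terms of omega_3, omega_2 and
   omega_1. *)
have R56 l : (l < 3)%N -> ev3 phi (e l) (e 5) (e 6) =
    ev3 phi (e l) (e 3) (e 4).
  move=> l3; have := actE qI l 3%N 4%N mI (w3 l l3) isT isT.
  rewrite fixd // I3 I4 => <-; have [p5 p6] := (e7 5%N isT, e7 6%N isT).
  by rewrite (ev3N2 (pl l l3) p6 p5) (ev3_swap23 (pl l l3) p5 p6) opprK.
have R46 l : (l < 3)%N -> ev3 phi (e l) (e 4) (e 6) =
    - ev3 phi (e l) (e 3) (e 5).
  move=> l3; have := actE qI l 3%N 5%N mI (w3 l l3) isT isT.
  rewrite fixd // I3 I5 => <-; have [p4 p6] := (e7 4%N isT, e7 6%N isT); have p := pl l l3.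
  by rewrite (ev3N2 p p6 (ppN p4)) (ev3N3 p p6 p4) (ev3_swap23 p p4 p6) !opprK.
have R45 l : (l < 3)%N -> ev3 phi (e l) (e 4) (e 5) =
    ev3 phi (e l) (e 3) (e 6).
  move=> l3; have := actE qJ l 4%N 5%N mJ (w3 l l3) isT isT.
  rewrite fixd // J4 J5 => <-; have [p3 p6] := (e7 3%N isT, e7 6%N isT); have p := pl l l3.
  by rewrite (ev3N2 p p6 p3) (ev3_swap23 p p3 p6) opprK.
move: (ev3 phi) Z1 Z3 R56 R46 R45 => f Z1 Z3 R56 R46 R45.
move=> a7 b7 c7 ab bc.
do 7?[case: a a7 ab => [|a] // a7 ab]; do 7?[case: b b7 ab bc => [|b] // b7 ab bc];
  do 7?[case: c c7 bc => [|c] // c7 bc];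
  rewrite /ev_coord /dlt /= ?mxE /= ?(subSS, subn0).
all: first [ring | by rewrite R56 //; ring | by rewrite R46 //; ring |
  by rewrite R45 //; ring | by rewrite Z1 //; ring | by rewrite Z3 //; ring].
Qed.

(** Both functions vanish on repeated indices, and on distinct ones sorting reduces to increasing
    triples. *)
Lemma antisym3_eq (f g : nat -> nat -> nat -> R) n :
  (forall a b c, (a < n)%N -> (b < n)%N -> (c < n)%N -> f b a c = - f a b c) ->
  (forall a b c, (a < n)%N -> (b < n)%N -> (c < n)%N -> f a c b = - f a b c) ->
  (forall a b c, (a < n)%N -> (b < n)%N -> (c < n)%N -> g b a c = - g a b c) ->
  (forall a b c, (a < n)%N -> (b < n)%N -> (c < n)%N -> g a c b = - g a b c) ->
  (forall a b c, (a < n)%N -> (b < n)%N -> (c < n)%N -> ltnb a b -> ltnb b c ->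
     f a b c = g a b c) ->
  forall a b c, (a < n)%N -> (b < n)%N -> (c < n)%N -> f a b c = g a b c.
Proof.
move=> f1 f2 g1 g2 fg a b c an bn cn.
have z (h : nat -> nat -> nat -> R) : (forall a b c, (a < n)%N -> (b < n)%N -> (c < n)%N -> h b a c = - h a b c) ->
  (forall a b c, (a < n)%N -> (b < n)%N -> (c < n)%N -> h a c b = - h a b c) ->
  forall x y, (x < n)%N -> (y < n)%N -> [/\ h x x y = 0, h x y x = 0 & h y x x = 0] :> Prop.
  move=> h1 h2 x y xn yn; have e1 : h x x y = 0 by have := h1 x x y xn xn yn; lra.
  by split=> //; [rewrite (h2 x x y) // e1 oppr0|have := h2 y x x yn xn xn; lra].
have {}z x y xn yn := (z f f1 f2 x y xn yn, z g g1 g2 x y xn yn).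
rewrite (sort3E f1 f2) // (sort3E g1 g2) // /sort3 !ltnbE.
have fg' x y t : (x < n)%N -> (y < n)%N -> (t < n)%N -> (x < y)%N -> (y < t)%N ->
    f x y t = g x y t by move=> *; apply: fg => //; rewrite ltnbE.
case: (ltngtP a b) => [ab|ba|e]; last 1 first.
- rewrite -{b bn}e; have [[? ? ?] [? ? ?]] := z a c an cn.
  by case: ltngtP => [ac|ca|e]; congruence.
- case: (ltngtP b c) => [bc|cb|e].
  + by rewrite fg'.
  + case: (ltngtP a c) => [ac|ca|e]; [by rewrite fg'|by rewrite fg'|].
    by rewrite -{c cn cb}e; have [[? ? ?] [? ? ?]] := z a b an bn; congruence.
  + rewrite -{c cn}e; rewrite ab; have [[? ? ?] [? ? ?]] := z b a bn an; congruence.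
- case: (ltngtP a c) => [ac|ca|e].
  + by rewrite fg'.
  + case: (ltngtP b c) => [bc|cb|e]; [by rewrite fg'|by rewrite fg'|].
    by rewrite -{c cn ca}e; have [[? ? ?] [? ? ?]] := z b a bn an; congruence.
  + by rewrite -{c cn}e ba; have [[? ? ?] [? ? ?]] := z a b an bn; congruence.
Qed.

(** The only terms of omega_1, omega_2, omega_3 containing e^4 are e^47, e^46, e^45, so the value on
    (e_l, e_4, e_(8-i)) reads off A_il; the code counts from 0. *)
Lemma invariant_T3 : phi = T3 (ev3 phi (ebas R 0) (ebas R 1) (ebas R 2))
    (\matrix_(i, l) ev3 phi (ebas R l) (ebas R 3) (ebas R (6 - i))).
Proof.
set C := ev3 _ _ _ _; set A := \matrix_(_, _) _.
apply: tensor_ext => //; first exact: T3_tensor.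
move=> f; rewrite (ev3E phi) (ev3E (T3 C A)).
have e7 k : (k < 7)%N -> pp (ebas R k) by exact: ebas_pp.
apply: (@antisym3_eq (fun a b c => ev3 phi (ebas R a) (ebas R b) (ebas R c))
  (fun a b c => ev3 (T3 C A) (ebas R a) (ebas R b) (ebas R c)) 7) => // [||||] a b c a7 b7 c7.
- by apply: ev3_swap12; exact: e7.
- by apply: ev3_swap23; exact: e7.
- exact: ev3_T3_swap.
- exact: ev3_T3_antisym.
move=> ab bc; rewrite ev3_invariant // (ev3_T3 _ _ (e7 _ a7) (e7 _ b7) (e7 _ c7)).
rewrite f3_ev_coord //.
have ea i : (i < 7)%N -> co i (ebas R a) = dlt R a i by move=> ?; rewrite co_ebas.
by rewrite /ev_coord !ea.
Qed.

End InvariantForms.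

Lemma etaf_ebas (A : 'M[R]_3) k (l : 'I_3) : etaf A (@co R) k (ebas R l) = A k l.
Proof.
rewrite /etaf !co_ebas ?(ltn_trans (ltn_ord l)) //.
by case: (ord3P l) => -> /=; ring.
Qed.

(** At e_1 the form is 6 C times a sum of squares and at e_4 it is 6 det A, which gives both signs.
    Conversely B is a sum of two nonnegative terms whose vanishing forces every coordinate to be
    0. *)
Lemma T3_pos C (A : 'M[R]_3) :
  (forall u, pp u -> u != 0 -> 0 < Bform (T3 C A) u u) <-> 0 < C /\ 0 < det3 A.
Proof.
have ne k : (k < 7)%N -> ebas R k != 0.
  move=> k7; apply/eqP => /(congr1 (co k)); rewrite co_ebas // eqxx => h.
  have : co k (0 : M2) = 0 by have := @co_lin R k 1 0 0; rewrite scaler0 addr0; lra.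
  by rewrite -h => /eqP; rewrite oner_eq0.
split=> [pos|[C0 A0] u pu u0].
  have p0 : pp (ebas R 0) by exact: ebas_pp.
  have p3 : pp (ebas R 3) by exact: ebas_pp.
  have := pos _ p0 (ne 0 isT); have := pos _ p3 (ne 3%N isT).
  rewrite (Bform_T3 _ _ p0 p0) (Bform_T3 _ _ p3 p3) /etaf !co_ebas //=.
  move: (det3 A) (A j0 j0) (A j1 j0) (A j2 j0) => d x y z.
  rewrite !(mulr0, mulr1, addr0, add0r) => h1 h2; split; last by lra.
  have := sqr_ge0 x; have := sqr_ge0 y; have := sqr_ge0 z => hz hy hx.
  have s0 : 0 <= x * x + y * y + z * z by rewrite -!expr2; lra.
  by move: h2; rewrite -mulrA pmulr_rgt0 // => h2; rewrite ltNge; apply/negP => c0;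
     have := mulr_le0_ge0 c0 s0; lra.
rewrite (Bform_T3 _ _ pu pu).
have [x xE] : exists x, forall i, co i u = x i by exists (fun i => co i u).
have [h hE] : exists h, forall i, etaf A (@co R) i u = h i by exists (fun i => etaf A (@co R) i u).
rewrite !xE !hE.
set n := x 3%N * x 3%N + _ + _ + _; set e := h j0 * h j0 + _ + _.
have {}nE : n = x 3%N ^+ 2 + x 4%N ^+ 2 + x 5%N ^+ 2 + x 6%N ^+ 2 by rewrite /n -!expr2.
have {}eE : e = h j0 ^+ 2 + h j1 ^+ 2 + h j2 ^+ 2 by rewrite /e -!expr2.
move: n e nE eE => n e nE eE.
have e0 : 0 <= e by rewrite eE !addr_ge0 ?sqr_ge0.
have n0 : 0 <= n by rewrite nE !addr_ge0 ?sqr_ge0.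
have [//|le0] := ltP 0 (6 * C * e + 6 * det3 A * n).
have Ce : 0 <= C * e by rewrite mulr_ge0 // ltW.
have An : 0 <= det3 A * n by rewrite mulr_ge0 // ltW.
have /eqP : C * e = 0 by lra.
have /eqP : det3 A * n = 0 by lra.
rewrite !mulf_eq0 (gt_eqF C0) (gt_eqF A0) /= nE eE !paddr_eq0 ?addr_ge0 ?sqr_ge0 // !sqrf_eq0.
move=> /andP[/andP[/andP[/eqP c3 /eqP c4] /eqP c5] /eqP c6].
move=> /andP[/andP[/eqP h0 /eqP h1] /eqP h2]; exfalso; move/eqP: u0; apply.
apply: pp_co_ext => //; first exact: pp0.
move=> i; have -> : co i (0 : M2) = 0.
  by have := @co_lin R i 1 0 0; rewrite scaler0 addr0; lra.
(* Cramer's rule: the equations A x = 0 are combined with the cofactors of A. *)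
have cram : [/\ det3 A * x 0%N = 0, det3 A * x 1%N = 0 & det3 A * x 2%N = 0].
  move: h0 h1 h2; rewrite -!hE /etaf /det3 !xE {A0 hE xE}.
  move: {c3 c4 c5 c6 nE} (x 0%N) (x 1%N) (x 2%N) => x0 y z.
  move: (A j0 j0) (A j0 j1) (A j0 j2) (A j1 j0) (A j1 j1) (A j1 j2) (A j2 j0) (A j2 j1) (A j2 j2).
  move=> a b c d e' f g h' k h0 h1 h2; split.
  - transitivity ((a * x0 + b * y + c * z) * (e' * k - f * h') - (d * x0 + e' * y + f * z) * (b * k - c * h')
      + (g * x0 + h' * y + k * z) * (b * f - c * e')); first by ring.
    by rewrite h0 h1 h2; ring.
  - transitivity (- (a * x0 + b * y + c * z) * (d * k - f * g) + (d * x0 + e' * y + f * z) * (a * k - c * g)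
      - (g * x0 + h' * y + k * z) * (a * f - c * d)); first by ring.
    by rewrite h0 h1 h2; ring.
  - transitivity ((a * x0 + b * y + c * z) * (d * h' - e' * g) - (d * x0 + e' * y + f * z) * (a * h' - b * g)
      + (g * x0 + h' * y + k * z) * (a * e' - b * d)); first by ring.
    by rewrite h0 h1 h2; ring.
have [/eqP + /eqP + /eqP +] := cram; rewrite !mulf_eq0 (gt_eqF A0) /= => /eqP c0 /eqP c1 /eqP c2.
by rewrite xE; case: i => [[|[|[|[|[|[|[|//]]]]]]] ?] /=.
Qed.

Lemma Lambda3p_invP (phi : tensor R M2 3) : Lambda3p_inv phi <->
  exists C A, [/\ 0 < C, 0 < det3 A & phi = T3 C A].
Proof.
split=> [[[tp ap pos] ip]|[C [A [C0 A0 ->]]]].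
  have E := invariant_T3 tp ap ip; move: pos; rewrite E => /T3_pos[C0 A0].
  by eexists; eexists; split; [exact: C0|exact: A0|].
split; last exact: T3_inv.
by split; [exact: T3_tensor|exact: T3_alt|apply/T3_pos].
Qed.

End TensorLaws.

(** * The metric of an invariant 3-form *)

Section InducedMetric.
Variable R : realType.
Local Notation H := (quat R).
Local Notation M2 := 'M[quat R]_2.

(** Like [f3], this is abstract in the coordinates e on the P-part and in the form n on the
    complement, for use on p and on the sphere. *)
Definition f2 (V : Type) (P : 'M[R]_3) (lam : R) (e : nat -> V -> R) (n : V -> V -> R)
  (u v : V) : R := \sum_(i < 3) \sum_(j < 3) P i j * e i u * e j v + lam * n u v.

Definition conorm (u v : M2) : R :=
  co 3 u * co 3 v + co 4 u * co 4 v + co 5 u * co 5 v + co 6 u * co 6 v.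

Definition T2 (P : 'M[R]_3) (lam : R) : tensor R M2 2 :=
  restr (@pp R) (fun v => f2 P lam (@co R) conorm (v ord0) (v ord_max)).

Lemma rlin_comb (f : M2 -> R) n (c : nat -> R) : rlin f ->
  f (\sum_(0 <= a < n) qre (c a) *: ebas R a) = \sum_(0 <= a < n) f (ebas R a) * c a.
Proof.
move=> fl; elim: n => [|n IH].
  by rewrite !big_geq //; have := fl 1 0 0; rewrite scaler0 addr0; lra.
by rewrite !big_nat_recr //= addrC fl IH addrC mulrC.
Qed.

Lemma rlin_sum (f : M2 -> R) u : rlin f -> pp u ->
  \sum_(a < 7) f (ebas R a) * co a u = f u.
Proof.
move=> fl pu; rewrite [in RHS](pp_sum pu) rlin_comb // big_mkord; exact: eq_bigr.
Qed.

Lemma etaf_lin (A : 'M[R]_3) k : rlin (etaf A (@co R) k).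
Proof. by move=> c u w; rewrite /etaf !co_lin; ring. Qed.

(* The functions in which the form B of [T3 C A] is diagonal *)
Definition diagf (A : 'M[R]_3) (m : 'I_7) : M2 -> R :=
  match (m : nat) with
  | 0 => etaf A (@co R) j0 | 1 => etaf A (@co R) j1 | 2 => etaf A (@co R) j2
  | _ => co m end.

Definition diagc C (d : R) : 'rV[R]_7 := \row_m (if (m < 3)%N then 6 * C else 6 * d).

Lemma diagf_lin A m : rlin (diagf A m).
Proof.
by rewrite /diagf; case: (m : nat) => [|[|[|?]]]; [exact: etaf_lin|exact: etaf_lin|
  exact: etaf_lin|exact: co_lin].
Qed.

Lemma Bform_diag C A (u v : M2) : pp u -> pp v ->
  Bform (T3 C A) u v = \sum_m diagc C (det3 A) 0 m * diagf A m u * diagf A m v.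
Proof.
move=> pu pv; rewrite (Bform_T3 _ _ pu pv) !big_ord_recl big_ord0 !mxE /diagf /=.
move: (etaf A (@co R)) (@co R) (det3 A) => h c d; rewrite /bump /=; ring.
Qed.

(** In the functions [diagf] the form is diagonal, and F = diag(A, 1) is the change of basis: three
    factors 6 C, four factors 6 det A, and (det F)^2. *)
Lemma det_Bform C A : \det (\matrix_(i < 7, j < 7) Bform (T3 C A) (ebas R i) (ebas R j)) =
  (6 * C) ^+ 3 * (6 * det3 A) ^+ 4 * det3 A ^+ 2.
Proof.
pose F : 'M[R]_(3 + 4) := block_mx A 0 0 1%:M.
have FE (m i : 'I_7) : F m i = diagf A m (ebas R i).
  have i7 := ltn_ord i; rewrite /F /diagf.
  case: (split_ordP (m : 'I_(3 + 4))) => m' ->; case: (split_ordP (i : 'I_(3 + 4))) => i' ->.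
  - by rewrite block_mxEul; case: (ord3P m') => -> /=; rewrite etaf_ebas.
  - rewrite block_mxEur mxE; have r7 : (3 + i' < 7)%N by rewrite ltn_add2l.
    by case: (ord3P m') => -> /=; rewrite /etaf !co_ebas //=; ring.
  - rewrite block_mxEdl mxE /= co_ebas ?ltn_add2l // ?(leq_trans (ltn_ord i')) //.
    by case: eqP => // e; have := ltn_ord i'; rewrite -e ltnNge leq_addr.
  - rewrite block_mxEdr mxE /= co_ebas ?ltn_add2l // eqn_add2l.
    by rewrite -val_eqE; case: eqP.
have -> : \matrix_(i < 7, j < 7) Bform (T3 C A) (ebas R i) (ebas R j) =
    F^T *m diag_mx (diagc C (det3 A)) *m F.
  apply/matrixP => i j; rewrite mxE Bform_diag; [|exact: ebas_pp..].
  rewrite mxE; apply: eq_bigr => m _.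
  have -> : (F^T *m diag_mx (diagc C (det3 A))) i m = F m i * diagc C (det3 A) 0 m.
    by rewrite mul_mx_diag mxE [X in X * _]mxE.
  by rewrite !FE [_ * diagc _ _ _ _]mulrC.
have dF : \det (F : 'M[R]_7) = det3 A.
  have := @det_ublock R 3 4 A 0 1%:M; rewrite det1 mulr1 det3E => <-.
  by congr determinant.
rewrite !det_mulmx det_tr det_diag dF.
rewrite !big_ord_recl big_ord0 !mxE /=; ring.
Qed.

Lemma powR_root n (x : R) : (0 < n)%N -> 0 <= x -> (x ^+ n) `^ (1 / n%:R) = x.
Proof.
move=> n0 x0; rewrite -powR_mulrn // -powRrM mul1r divff ?powRr1 //.
by rewrite pnatr_eq0 -lt0n.
Qed.

Lemma G2_metric_T3 a A : 0 < a -> 0 < det3 A ->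
  let lam := det3 A `^ (1 / 3) / a in
  G2_metric (T3 (a ^+ 3) A) = T2 (lam ^- 2 *: (A^T *m A)) lam.
Proof.
move=> a0 d0 lam; apply/funext => v; rewrite /G2_metric.
set B := \matrix_(_, _) _; set c := 6 `^ (- (2 / 9)) / (\det B) `^ (1 / 9).
pose r := det3 A `^ (1 / 3); have lamE : lam = r / a by [].
have r0 : 0 < r by exact: powR_gt0.
have dr : det3 A = r ^+ 3.
  by rewrite /r -powR_mulrn ?powR_ge0 // -powRrM mul1r mulVf ?powRr1 ?ltW // pnatr_eq0.
(* With det A = r^3 the determinant of B is 6^7 (a r^2)^9, and 6^(-2/9) 6^(-7/9) = 1/6 cancels the
   factor 6 in B. *)
have cE : c = 6^-1 / (a * r ^+ 2).
  rewrite /c det_Bform dr.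
  have -> : (6 * a ^+ 3) ^+ 3 * (6 * r ^+ 3) ^+ 4 * r ^+ 3 ^+ 2 = 6 ^+ 7 * (a * r ^+ 2) ^+ 9 :> R.
    by ring.
  have ar : 0 < a * r ^+ 2 by rewrite mulr_gt0 ?exprn_gt0.
  rewrite powRM ?exprn_ge0 ?ltW // powR_root ?ltW // invfM mulrA; congr (_ / _).
  rewrite -powR_mulrn // -powRrM -powRB; last by rewrite pnatr_eq0 implybT.
  have -> : - (2 / 9) - 7 * (1 / 9) = -1 :> R by field.
  by rewrite powR_inv1.
rewrite /T2 /restr; case: asboolP => [ppv|nppv]; last first.
  rewrite big1 // => i _; rewrite big1 // => j _; rewrite !deE /dd.
  have [h|h] := pselect (pp (v ord0)); last by rewrite asboolF // mulr0 mul0r.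
  have np : ~ pp (v ord_max).
    move=> h'; apply: nppv => k.
    case: (ord2P k) => ->; first by rewrite (_ : 0 = ord0) //; exact/val_inj.
    by rewrite (_ : 1 = ord_max) //; exact/val_inj.
  by rewrite (asboolF np) mulr0.
have [pu pw] := (ppv ord0, ppv ord_max); move: (v ord0) (v ord_max) pu pw => u w pu pw.
transitivity (c * \sum_m diagc (a ^+ 3) (det3 A) 0 m * diagf A m u * diagf A m w).
  transitivity (\sum_(i < 7) \sum_(j < 7) \sum_m c * (diagc (a ^+ 3) (det3 A) 0 m *
      diagf A m (ebas R i) * diagf A m (ebas R j)) * co i u * co j w).
    apply: eq_bigr => i _; apply: eq_bigr => j _.
    rewrite !deE /dd !asboolT // mxE -[bas R i.+1]/(ebas R i) -[bas R j.+1]/(ebas R j).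
    rewrite Bform_diag; [|exact: ebas_pp..].
    by rewrite -!mulr_suml -mulr_sumr /c -!mulrA; congr (_ * _); rewrite mulrCA.
  rewrite mulr_sumr; under eq_bigr => i _ do rewrite exchange_big.
  rewrite exchange_big; apply: eq_bigr => m _.
  have fl := diagf_lin A m.
  rewrite -[diagf A m u](rlin_sum fl pu) -[diagf A m w](rlin_sum fl pw).
  move: (diagc _ _ 0 m) => d; clearbody c.
  rewrite -(mulrA d) big_distrlr /= !mulr_sumr; apply: eq_bigr => i _.
  rewrite !mulr_sumr; apply: eq_bigr => j _.
  by rewrite -!mulrA; congr (_ * (_ * (_ * _))); rewrite mulrCA.
have a0' : a != 0 by rewrite gt_eqF.
have r0' : r != 0 by rewrite gt_eqF.
rewrite cE dr !big_ord_recl big_ord0 !mxE /diagf /= /f2 !sum3E lamE.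
rewrite !mxE !sum3E !mxE /etaf /conorm /bump /=.
move: (co 0 u) (co 1 u) (co 2 u) (co 3 u) (co 4 u) (co 5 u) (co 6 u).
move: (co 0 w) (co 1 w) (co 2 w) (co 3 w) (co 4 w) (co 5 w) (co 6 w) => *.
field; exact/andP.
Qed.

End InducedMetric.

(** * Invariant fields on the sphere *)

Section SmoothQuaternions.
Variable R : realType.
Local Notation H := (quat R).

Section OnOpen.
Variables (V : normedModType R) (U : set V).
Hypothesis oU : open U.
Implicit Types f g : V -> H.

(** The quaternions are not given a norm; smoothness of a quaternion-valued map means smoothness of
    its four components. *)
Definition qsm f := [/\ smooth_on U (fun y => qr (f y)), smooth_on U (fun y => qi (f y)),
  smooth_on U (fun y => qj (f y)) & smooth_on U (fun y => qk (f y))].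

Lemma qsm_cst (c : H) : qsm (fun=> c).
Proof. by split; exact: sm_cst. Qed.

Lemma qsmD f g : qsm f -> qsm g -> qsm (fun y => f y + g y).
Proof. by move=> [? ? ? ?] [? ? ? ?]; split; exact: smD. Qed.

Lemma qsmN f : qsm f -> qsm (fun y => - f y).
Proof. by move=> [? ? ? ?]; split; exact: smN. Qed.

Lemma qsmC f : qsm f -> qsm (fun y => qconj (f y)).
Proof. by move=> [? ? ? ?]; split=> //; exact: smN. Qed.

Lemma qsmM f g : qsm f -> qsm g -> qsm (fun y => f y * g y).
Proof.
move=> [f1 f2 f3 f4] [g1 g2 g3 g4].
by split; rewrite /=; do ! [apply: smB => // | apply: smD => //]; exact: smM.
Qed.

Definition msm m n (Z : V -> 'M[H]_(m, n)) := forall i j, qsm (fun y => Z y i j).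

Lemma msm_cst m n (Z : 'M[H]_(m, n)) : msm (fun=> Z).
Proof. by move=> i j; exact: qsm_cst. Qed.

Lemma msmM m n p (Z : V -> 'M[H]_(m, n)) (Z' : V -> 'M[H]_(n, p)) :
  msm Z -> msm Z' -> msm (fun y => Z y *m Z' y).
Proof.
move=> mZ mZ' i j; under eq_fun do rewrite mxE.
elim: (index_enum _) => [|k r IH]; first by under eq_fun do rewrite big_nil; exact: qsm_cst.
by under eq_fun do rewrite big_cons; apply: qsmD => //; exact: qsmM.
Qed.

Lemma msm_rcoord m n (Z : V -> 'M[H]_(m, n)) : msm Z ->
  smooth_on U (fun y => rcoord (Z y)).
Proof.
move=> mZ; do 3?[apply: sm_pair => //]; apply: sm_mx => // i j;
  by under eq_fun do rewrite mxE; have [] := mZ i j.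
Qed.

End OnOpen.

Definition unrc m n (y : 'M[R]_(m, n) * 'M[R]_(m, n) * 'M[R]_(m, n) * 'M[R]_(m, n)) :
    'M[H]_(m, n) :=
  \matrix_(i, j) Quat (y.1.1.1 i j) (y.1.1.2 i j) (y.1.2 i j) (y.2 i j).

Lemma rcoordK m n : cancel (@rcoord R m n) (@unrc m n).
Proof. by move=> A; apply/matrixP => i j; rewrite !mxE; case: (A i j). Qed.

Lemma msm_unrc (V : normedModType R) (U : set V) m n
    (G : V -> 'M[R]_(m, n) * 'M[R]_(m, n) * 'M[R]_(m, n) * 'M[R]_(m, n)) :
  open U -> smooth_on U G -> msm U (fun y => unrc (G y)).
Proof.
move=> oU sG i j.
have s1 := sm_fst oU sG; have s11 := sm_fst oU s1; have s111 := sm_fst oU s11.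
have s2 := sm_snd oU sG; have s12 := sm_snd oU s1; have s112 := sm_snd oU s11.
by split; under eq_fun do rewrite mxE /=; exact: sm_entry.
Qed.

Lemma open_bigcap_ord (V : topologicalType) k (U : 'I_k -> set V) :
  (forall i, open (U i)) -> open (\bigcap_i U i).
Proof.
elim: k U => [|k IH] U oU.
  by rewrite (_ : \bigcap_i U i = setT); [exact: openT | apply/seteqP; split=> // x _ []].
rewrite (_ : \bigcap_i U i = U ord0 `&` \bigcap_i U (lift ord0 i)).
  by apply: openI => //; exact: IH.
apply/seteqP; split=> [x Ux|x [x0 Ux] i _]; first by split=> [|i _]; exact: Ux.
by case: (unliftP ord0 i) => [j ->|->] //; exact: Ux.
Qed.

(** A formula that makes sense on all matrices is its own extension, so U can be the whole space. *)
Lemma smooth_map_formula m n p q (S : set 'M[H]_(m, n)) (f g : 'M[H]_(m, n) -> 'M[H]_(p, q)) :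
  (forall U, open U -> msm U (fun y => g (unrc y))) ->
  (forall x, S x -> f x = g x) ->
  smooth_map (@rcoord R m n) (@rcoord R p q) S f.
Proof.
move=> sg fg x Sx; exists setT, (fun y => rcoord (g (unrc y))); split=> //.
- exact: openT.
- by apply: msm_rcoord; [exact: openT|apply: sg; exact: openT].
- by move=> y Sy _; rewrite rcoordK fg.
Qed.

(** The fields X i extend only locally, each on its own neighbourhood of x; F is applied to these
    extensions on the finite intersection. *)
Lemma smooth_tfield_formula k (t : tfield R k)
    (F : 'cV[H]_2 -> ('I_k -> 'cV[H]_2) -> R) :
  (forall x v, @S7 R x -> (forall i, T7 x (v i)) -> t x v = F x v) ->
  (forall (V : normedModType R) (U : set V) (x : V -> 'cV[H]_2) (v : 'I_k -> V -> 'cV[H]_2),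
     open U -> msm U x -> (forall i, msm U (v i)) ->
     smooth_on U (fun y => F (x y) (fun i => v i y))) ->
  smooth_tfield t.
Proof.
move=> tF sF X sX TX x Sx.
have /choice[UG HUG] : forall i, exists UG : set _ * (_ -> _),
    [/\ open UG.1, UG.1 (rcoord x), (forall k, Ck k UG.1 UG.2) &
     forall y, @S7 R y -> UG.1 (rcoord y) -> rcoord (X i y) = UG.2 (rcoord y)].
  by move=> i; have [U [G [? ? ? ?]]] := sX i x Sx; exists (U, G).
pose U := \bigcap_i (UG i).1.
have oU : open U by apply: open_bigcap_ord => i; have [] := HUG i.
exists U, (fun y => F (unrc y) (fun i => unrc ((UG i).2 y))); split=> //.
- by move=> i _; have [] := HUG i.
- apply: sF => //; first by apply: msm_unrc => //; exact: sm_id.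
  move=> i; apply: msm_unrc => //; have [_ _ sG _] := HUG i.
  by move=> l; apply: Ck_sub (sG l) => y Uy; exact: Uy.
- move=> y Sy Uy; rewrite tF // => [|i]; last exact: TX.
  rewrite rcoordK; congr F; apply/funext => i; have [_ _ _ E] := HUG i.
  by rewrite -E ?rcoordK //; exact: Uy.
Qed.

End SmoothQuaternions.

(** * The invariant fields extending tensors on p *)

Section Fields.
Variable R : realType.
Local Notation H := (quat R).
Local Notation M2 := 'M[quat R]_2.
Local Notation H2 := 'cV[quat R]_2.
Implicit Types x v w : H2.

Definition cc (x v : H2) : H := qconj (x 0 0) * v 0 0 + qconj (x 1 0) * v 1 0.
(** For x on the sphere, the Hermitian product of the components of v and w orthogonal to the
    quaternionic line of x. At o it is the product [qconj q * q'] of the p_2-parts. *)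
Definition kk (x v w : H2) : H := cc v w - qconj (cc x v) * cc x w.
Definition eX (x : H2) l (v : H2) : R := imq l (cc x v).
Definition oX (x : H2) i (v w : H2) : R := omq i (kk x v w).
Definition nX (x v w : H2) : R := 2 * qr (kk x v w).

(** The condition [S7 x] makes fields truncated to this set vanish off the sphere, as [is_tfield]
    requires. *)
Definition tangent (x : H2) : set H2 := [set v | S7 x /\ T7 x v].

Definition Field3 C (A : 'M[R]_3) : tfield R 3 := fun x =>
  restr (tangent x) (form3 C A (eX x) (oX x)).
Definition Field2 (P : 'M[R]_3) lam : tfield R 2 := fun x =>
  restr (tangent x) (fun v : 'I_2 -> H2 => f2 P lam (eX x) (nX x) (v ord0) (v ord_max)).

Lemma ccE x v : cc x v = (adjm x *m v) 0 0.
Proof. by rewrite !mxsE. Qed.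

Lemma cc_Sp2 (A : M2) x v : Sp2 A -> cc (A *m x) (A *m v) = cc x v.
Proof. by move=> [_ AA]; rewrite !ccE adjmM mulmxA -(mulmxA (adjm x)) AA mulmx1. Qed.

Lemma kk_Sp2 (A : M2) x v w : Sp2 A -> kk (A *m x) (A *m v) (A *m w) = kk x v w.
Proof. by move=> SA; rewrite /kk !cc_Sp2. Qed.

Lemma S7P x : S7 x <-> cc x x = 1.
Proof.
rewrite /S7 /= ip1E /cc; split=> [h|h].
  by apply: quat_ext; move: h; rewrite !qE => h; [rewrite -h|..]; ring.
by have := congr1 (@qr R) h; rewrite !qE => <-; ring.
Qed.

Lemma T7P x v : T7 x v <-> qr (cc x v) = 0.
Proof. by rewrite /T7 /= ip1E /cc !qE; split=> <-; ring. Qed.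

Lemma cc_lin x (c : R) u w : cc x (qre c *: u + w) = qre c * cc x u + cc x w.
Proof.
rewrite /cc !mxsE !mulrDr !mulrA !qreC -!mulrA addrACA; congr (_ + _).
Qed.

Lemma T7_lin x (c : R) u w : T7 x u -> T7 x w -> T7 x (qre c *: u + w).
Proof.
move=> /T7P + /T7P +; move=> hu hw; apply/T7P; rewrite cc_lin; move: hu hw.
by move: (cc x u) (cc x w) => p q; rewrite !qE => -> ->; ring.
Qed.

Lemma T7_Sp2 (A : M2) x v : Sp2 A -> T7 x v -> T7 (A *m x) (A *m v).
Proof. by move=> SA /T7P h; apply/T7P; rewrite cc_Sp2. Qed.

Lemma S7_Sp2 (A : M2) x : Sp2 A -> S7 x -> S7 (A *m x).
Proof. by move=> SA /S7P h; apply/S7P; rewrite cc_Sp2. Qed.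

Lemma eX_lin x l : rlin (eX x l).
Proof.
move=> c u w; rewrite /eX cc_lin; move: (cc x u) (cc x w) => p q.
by case: l => [|[|l]] /=; ring.
Qed.

Lemma kk_lin x (c : R) a u w : kk x a (qre c *: u + w) = qre c * kk x a u + kk x a w.
Proof.
rewrite /kk !cc_lin; move: (qconj _) (cc x u) (cc a u) (cc x w) (cc a w) => z p p' r r'.
by rewrite mulrDr mulrA qreC mulrBr opprD addrACA !mulrA.
Qed.

Lemma kkC x v w : kk x w v = qconj (kk x v w).
Proof.
have ccC u y : cc u y = qconj (cc y u) by rewrite /cc qconjD !qconjM !qconjK.
by rewrite /kk qconjD qconjN qconjM qconjK -(ccC w v).
Qed.

Lemma oX_lin x i a : rlin (oX x i a).
Proof.
move=> c u w; rewrite /oX kk_lin; move: (kk x a u) (kk x a w) => p q.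
by case: i => [|[|i]] /=; ring.
Qed.

Lemma oX_alt x i a b : oX x i b a = - oX x i a b.
Proof.
by rewrite /oX kkC; move: (kk x a b) => p; case: i => [|[|i]]; rewrite /omq !qE; ring.
Qed.

Lemma nX_lin x a : rlin (nX x a).
Proof.
move=> c u w; rewrite /nX kk_lin; move: (kk x a u) (kk x a w) => p q.
by rewrite !qE; ring.
Qed.

Lemma nX_sym x a b : nX x b a = nX x a b.
Proof. by rewrite /nX kkC qE. Qed.

Lemma tangentE x : S7 x -> tangent x = T7 x.
Proof. by move=> Sx; apply/seteqP; split=> [v []|v]. Qed.

Lemma Field3_tensor C A x : S7 x -> is_tensor (T7 x) (Field3 C A x).
Proof.
move=> Sx; rewrite /Field3 tangentE //; apply: restr_tensor; first exact: T7_lin.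
by apply: form3_lin => [l|i a|i a b]; [exact: eX_lin|exact: oX_lin|exact: oX_alt].
Qed.

Lemma f2_lin m n (P : 'M[R]_3) lam (e : nat -> 'M[H]_(m, n) -> R) nn :
  (forall l, rlin (e l)) -> (forall a, rlin (nn a)) -> (forall a b, nn b a = nn a b) ->
  forall (v : 'I_2 -> 'M[H]_(m, n)) i u u' (c : R),
    let t (v : 'I_2 -> 'M[H]_(m, n)) := f2 P lam e nn (v ord0) (v ord_max) in
    t (upd v i (qre c *: u + u')) = c * t (upd v i u) + t (upd v i u').
Proof.
move=> el nl nC v i u u' c t.
have nl' (x y b : 'M[H]_(m, n)) : nn (qre c *: x + y) b = c * nn x b + nn y b.
  by rewrite nC nl (nC b x) (nC b y).
have [->|->] : i = ord0 \/ i = ord_max.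
  by case: (ord2P i) => ->; [left|right]; exact/val_inj.
- rewrite /t !(upd_eq v ord0) !(upd_neq v) //; move: (v ord_max) => b.
  by rewrite /f2 !sum3E !el !nl'; ring.
- rewrite /t !(upd_eq v ord_max) !(upd_neq v) //; move: (v ord0) => b.
  by rewrite /f2 !sum3E !el !nl; ring.
Qed.

Lemma Field2_tensor P lam x : S7 x -> is_tensor (T7 x) (Field2 P lam x).
Proof.
move=> Sx; rewrite /Field2 tangentE //; apply: restr_tensor; first exact: T7_lin.
by apply: f2_lin => *; [exact: eX_lin|exact: nX_lin|exact: nX_sym].
Qed.

Lemma restr_tangent_off k (t : tensor R H2 k.+1) x (v : 'I_k.+1 -> H2) : ~ S7 x ->
  restr (tangent x) t v = 0.
Proof. by move=> nS; rewrite /restr asboolF // => /(_ ord0)[]. Qed.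

Section SmoothFormulas.
Variables (V : normedModType R) (U : set V).
Hypothesis oU : open U.

Lemma sm_imq l (p : V -> H) : qsm U p -> smooth_on U (fun y => imq l (p y)).
Proof. by case: l => [|[|l]] []. Qed.

Lemma sm_omq i (p : V -> H) : qsm U p -> smooth_on U (fun y => omq i (p y)).
Proof.
have s2 := @sm_cst R V R U 2.
by case: i => [|[|i]] [*]; try apply: smN => //; exact: smM.
Qed.

Lemma qsm_cc (x v : V -> H2) : msm U x -> msm U v -> qsm U (fun y => cc (x y) (v y)).
Proof.
by move=> mx mv; apply: qsmD => //; apply: qsmM => //; exact: qsmC.
Qed.

Lemma qsm_kk (x v w : V -> H2) : msm U x -> msm U v -> msm U w ->
  qsm U (fun y => kk (x y) (v y) (w y)).
Proof.
move=> mx mv mw; apply: qsmD => //; first exact: qsm_cc.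
by apply: qsmN => //; apply: qsmM => //; [apply: qsmC => //|]; exact: qsm_cc.
Qed.

Lemma sm_eX l (x v : V -> H2) : msm U x -> msm U v ->
  smooth_on U (fun y => eX (x y) l (v y)).
Proof. by move=> mx mv; apply: sm_imq; exact: qsm_cc. Qed.

Lemma sm_oX i (x v w : V -> H2) : msm U x -> msm U v -> msm U w ->
  smooth_on U (fun y => oX (x y) i (v y) (w y)).
Proof. by move=> mx mv mw; apply: sm_omq; exact: qsm_kk. Qed.

Lemma sm_nX (x v w : V -> H2) : msm U x -> msm U v -> msm U w ->
  smooth_on U (fun y => nX (x y) (v y) (w y)).
Proof.
move=> mx mv mw; apply: smM => //; first exact: sm_cst.
by have [] := qsm_kk mx mv mw.
Qed.

End SmoothFormulas.

Lemma Field3_field C A : is_tfield (Field3 C A).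
Proof.
split=> [x Sx|x v nS|]; first exact: Field3_tensor.
  by rewrite /Field3 restr_tangent_off.
apply: (@smooth_tfield_formula R 3 _ (fun x => form3 C A (eX x) (oX x))).
  by move=> x v Sx Tv; rewrite /Field3 restrT.
move=> V U x v oU mx mv; rewrite /form3 /f3 /etaf /tri.
have se l i : smooth_on U (fun y => eX (x y) l (v i y)) by exact: sm_eX.
have so i j k : smooth_on U (fun y => oX (x y) i (v j y) (v k y)) by exact: sm_oX.
do ! [exact: se | exact: so | exact: sm_cst |
      apply: smB => // | apply: smD => // | apply: smM => //].
Qed.

Lemma Field2_field P lam : is_tfield (Field2 P lam).
Proof.
split=> [x Sx|x v nS|]; first exact: Field2_tensor.
  by rewrite /Field2 restr_tangent_off.
apply: (@smooth_tfield_formula R 2 _ (fun x (v : 'I_2 -> H2) =>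
  f2 P lam (eX x) (nX x) (v ord0) (v ord_max))).
  by move=> x v Sx Tv; rewrite /Field2 restrT.
move=> V U x v oU mx mv; rewrite /f2.
have se l i : smooth_on U (fun y => eX (x y) l (v i y)) by exact: sm_eX.
apply: smD => //; last first.
  by apply: smM => //; [exact: sm_cst|exact: sm_nX].
apply: sm_sum => // i _; apply: sm_sum => // j _.
by apply: smM => //; apply: smM => //; exact: sm_cst.
Qed.

Lemma Field3_inv C A : Sp2_invariant (Field3 C A).
Proof.
move=> B x v SB Sx Tv; rewrite /Field3 !restrT /form3; last 2 first.
- by move=> i; split=> //; exact: Tv.
- by move=> i; split; [exact: S7_Sp2|exact: T7_Sp2].
apply: f3_ext => i i3; rewrite /eX /oX; first by rewrite !cc_Sp2.
by rewrite !kk_Sp2.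
Qed.

Lemma Field2_inv P lam : Sp2_invariant (Field2 P lam).
Proof.
move=> B x v SB Sx Tv; rewrite /Field2 !restrT; last 2 first.
- by move=> i; split=> //; exact: Tv.
- by move=> i; split; [exact: S7_Sp2|exact: T7_Sp2].
rewrite /f2 /nX kk_Sp2 //; congr (_ + _); apply: eq_bigr => i _; apply: eq_bigr => j _.
by rewrite /eX !cc_Sp2.
Qed.

Lemma S7_o : S7 (o7 R).
Proof. by apply/S7P; rewrite /cc !mxsE qconj0 qconj1 mul0r mul1r add0r. Qed.

Lemma cc_o (q d : H) : cc (o7 R) (pmat q d *m o7 R) = d.
Proof. by rewrite /cc !mxsE qconj0 qconj1; rewrite !(mul0r, mulr0, mul1r, mulr1, add0r). Qed.

Lemma kk_o (q d q' d' : H) :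
  kk (o7 R) (pmat q d *m o7 R) (pmat q' d' *m o7 R) = qconj q * q'.
Proof.
rewrite /kk !cc_o /cc !mxsE !(mul0r, mulr0, mul1r, mulr1, add0r).
by rewrite addrK.
Qed.

Lemma pp_T7 (v : M2) : pp v -> T7 (o7 R) (v *m o7 R).
Proof. by move=> /ppP[q [d [d0 ->]]]; apply/T7P; rewrite cc_o. Qed.

Lemma T7_pp (w : H2) : T7 (o7 R) w -> exists2 v, pp v & v *m o7 R = w.
Proof.
move=> /T7P h; exists (pmat (w 0 0) (w 1 0)).
  apply: pmat_pp; move: h; rewrite /cc !mxsE qconj0 qconj1.
  by rewrite mul0r mul1r add0r.
by apply: cv2_ext; rewrite !mxsE mulr0 mulr1 add0r.
Qed.

Lemma ev_Field3 C A : ev (Field3 C A) = T3 C A.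
Proof.
apply/funext => v; rewrite /ev /T3 /restr; case: asboolP => // ppv.
rewrite /Field3 restrT /form3; last by move=> i; split; [exact: S7_o|exact: pp_T7].
have [q0 [d0 [z0 ->]]] := (ppP _).1 (ppv j0).
have [q1 [d1 [z1 ->]]] := (ppP _).1 (ppv j1).
have [q2 [d2 [z2 ->]]] := (ppP _).1 (ppv j2).
apply: f3_ext => i i3; rewrite /eX /oX ?cc_o ?kk_o ?om_pmat //.
by rewrite !co_im.
Qed.

Lemma conorm_pmat (q d q' d' : H) : qr d = 0 -> qr d' = 0 ->
  conorm (pmat q d) (pmat q' d') = 2 * qr (qconj q * q').
Proof.
move=> z z'; have s2 := sqrt2_sqr R; rewrite /conorm !qE !co_pmat //=; move: s2.
by move: (Num.sqrt 2) => s <-; ring.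
Qed.

Lemma ev_Field2 P lam : ev (Field2 P lam) = T2 P lam.
Proof.
apply/funext => v; rewrite /ev /T2 /restr; case: asboolP => // ppv.
rewrite /Field2 restrT; last by move=> i; split; [exact: S7_o|exact: pp_T7].
have [q0 [d0 [z0 ->]]] := (ppP _).1 (ppv ord0).
have [q1 [d1 [z1 ->]]] := (ppP _).1 (ppv ord_max).
rewrite /f2 /nX kk_o conorm_pmat //; congr (_ + _).
by apply: eq_bigr => i _; apply: eq_bigr => j _; rewrite /eX !cc_o !co_im.
Qed.

End Fields.

(** * Transitivity of Sp(2) and evaluation at o *)

Section InvariantFields.
Variable R : realType.
Local Notation H := (quat R).
Local Notation M2 := 'M[quat R]_2.
Local Notation H2 := 'cV[quat R]_2.

Lemma Sp2_adjm (A : M2) : Sp2 A -> Sp2 (adjm A).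
Proof. by move=> [h h']; split; rewrite adjmK. Qed.

Lemma Sp2M (A B : M2) : Sp2 A -> Sp2 B -> Sp2 (A *m B).
Proof.
move=> [a a'] [b b']; split; rewrite adjmM.
  by rewrite -mulmxA (mulmxA B) b mul1mx.
by rewrite -mulmxA (mulmxA (adjm A)) a' mul1mx.
Qed.

Lemma Sp2_1 : Sp2 (1%:M : M2).
Proof. by split; rewrite adjm1 mulmx1. Qed.

Lemma Sp1_Sp2 (A : M2) : Sp1 A -> Sp2 A.
Proof.
move=> [h /= hh <-]; have h'h : qconj h * h = 1 by rewrite qmulCl -qmulCr.
split; apply: mx2_ext; rewrite !mxsE ?qconj0 ?qconj1;
  by rewrite ?hh ?h'h !(mul0r, mulr0, mulr1, addr0, add0r).
Qed.

Lemma Sp1_o (A : M2) : Sp1 A -> A *m o7 R = o7 R.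
Proof.
by move=> [h /= hh <-]; apply: cv2_ext; rewrite !mxsE !(mul0r, mulr0, mulr1, addr0, add0r).
Qed.

Lemma Sp1_adjm (A : M2) : Sp1 A -> Sp1 (adjm A).
Proof.
move=> [h /= hh <-]; exists (qconj h); first by rewrite /= qconjK qmulCl -qmulCr.
by apply: mx2_ext; rewrite !mxsE ?qconj0 ?qconj1.
Qed.

Lemma Sp2_diag (p q : H) : qnorm2 p = 1 -> qnorm2 q = 1 -> Sp2 (mx2 p 0 0 q).
Proof.
move=> p1 q1; split; apply: mx2_ext; rewrite !mxsE ?qconj0;
  by rewrite !(mul0r, mulr0, addr0, add0r) // ?qmulCr ?qmulCl ?p1 ?q1.
Qed.

(* When [x 1 0 != 0], the first column [(|x_1|, - x_1 x_0^* / |x_1|)] completes x to a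
   symplectic matrix. *)
Lemma S7_orbit (x : H2) : S7 x -> exists2 A, Sp2 A & A *m o7 R = x.
Proof.
move=> /S7P; rewrite /cc !qmulCl -qreD -qre1 => /qreI sx.
have colE (a b : H) : mx2 a (x 0 0) b (x 1 0) *m o7 R = x.
  by apply: cv2_ext; rewrite !mxsE !mulr0 !mulr1 !add0r.
have [x10|x10] := eqVneq (x 1 0) 0.
  exists (mx2 0 (x 0 0) 1 (x 1 0)); last exact: colE.
  have n0 : qnorm2 (x 0 0) = 1.
    by rewrite -sx x10 (_ : qnorm2 0 = 0) ?addr0 //; apply/eqP; rewrite qnorm2_eq0.
  rewrite x10; split; apply: mx2_ext; rewrite !mxsE ?qconj0 ?qconj1;
  by rewrite !(mul0r, mulr0, mulr1, addr0, add0r) // ?qmulCr ?qmulCl ?n0.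
have n1 : 0 < qnorm2 (x 1 0) by rewrite lt_def qnorm2_eq0 x10 qnorm2_ge0.
pose n := Num.sqrt (qnorm2 (x 1 0)); have n0 : n != 0 by rewrite gt_eqF // sqrtr_gt0.
have nn : n * n = qnorm2 (x 1 0) by rewrite -expr2 sqr_sqrtr // ltW.
exists (mx2 (qre n) (x 0 0) (- (qre n^-1 * (x 1 0 * qconj (x 0 0)))) (x 1 0)); last exact: colE.
move: (x 0 0) (x 1 0) sx nn {colE x10 n1} => p q pq nn.
have nV : qre n^-1 * qre n = 1 by rewrite -qreM mulVf.
have Nb : qnorm2 (- (qre n^-1 * (q * qconj p))) = qnorm2 p.
  rewrite (_ : qnorm2 (- _) = n^-1 ^+ 2 * (qnorm2 q * qnorm2 p)); last first.
    by rewrite -(qnorm2C p) -qnorm2M /qnorm2 !qE; ring.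
  by rewrite -nn; field.
have pq1 : qre (qnorm2 p) + qre (qnorm2 q) = 1 :> H by rewrite -qreD pq.
have Nn : qnorm2 (qre n) = qnorm2 q by rewrite -nn /qnorm2 !qE; ring.
split; apply: mx2_ext; rewrite !mxsE ?qmulCr ?qmulCl ?Nb ?Nn ?qconjQ //.
- by rewrite addrC.
- rewrite qconjN !qconjM qconjK qconjQ mulrN -(qreC n) -!mulrA nV mulr1.
  by rewrite addNr.
- by rewrite mulNr qreC mulrA -qreM mulfV // qre1 mul1r addNr.
- by rewrite addrC.
- rewrite qconjN !qconjM qconjK qconjQ mulNr qreC -!mulrA qmulCl -nn [p * _]qreC qreM.
  by rewrite !mulrA nV mul1r subrr.
- rewrite mulrN !mulrA [qconj q * _]qreC -!mulrA (mulrA (qconj q)) qmulCl -nn qreM !mulrA nV mul1r.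
  by rewrite qreC subrr.
Qed.

Lemma pull_ev k (t : tfield R k) A : Sp2_invariant t -> Sp2 A -> pull A t = ev t.
Proof.
move=> it SA; apply/funext => v; rewrite /pull /ev /restr; case: asboolP => // ppv.
rewrite -(it A (o7 R) _ SA (S7_o R)) => [|i]; last exact: pp_T7.
by congr t; apply/funext => i; rewrite mulmxA.
Qed.

(** Sp(2) is transitive on the sphere: for x = A o, the adjoint of A brings tangent vectors at x
    back to o, where the fields agree. *)
Lemma invariant_field_ext k (t t' : tfield R k) : is_tfield t -> is_tfield t' ->
  Sp2_invariant t -> Sp2_invariant t' -> ev t = ev t' -> t = t'.
Proof.
move=> [tt t0 _] [tt' t0' _] it it' e; apply/funext => x; apply/funext => v.
have [Sx|nSx] := pselect (S7 x); last by rewrite t0 ?t0'.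
have [<- _] := tt x Sx; have [<- _] := tt' x Sx.
rewrite /restr; case: asboolP => // Tv.
have [A SA Ax] := S7_orbit Sx; have [AA1 AA2] := SA.
have /choice[u uP] i : exists u, pp u /\ u *m o7 R = adjm A *m v i.
  have : T7 (o7 R) (adjm A *m v i).
    rewrite -(mul1mx (o7 R)) -AA2 -mulmxA Ax; apply: T7_Sp2 => //; exact: Sp2_adjm.
  by move=> /T7_pp[u ? ?]; exists u.
have -> : v = fun i => A *m (u i *m o7 R).
  by apply/funext => i; rewrite (uP i).2 mulmxA AA1 mul1mx.
rewrite -Ax it ?it' //; try exact: S7_o; try by move=> i; apply: pp_T7; exact: (uP i).1.
have := congr1 (fun f => f u) e; rewrite /ev !restrT // => i; exact: (uP i).1.
Qed.

(** Sp(1) fixes o, so the tangent vector of [h *m v *m adjm h] at o is h applied to that of v. *)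
Lemma ev_Ad k (t : tfield R k) : Sp2_invariant t -> Ad_invariant (ev t).
Proof.
move=> it h v Sh ppv; have Sph := Sp1_Sp2 Sh.
have ho : adjm h *m o7 R = o7 R by apply/Sp1_o/Sp1_adjm.
have ppA i : pp (h *m v i *m adjm h).
  have [q [d [d0 ->]]] := (ppP _).1 (ppv i); case: Sh => p /= pp1 <-.
  by rewrite Ad_pmat //; exact: pmat_pp.
rewrite /ev !restrT // -(it h (o7 R) (fun i => v i *m o7 R) Sph (S7_o R)) => [|i]; last exact: pp_T7.
rewrite Sp1_o //; congr t; apply/funext => i.
by rewrite -!mulmxA ho.
Qed.

Lemma ev_tensor k (t : tfield R k) : is_tfield t -> is_tensor (@pp R) (ev t).
Proof.
move=> [tt _ _]; have [_ tl] := tt _ (S7_o R); split; first exact: restr_restr.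
move=> v i u w c ppv ppu ppw.
have updP y : pp y -> forall j, pp (upd v i y j).
  by move=> ppy j; rewrite /upd; case: eqP.
have updE y : (fun j => upd v i y j *m o7 R) = upd (fun j => v j *m o7 R) i (y *m o7 R).
  by apply/funext => j; rewrite /upd; case: eqP.
rewrite /ev !restrT; do ?exact: updP; last by apply: updP; exact: pp_lin.
rewrite !updE mulmxDl -scalemxAl tl //; try exact: pp_T7.
by move=> j; exact: pp_T7.
Qed.

Lemma Omega3p_inv_Field3 C (A : 'M[R]_3) : 0 < C -> 0 < det3 A ->
  Omega3p_inv (Field3 C A).
Proof.
move=> C0 A0; split; last exact: Field3_inv.
split; first exact: Field3_field.
  by move=> x; apply/restr_alt/form3_alt => i a b; exact: oX_alt.
move=> B SB; rewrite pull_ev //; last exact: Field3_inv.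
have [//] : Lambda3p_inv (T3 C A) by apply/Lambda3p_invP; exists C, A.
by rewrite ev_Field3.
Qed.

Lemma Omega3p_inv_ev (phi : tfield R 3) : Omega3p_inv phi -> Lambda3p_inv (ev phi).
Proof.
move=> [[fp ap pos] ip]; split; last exact: ev_Ad.
by rewrite -(pull_ev ip Sp2_1); apply: pos; exact: Sp2_1.
Qed.

Lemma Omega3p_inv_bij : set_bij (@Omega3p_inv R) (@Lambda3p_inv R) (@ev R 3).
Proof.
split=> [phi /Omega3p_inv_ev //|phi psi|phi].
  move=> /set_mem[[fp _ _] ip] /set_mem[[fp' _ _] ip'] e.
  exact: invariant_field_ext.
move=> /Lambda3p_invP[C [A [C0 A0 ->]]]; exists (Field3 C A); first exact: Omega3p_inv_Field3.
exact: ev_Field3.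
Qed.

Lemma Omega3p_invP (phi : tfield R 3) : Omega3p_inv phi <->
  exists C A, [/\ 0 < C, 0 < det3 A & phi = Field3 C A].
Proof.
split=> [Op|[C [A [C0 A0 ->]]]]; last exact: Omega3p_inv_Field3.
have /Lambda3p_invP[C [A [C0 A0 e]]] := Omega3p_inv_ev Op.
exists C, A; split=> //; case: Op => -[fp _ _] ip.
apply: invariant_field_ext => //; [exact: Field3_field|exact: Field3_inv|].
by rewrite ev_Field3.
Qed.

End InvariantFields.

(** * Invariant metrics *)

Section SymmetricTensors.
Variable R : realType.
Local Notation H := (quat R).
Local Notation M2 := 'M[quat R]_2.
Local Notation H2 := 'cV[quat R]_2.

Definition qf (P : 'M[R]_3) (x : 'I_3 -> R) : R := \sum_i \sum_j P i j * x i * x j.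

Definition PD (P : 'M[R]_3) := P^T = P /\ forall x, (exists i, x i != 0) -> 0 < qf P x.

Lemma ord2E (i : 'I_2) : i = ord0 \/ i = ord_max.
Proof. by case: (ord2P i) => ->; [left|right]; exact/val_inj. Qed.

Section Classification.
Variable t : tensor R M2 2.
Hypothesis tt : is_tensor (@pp R) t.
Hypothesis st : symmetric_tensor t.
Hypothesis it : Ad_invariant t.

Let pr (u w : M2) : 'I_2 -> M2 := fun i => if i == ord0 then u else w.
Let g u w := t (pr u w).

Lemma pairE (v : 'I_2 -> M2) : v = pr (v ord0) (v ord_max).
Proof. by apply/funext => i; case: (ord2E i) => ->. Qed.

Lemma pair_pp u w : pp u -> pp w -> forall i, pp (pr u w i).
Proof. by move=> pu pw i; rewrite /pr; case: eqP. Qed.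

Lemma g_lin c u u' w : pp u -> pp u' -> pp w ->
  g (qre c *: u + u') w = c * g u w + g u' w.
Proof.
move=> pu pu' pw; have [_ /(_ (pr u w) ord0 u u' c (pair_pp pu pw) pu pu')] := tt.
have E y : upd (pr u w) ord0 y = pr y w by apply/funext => i; case: (ord2E i) => ->.
by rewrite !E.
Qed.

Lemma g_sym u w : g w u = g u w.
Proof.
rewrite /g -(st (pr u w) (tperm ord0 ord_max)); congr t; apply/funext => i /=.
by case: (ord2E i) => ->; rewrite ?tpermL ?tpermR.
Qed.

Lemma g0 w : pp w -> g 0 w = 0.
Proof.
move=> pw; have := g_lin (-1) (pp0 R) (pp0 R) pw.
by rewrite scaler0 addr0 mulN1r addNr.
Qed.

Lemma gN u w : pp u -> pp w -> g (- u) w = - g u w.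
Proof.
move=> pu pw; have := g_lin (-1) pu (pp0 R) pw.
by rewrite scaleNq addr0 (g0 pw) addr0 mulN1r.
Qed.

Lemma g_Ad (h q d q' d' : H) : h * qconj h = 1 -> qr d = 0 -> qr d' = 0 ->
  g (pmat (h * q) d) (pmat (h * q') d') = g (pmat q d) (pmat q' d').
Proof.
move=> hh d0 d0'; have Sh : Sp1 (mx2 h 0 0 1) by exists h.
rewrite /g -(it Sh (pair_pp (pmat_pp q d0) (pmat_pp q' d0'))); congr t; apply/funext => i.
by case: (ord2E i) => ->; rewrite /pr /= Ad_pmat.
Qed.

Let G p q := g (pmat p 0) (pmat q 0).
Lemma p2 q : pp (pmat (q : H) 0).
Proof. exact: pmat_pp. Qed.
Lemma p1 (d : H) : qr d = 0 -> pp (pmat 0 d).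
Proof. exact: pmat_pp. Qed.
Hint Resolve p2 : core.

Lemma G_lin (c : R) p p' q : G (qre c * p + p') q = c * G p q + G p' q.
Proof.
rewrite /G -g_lin //; congr g; apply: mx2_ext; rewrite !mxsE ?mulr0 ?addr0 //.
by rewrite qconjD qconjM qconjQ opprD mulrN qreC.
Qed.

Lemma G_sym p q : G q p = G p q. Proof. exact: g_sym. Qed.

Lemma G0 q : G 0 q = 0.
Proof. by have := G_lin (-1) 0 0 q; rewrite mulr0 addr0 mulN1r addNr. Qed.

Lemma G_Z (c : R) p q : G (qre c * p) q = c * G p q.
Proof. by rewrite -[qre c * p]addr0 G_lin G0 addr0. Qed.

Lemma G_mul h p q : qnorm2 h = 1 -> G (h * p) (h * q) = G p q.
Proof. by move=> /unitqP h1; exact: g_Ad. Qed.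

(** Left multiplication by h takes the pair (h, 1) to (-1, h), and G is symmetric. *)
Lemma G1_im h : qnorm2 h = 1 -> h * h = -1 -> G h 1 = 0.
Proof.
move=> h1 hh; have := G_mul h 1 h1; rewrite mulr1 hh.
have -> : -1 = qre (-1) * 1 :> H by apply: quat_ext; rewrite !qE; ring.
by rewrite G_Z (G_sym h) => e; lra.
Qed.

Lemma G1 q : G q 1 = qr q * G 1 1.
Proof.
have qE' : q = qre (qr q) * 1 + (qre (qi q) * Quat 0 1 0 0 + (qre (qj q) * Quat 0 0 1 0 +
    (qre (qk q) * Quat 0 0 0 1 + 0))).
  by apply: quat_ext; rewrite !qE /=; ring.
have GI : G (Quat 0 1 0 0) 1 = 0.
  by apply: G1_im; [rewrite /qnorm2 /=; ring|apply: quat_ext; rewrite !qE /=; ring].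
have GJ : G (Quat 0 0 1 0) 1 = 0.
  by apply: G1_im; [rewrite /qnorm2 /=; ring|apply: quat_ext; rewrite !qE /=; ring].
have GK : G (Quat 0 0 0 1) 1 = 0.
  by apply: G1_im; [rewrite /qnorm2 /=; ring|apply: quat_ext; rewrite !qE /=; ring].
by rewrite [in LHS]qE' !G_lin G0 GI GJ GK !(mulr0, addr0).
Qed.

(** Left multiplication by the inverse of p / |p| moves p to |p|, which reduces the claim to
    [G1]. *)
Lemma G_conformal p q : G p q = G 1 1 * qr (qconj p * q).
Proof.
have [->|p0] := eqVneq p 0; first by rewrite G0 qconj0 mul0r qE mulr0.
have n1 : 0 < qnorm2 p by rewrite lt_def qnorm2_eq0 p0 qnorm2_ge0.
pose n := Num.sqrt (qnorm2 p); have n0 : n != 0 by rewrite gt_eqF // sqrtr_gt0.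
have nn : n * n = qnorm2 p by rewrite -expr2 sqr_sqrtr // ltW.
pose h := qre n^-1 * p.
have h1 : qnorm2 h = 1.
  rewrite /h qnorm2M -nn (_ : qnorm2 (qre n^-1) = n^-1 ^+ 2); first by field.
  by rewrite /qnorm2 !qE; ring.
have ph : p = qre n * h by rewrite /h mulrA -qreM mulfV // mul1r.
have hh : h * qconj h = 1 by exact/unitqP.
have qq : q = h * (qconj h * q) by rewrite mulrA hh mul1r.
rewrite ph G_Z -{1}[h]mulr1 {1}qq G_mul // G_sym G1.
rewrite mulrA mulrC; congr (_ * _); rewrite qconjM qconjQ qreC -mulrA.
by move: (qconj h * q) => z; rewrite !qE; ring.
Qed.

(** The element -1 of Sp(1) acts by 1 on p_1 and by -1 on p_2. *)
Lemma g_cross q d : qr d = 0 -> g (pmat 0 d) (pmat q 0) = 0.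
Proof.
move=> d0; have := @g_Ad (-1) 0 d q 0; rewrite mulr0 (mulN1r q).
have -> : pmat (- q) 0 = - pmat q 0 by rewrite -{2}oppr0 -pmatN // oppr0.
rewrite g_sym gN //; last exact: p1.
rewrite g_sym => h; have : - g (pmat 0 d) (pmat q 0) = g (pmat 0 d) (pmat q 0).
  by apply: h => //; apply/unitqP; rewrite /qnorm2 !qE; ring.
by move=> e; lra.
Qed.

Let Q (l : nat) : H := nth 0 [:: Quat 0 1 0 0; Quat 0 0 1 0; Quat 0 0 0 1] l.
Let P : 'M[R]_3 := \matrix_(i, j) g (pmat 0 (Q i)) (pmat 0 (Q j)).

Lemma invariant_T2 : exists2 P : 'M[R]_3, P^T = P & exists lam, t = T2 P lam.
Proof.
exists P; first by apply/matrixP => i j; rewrite !mxE g_sym.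
have Q0 l : qr (Q l) = 0 by case: l => [|[|[|l]]]; rewrite /Q /= ?nth_nil.
have dE d : qr d = 0 -> pmat 0 d = qre (qi d) *: pmat 0 (Q 0) + (qre (qj d) *: pmat 0 (Q 1) +
    (qre (qk d) *: pmat 0 (Q 2) + 0)).
  move=> d0; apply: mx2_ext; rewrite !mxsE ?qconj0 ?oppr0 ?mulr0 ?addr0 //.
  by apply: quat_ext; rewrite /Q !qE /= ?d0; ring.
have p1Q l : pp (pmat 0 (Q l)) by exact: p1.
have p1Z c l : pp (qre c *: pmat 0 (Q l) + 0) by apply: pp_lin => //; exact: pp0.
have p1d d w : qr d = 0 -> pp w -> g (pmat 0 d) w =
    qi d * g (pmat 0 (Q 0)) w + qj d * g (pmat 0 (Q 1)) w + qk d * g (pmat 0 (Q 2)) w.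
  move=> d0 pw; rewrite {1}(dE d d0) !g_lin //; do ?[exact: pp0|exact: pp_lin].
  by rewrite g0 //; ring.
(* The value of [conorm] at q = 1 is 2, hence the division. *)
exists (G 1 1 / 2); apply/funext => v; have [tr _] := tt.
rewrite -tr /T2 /restr; case: asboolP => // ppv.
rewrite [in LHS](pairE v) -/(g _ _).
have [q [d [d0 ->]]] := (ppP _).1 (ppv ord0).
have [q' [d' [d0' ->]]] := (ppP _).1 (ppv ord_max).
have split (a b : H) : pmat a b = qre 1 *: pmat 0 b + pmat a 0.
  by apply: mx2_ext; rewrite !mxsE qre1 mul1r ?qconj0 ?oppr0 ?addr0 ?add0r.
have -> : g (pmat q d) (pmat q' d') = g (pmat 0 d) (pmat 0 d') + G q q'.
  rewrite (split q d) g_lin //; [|exact: p1|exact: pmat_pp].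
  rewrite (g_sym (pmat q' d')) (g_sym (pmat q' d') (pmat q 0)) (split q' d').
  rewrite !g_lin //; do ?exact: p1.
  rewrite (g_sym (pmat 0 d) (pmat q' 0)) (g_sym (pmat 0 d) (pmat 0 d')) g_cross //.
  rewrite (g_cross q d0') -/(G q' q) (G_sym q q'); ring.
rewrite G_conformal /f2 conorm_pmat // !sum3E !co_im //; congr (_ + _); last by field.
rewrite (p1d d) //; last exact: p1.
rewrite 3!(g_sym (pmat 0 d')) 3?(p1d d') //.
rewrite (g_sym (pmat 0 (Q 0)) (pmat 0 (Q 1))) (g_sym (pmat 0 (Q 0)) (pmat 0 (Q 2))).
rewrite (g_sym (pmat 0 (Q 1)) (pmat 0 (Q 2))) /P !mxE /=.
rewrite (g_sym (pmat 0 (Q 0)) (pmat 0 (Q 1))) (g_sym (pmat 0 (Q 0)) (pmat 0 (Q 2))).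
rewrite (g_sym (pmat 0 (Q 1)) (pmat 0 (Q 2))).
by move: (g _ _) (g _ _) (g _ _) (g _ _) (g _ _) (g _ _) => *; ring.
Qed.
End Classification.

Lemma f2_sym (V : Type) (P : 'M[R]_3) lam (e : nat -> V -> R) n u v :
  P^T = P -> (forall a b, n b a = n a b) -> f2 P lam e n v u = f2 P lam e n u v.
Proof.
move=> PT nC; rewrite /f2 exchange_big /= nC; congr (_ + _).
apply: eq_bigr => i _; apply: eq_bigr => j _.
by rewrite -{1}PT mxE -!mulrA (mulrC (e j v)).
Qed.

Lemma sym2_tensor (V : Type) (F : V -> V -> R) :
  (forall a b, F b a = F a b) -> symmetric_tensor (fun v : 'I_2 -> V => F (v ord0) (v ord_max)).
Proof.
move=> FC v s /=; case: (ord2E (s ord0)) => s0; case: (ord2E (s ord_max)) => s1;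
  rewrite s0 s1 //.
- by have := perm_inj (etrans s0 (esym s1)).
- by have := perm_inj (etrans s0 (esym s1)).
Qed.

Lemma restr_sym k (V : Type) (W : set V) (t : tensor R V k) :
  symmetric_tensor t -> symmetric_tensor (restr W t).
Proof.
move=> st v s; rewrite /restr st; congr (if _ then _ else _).
apply: asbool_equiv_eq; split=> h i; last exact: h.
by rewrite -[i](permKV s); exact: h.
Qed.

Lemma Field2_sym P lam x : P^T = P -> @symmetric_tensor R H2 2 (Field2 P lam x).
Proof.
move=> PT; apply: restr_sym; apply: sym2_tensor => a b.
by apply: f2_sym => // u v; exact: nX_sym.
Qed.

Lemma f2_diag (V : Type) (P : 'M[R]_3) lam (e : nat -> V -> R) n u :
  f2 P lam e n u u = qf P (fun i => e i u) + lam * n u u.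
Proof. by []. Qed.

Lemma conorm_diag (q d : H) : qr d = 0 -> conorm (pmat q d) (pmat q d) = 2 * qnorm2 q.
Proof. by move=> d0; rewrite conorm_pmat // qmulCl. Qed.

Lemma qf_ge0 P x : PD P -> 0 <= qf P x.
Proof.
move=> [_ h]; have [|n0] := pselect (exists i, x i != 0); first by move/h/ltW.
rewrite /qf big1 // => i _; rewrite big1 // => j _; have [->|xi] := eqVneq (x i) 0.
  by rewrite mulr0 mul0r.
by case: n0; exists i.
Qed.

Lemma T2_pos P lam (u : M2) : PD P -> 0 < lam -> pp u -> u != 0 -> 0 < T2 P lam (fun=> u).
Proof.
move=> PP l0 pu u0; rewrite /T2 restrT // f2_diag.
move: pu u0 => /ppP[q [d [d0 ->]]] u0; rewrite conorm_diag //.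
have n0 : 0 <= lam * (2 * qnorm2 q) by rewrite mulr_ge0 ?(ltW l0) // mulr_ge0 // qnorm2_ge0.
have [q0|q0] := eqVneq q 0; last first.
  apply: ltr_wpDl; first exact: qf_ge0.
  by rewrite mulr_gt0 // mulr_gt0 // lt_def qnorm2_eq0 q0 qnorm2_ge0.
apply: ltr_wpDr => //; apply: PP.2; apply: contrapT => no.
have e (i : 'I_3) : imq i d = 0.
  have [z|z] := eqVneq (imq i d) 0; first exact: z.
  by case: no; exists i; rewrite co_im.
move: u0; rewrite q0 (_ : d = 0); last first.
  by apply: quat_ext; [exact: d0|exact: (e j0)|exact: (e j1)|exact: (e j2)].
by move=> /eqP[]; apply: mx2_ext; rewrite !mxsE ?qconj0 ?oppr0.
Qed.

(** By invariance, positivity at x = A o is positivity at o of the vector moved back by A. *)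
Lemma Field2_Sym2p P lam : PD P -> 0 < lam -> Sym2p_inv (Field2 P lam).
Proof.
move=> PP l0; split; last exact: Field2_inv.
split; [exact: Field2_field|by move=> x; apply: Field2_sym; exact: PP.1|].
move=> x Sx v Tv v0; have [A SA Ax] := S7_orbit Sx; have [AA1 AA2] := SA.
have To : T7 (o7 R) (adjm A *m v).
  rewrite -(mul1mx (o7 R)) -AA2 -mulmxA Ax; apply: T7_Sp2 => //; exact: Sp2_adjm.
have [u ppu uv] := T7_pp To.
have vE : v = A *m (u *m o7 R) by rewrite uv mulmxA AA1 mul1mx.
have u0 : u != 0.
  by apply: contraNneq v0 => u0; rewrite vE u0 mul0mx mulmx0.
have -> : (fun=> v) = (fun _ : 'I_2 => A *m (u *m o7 R)) by rewrite -vE.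
rewrite -Ax (@Field2_inv R P lam A (o7 R) (fun=> u *m o7 R)) //; last 2 first.
- exact: S7_o.
- by move=> _; exact: pp_T7.
have := T2_pos PP l0 ppu u0; rewrite -ev_Field2 /ev restrT //.
Qed.

(** At o, positivity on p_1 says that P is positive definite, and positivity at q = 1 that lam is
    positive. *)
Lemma Sym2p_invP (g : tfield R 2) : Sym2p_inv g <->
  exists P lam, [/\ PD P, 0 < lam & g = Field2 P lam].
Proof.
split=> [[[fg sg pg] ig]|[P [lam [PP l0 ->]]]]; last exact: Field2_Sym2p.
have [P PT [lam e]] : exists2 P : 'M[R]_3, P^T = P & exists lam, ev g = T2 P lam.
  apply: invariant_T2; [exact: ev_tensor| |exact: ev_Ad].
  by apply: restr_sym => v s; exact: (sg (o7 R) (fun i => v i *m o7 R) s).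
have gE : g = Field2 P lam.
  apply: invariant_field_ext => //; [exact: Field2_field|exact: Field2_inv|].
  by rewrite ev_Field2.
have pos (u : M2) : pp u -> u *m o7 R != 0 -> 0 < T2 P lam (fun=> u).
  move=> pu u0; rewrite -e /ev restrT //; apply: pg => //; first exact: S7_o.
  exact: pp_T7.
exists P, lam; split=> //.
- split=> // x [i xi]; pose d := Quat 0 (x j0) (x j1) (x j2).
  have d0 : qr d = 0 by [].
  have /pos : pp (pmat 0 d) by exact: pmat_pp.
  rewrite /T2 restrT; last by move=> _; exact: pmat_pp.
  rewrite f2_diag conorm_diag // (_ : qnorm2 0 = 0); last by rewrite /qnorm2 !qE; ring.
  rewrite !mulr0 addr0 (_ : (fun i : 'I_3 => co i (pmat 0 d)) = x); last first.
    by apply/funext => k; rewrite co_im //; case: (ord3P k) => ->.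
  apply; apply: contra_neq xi => /matrixP/(_ 1 0); rewrite !mxsE mulr0 add0r mulr1.
  by move=> [h0 h1 h2]; case: (ord3P i) => ->.
- have /pos : pp (pmat (1 : H) 0) by exact: pmat_pp.
  rewrite /T2 restrT; last by move=> _; exact: pmat_pp.
  rewrite f2_diag conorm_diag //.
  rewrite (_ : (fun i : 'I_3 => co i (pmat 1 0)) = fun=> 0); last first.
    by apply/funext => k; rewrite co_im //; case: (ord3P k) => ->.
  rewrite /qf big1 => [|i _]; last by rewrite big1 // => j _; rewrite mulr0.
  rewrite add0r (_ : qnorm2 1 = 1); last by rewrite /qnorm2 !qE; ring.
  rewrite mulr1 => h; have : 0 < lam * 2; last by rewrite pmulr_lgt0.
  apply: h; apply/eqP => /matrixP/(_ 0 0); rewrite !mxsE mulr1 mulr0 add0r.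
  by move=> /eqP; rewrite oner_eq0.
Qed.

End SymmetricTensors.

(** * Smooth structures on the spaces of 3-forms and metrics *)

Section SmoothMatrices.
Variables (R : realType) (V : normedModType R) (U : set V).
Hypothesis oU : open U.

Lemma sm_prod I (r : seq I) (f : I -> V -> R) :
  (forall i, smooth_on U (f i)) -> smooth_on U (fun x => \prod_(i <- r) f i x).
Proof.
move=> sf; elim: r => [|i r IH]; first by under eq_fun do rewrite big_nil; exact: sm_cst.
by under eq_fun do rewrite big_cons; exact: smM.
Qed.

Lemma sm_det n (f : V -> 'M[R]_n) : smooth_on U f -> smooth_on U (fun x => \det (f x)).
Proof.
move=> sf; rewrite /determinant; apply: sm_sum => // s _; apply: smM => //; first exact: sm_cst.
by apply: sm_prod => i; exact: sm_entry.
Qed.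

Lemma sm_invmx n (f : V -> 'M[R]_n) : (forall x, U x -> \det (f x) != 0) ->
  smooth_on U f -> smooth_on U (fun x => invmx (f x)).
Proof.
move=> d0 sf; apply: (@sm_ext _ _ _ oU _ (fun x => (\det (f x))^-1 *: \adj (f x))).
  by move=> x Ux; rewrite /invmx unitmxE unitfE d0.
apply: sm_mx => // i j; under eq_fun do rewrite !mxE.
apply: smM => //; first by apply: smV => //; exact: sm_det.
rewrite /cofactor; apply: smM => //; first exact: sm_cst.
apply: sm_det; apply: sm_mx => // k l; under eq_fun do rewrite !mxE.
exact: sm_entry.
Qed.

Lemma open_gt0 (f : V -> R) : smooth_on setT f -> open [set x | 0 < f x].
Proof.
move=> sf; apply: (@open_comp _ _ f [set y | 0 < y]); last exact: open_gt.
by move=> x _; exact: (sm_cont sf).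
Qed.

Lemma sm_form3 (T : Type) (C : V -> R) (A : V -> 'M[R]_3) (e : nat -> T -> R) w v :
  smooth_on U C -> smooth_on U A -> smooth_on U (fun x => form3 (C x) (A x) e w v).
Proof.
move=> sC sA; rewrite /form3 /f3 /etaf.
have sAij i j : smooth_on U (fun x => A x i j) by exact: sm_entry.
do ! [exact: sC | exact: sAij | exact: sm_cst |
      apply: smB => // | apply: smD => // | apply: smM => //].
Qed.

End SmoothMatrices.

(** * The map Phi is a diffeomorphism *)

Section PhiDiffeo.
Variable R : realType.
Local Notation H := (quat R).
Local Notation M2 := 'M[quat R]_2.
Local Notation H2 := 'cV[quat R]_2.

Definition T3C (t : nat -> nat -> nat -> R) : R := t 0 1 2.
Definition T3A (t : nat -> nat -> nat -> R) : 'M[R]_3 := \matrix_(i, l) t l 3 (6 - i)%N.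

Lemma T3_coef C A : T3C (fun a b c => ev3 (T3 C A) (ebas R a) (ebas R b) (ebas R c)) = C /\
  T3A (fun a b c => ev3 (T3 C A) (ebas R a) (ebas R b) (ebas R c)) = A.
Proof.
have e a b c : (a < 7)%N -> (b < 7)%N -> (c < 7)%N ->
    ev3 (T3 C A) (ebas R a) (ebas R b) (ebas R c) = ev_coord C A (fun i => co i (ebas R a)) b c.
  by move=> *; rewrite ev3_T3 ?f3_ev_coord //; exact: ebas_pp.
split; first by rewrite /T3C e // /ev_coord !co_ebas //=; ring.
apply/matrixP => i l; rewrite mxE e //; last 2 first.
- exact: ltn_trans (ltn_ord l) _.
- exact: leq_ltn_trans (leq_subr _ _) _.
by case: (ord3P i) => ->; case: (ord3P l) => ->; rewrite /ev_coord !co_ebas //=; ring.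
Qed.

Definition fidx (a b c : nat) : {ffun 'I_3 -> 'I_7} :=
  [ffun i : 'I_3 => inord (nth 0%N [:: a; b; c] i)].

Definition tidx (y : 'rV[R]_#|{ffun 'I_3 -> 'I_7}|) (a b c : nat) : R :=
  y 0 (enum_rank (fidx a b c)).

Lemma tidxE (t : tensor R M2 3) a b c : (a < 7)%N -> (b < 7)%N -> (c < 7)%N ->
  tidx (tcoord t) a b c = ev3 t (ebas R a) (ebas R b) (ebas R c).
Proof.
move=> a7 b7 c7; rewrite /tidx mxE enum_rankK /ev3 /tseq; congr t; apply/funext => i.
by rewrite ffunE basE; case: (ord3P i) => -> /=; rewrite inordK.
Qed.

(** Being a formula on all coordinate vectors, it supplies the ambient extension of the inverse of
    Phi. *)
Definition invPhi_coord (y : 'rV[R]_#|{ffun 'I_3 -> 'I_7}|) : R * 'M[R]_3 :=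
  (T3C (tidx y) `^ (1 / 3), invmx (T3A (tidx y))).

Lemma invPhi_coordE C A : invPhi_coord (tcoord (T3 C A)) = (C `^ (1 / 3), invmx A).
Proof.
have [hC hA] := T3_coef C A; rewrite /invPhi_coord; congr (_ `^ _, invmx _).
  by rewrite /T3C tidxE.
rewrite -[RHS]hA; apply/matrixP => i l; rewrite !mxE tidxE //.
- exact: ltn_trans (ltn_ord l) _.
- exact: leq_ltn_trans (leq_subr _ _) _.
Qed.

Lemma det3_invmx (A : 'M[R]_3) : 0 < det3 A -> A \in unitmx /\ 0 < det3 (invmx A).
Proof.
rewrite -!det3E => A0; have uA : A \in unitmx by rewrite unitmxE unitfE gt_eqF.
by rewrite uA det_inv invr_gt0.
Qed.

Lemma Phi_smooth : smooth_map (@RGL_coord R) (@tcoord R 3) (@RGLp R) (@Phi R).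
Proof.
move=> z [z1 z2]; exists [set z : R * 'M[R]_3 | 0 < \det z.2], (fun z => tcoord (Phi z)).
have oU : open [set z : R * 'M[R]_3 | 0 < \det z.2].
  apply: open_gt0; apply: sm_det; first exact: openT.
  by apply: sm_snd; [exact: openT|apply: sm_id; exact: openT].
suff sP : smooth_on [set z : R * 'M[R]_3 | 0 < \det z.2] (fun z => tcoord (Phi z)) by split.
apply: sm_mx => // i s; set v := fun i : 'I_3 => ebas R ((enum_val s : {ffun 'I_3 -> 'I_7}) i).
have vE y : tcoord (Phi y) i s = form3 (y.1 ^+ 3) (invmx y.2) (@co R) (om (@co R)) v.
  by rewrite mxE Phi_T3 /T3 restrT // => k; exact: (@ebas_pp R _ (ltn_ord _)).
rewrite (_ : (fun z => _) = fun y : R * 'M[R]_3 =>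
  form3 (y.1 ^+ 3) (invmx y.2) (@co R) (om (@co R)) v); last by apply/funext => y; exact: vE.
apply: sm_form3 => //; first by apply: smX => //; apply: sm_fst => //; exact: sm_id.
apply: sm_invmx => //; first by move=> y /= /gt_eqF ->.
by apply: sm_snd => //; exact: sm_id.
Qed.

Lemma invPhi_smooth : smooth_map (@tcoord R 3) (@RGL_coord R) (@Lambda3p_inv R)
  (fun t => invPhi_coord (tcoord t)).
Proof.
move=> _ /Lambda3p_invP[C [A [C0 A0 ->]]].
have sT a b c : smooth_on setT (fun y => tidx y a b c).
  by apply: sm_entry; [exact: openT|apply: sm_id; exact: openT].
have sA : smooth_on setT (fun y => T3A (tidx y)).
  apply: sm_mx; first exact: openT.
  move=> i j; rewrite (_ : (fun y => _) = fun y => tidx y j 3 (6 - i)%N); first exact: sT.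
  by apply/funext => y; rewrite mxE.
pose U := [set y | 0 < T3C (tidx y)] `&` [set y | 0 < \det (T3A (tidx y))].
have oU : open U.
  by apply: openI; apply: open_gt0; [exact: sT|apply: sm_det => //; exact: openT].
exists U, invPhi_coord; split=> //.
- have [hC hA] : T3C (tidx (tcoord (T3 C A))) = C /\ T3A (tidx (tcoord (T3 C A))) = A.
    have [hC hA] := T3_coef C A; split; first by rewrite /T3C tidxE.
    rewrite -[RHS]hA; apply/matrixP => i l; rewrite !mxE tidxE //.
    + exact: ltn_trans (ltn_ord l) _.
    + exact: leq_ltn_trans (leq_subr _ _) _.
  by split=> /=; rewrite ?hC ?hA ?det3E.
- apply: sm_pair => //.
    by apply: sm_powR => //; [move=> y []|apply: sm_sub (sT _ _ _)].
  apply: sm_invmx => //; first by move=> y [_ /gt_eqF ->].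
  exact: sm_sub sA.
Qed.

Lemma Phi_diffeo : diffeo (@RGL_coord R) (@tcoord R 3) (@RGLp R) (@Lambda3p_inv R) (@Phi R).
Proof.
exists (fun t => invPhi_coord (tcoord t)); split.
- move=> z [z1 z2]; apply/Lambda3p_invP; exists (z.1 ^+ 3), (invmx z.2).
  have [|_ h] := @det3_invmx z.2; first by rewrite -det3E.
  by split=> //; [exact: exprn_gt0|exact: Phi_T3].
- move=> _ /Lambda3p_invP[C [A [C0 A0 ->]]]; rewrite /= invPhi_coordE.
  have [_ h] := det3_invmx A0.
  by split=> /=; [exact: powR_gt0|rewrite det3E].
- split=> [[a D] [/= a0 D0]|_ /Lambda3p_invP[C [A [C0 A0 ->]]]].
    by rewrite Phi_T3 invPhi_coordE /= powR_root ?invmxK // ltW.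
  by rewrite invPhi_coordE Phi_T3 /= invmxK -powR_mulrn ?powR_ge0 // -powRrM
    divfK // powRr1 // ltW.
- exact: Phi_smooth.
- exact: invPhi_smooth.
Qed.

End PhiDiffeo.

(** * Positive definite matrices of size 3 and their Cholesky factor *)

Section Cholesky.
Variable R : realType.
Implicit Types P A U Q : 'M[R]_3.

Definition minor2 P : R := P j0 j0 * P j1 j1 - P j0 j1 * P j0 j1.

Definition posminors P := [/\ 0 < P j0 j0, 0 < minor2 P & 0 < det3 P].

Lemma mx3_ext (A B : 'M[R]_3) :
  A j0 j0 = B j0 j0 -> A j0 j1 = B j0 j1 -> A j0 j2 = B j0 j2 ->
  A j1 j0 = B j1 j0 -> A j1 j1 = B j1 j1 -> A j1 j2 = B j1 j2 ->
  A j2 j0 = B j2 j0 -> A j2 j1 = B j2 j1 -> A j2 j2 = B j2 j2 -> A = B.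
Proof.
by move=> *; apply/matrixP => i j; case: (ord3P i) => ->; case: (ord3P j) => ->.
Qed.

Definition mx3 (s : seq (seq R)) : 'M[R]_3 := \matrix_(i, j) nth 0 (nth [::] s i) j.

Lemma qfE P x : qf P x =
  (P j0 j0 * x j0 * x j0 + P j0 j1 * x j0 * x j1 + P j0 j2 * x j0 * x j2) +
  (P j1 j0 * x j1 * x j0 + P j1 j1 * x j1 * x j1 + P j1 j2 * x j1 * x j2) +
  (P j2 j0 * x j2 * x j0 + P j2 j1 * x j2 * x j1 + P j2 j2 * x j2 * x j2).
Proof. by rewrite /qf !sum3E. Qed.

Lemma symE P i j : P^T = P -> P j i = P i j.
Proof. by move=> {1}<-; rewrite mxE. Qed.

Definition vec3 (a b c : R) : 'I_3 -> R := fun i => nth 0 [:: a; b; c] i.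

(** The form at the last column of the adjugate of a leading block is the determinant of that block
    times the previous leading minor; the three test vectors are these columns. *)
Lemma PD_minors P : PD P -> posminors P.
Proof.
move=> [PT pos].
have p0 : 0 < P j0 j0.
  have /pos : exists i, vec3 1 0 0 i != 0 by exists j0; exact: oner_neq0.
  by rewrite qfE /vec3 /= !(mulr0, mulr1, addr0).
have m0 : 0 < minor2 P.
  have /pos : exists i, vec3 (- P j0 j1) (P j0 j0) 0 i != 0 by exists j1; rewrite gt_eqF.
  rewrite qfE /vec3 /= (symE j0 j1 PT) => h; rewrite -(pmulr_rgt0 _ p0).
  by move: h; congr (0 < _); rewrite /minor2; ring.
split=> //.
have /pos : exists i, vec3 (P j0 j1 * P j1 j2 - P j0 j2 * P j1 j1)
    (P j0 j2 * P j0 j1 - P j0 j0 * P j1 j2) (minor2 P) i != 0 by exists j2; rewrite gt_eqF.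
rewrite qfE /vec3 /= (symE j0 j1 PT) (symE j0 j2 PT) (symE j1 j2 PT) => h.
rewrite -(pmulr_rgt0 _ m0) /det3 (symE j0 j1 PT) (symE j0 j2 PT) (symE j1 j2 PT).
by move: h; congr (0 < _); rewrite /minor2; ring.
Qed.

(** The diagonal entries are square roots of quotients of consecutive leading minors. The formula is
    smooth wherever these minors are positive, also at matrices that are not symmetric, which
    provides the extension to an open set that [smooth_map] asks for. *)
Definition chol P : 'M[R]_3 :=
  let u := Num.sqrt (P j0 j0) in let v := Num.sqrt (minor2 P / P j0 j0) in
  mx3 [:: [:: u; P j0 j1 / u; P j0 j2 / u];
          [:: 0; v; (P j1 j2 - P j0 j1 * P j0 j2 / P j0 j0) / v];
          [:: 0; 0; Num.sqrt (det3 P / minor2 P)]].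

Lemma cholP P : P^T = P -> posminors P -> (chol P)^T *m chol P = P /\ 0 < det3 (chol P).
Proof.
move=> PT [p0 m0 d0].
pose u := Num.sqrt (P j0 j0); pose v := Num.sqrt (minor2 P / P j0 j0).
pose w := Num.sqrt (det3 P / minor2 P).
have mp0 : 0 < minor2 P / P j0 j0 by rewrite divr_gt0.
have dm0 : 0 < det3 P / minor2 P by rewrite divr_gt0.
have u0 : 0 < u by rewrite sqrtr_gt0.
have v0 : 0 < v by rewrite sqrtr_gt0.
have w0 : 0 < w by rewrite sqrtr_gt0.
have uu : u ^+ 2 = P j0 j0 by rewrite sqr_sqrtr // ltW.
have vv : v ^+ 2 = minor2 P / P j0 j0 by rewrite sqr_sqrtr // ltW.
have ww : w ^+ 2 = det3 P / minor2 P by rewrite sqr_sqrtr // ltW.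
have uN : u != 0 by rewrite gt_eqF.
have vN : v != 0 by rewrite gt_eqF.
have pN : P j0 j0 != 0 by rewrite gt_eqF.
have mN : minor2 P != 0 by rewrite gt_eqF.
have s10 := symE j0 j1 PT; have s20 := symE j0 j2 PT; have s21 := symE j1 j2 PT.
have e11 : (P j0 j1 / u) ^+ 2 + v ^+ 2 = P j1 j1.
  by rewrite exprMn exprVn uu vv /minor2; field.
have e12 : P j0 j1 / u * (P j0 j2 / u) + v * ((P j1 j2 - P j0 j1 * P j0 j2 / P j0 j0) / v) = P j1 j2.
  rewrite (_ : P j0 j1 / u * _ = P j0 j1 * P j0 j2 / u ^+ 2); last by field.
  by rewrite uu; field; rewrite pN vN.
have e22 : (P j0 j2 / u) ^+ 2 + ((P j1 j2 - P j0 j1 * P j0 j2 / P j0 j0) / v) ^+ 2 + w ^+ 2 = P j2 j2.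
  rewrite !exprMn !exprVn uu vv ww /det3 s10 s20 s21.
  have -> : P j1 j1 = (minor2 P + P j0 j1 * P j0 j1) / P j0 j0 by rewrite /minor2; field.
  by field; rewrite pN mN.
split.
  apply: mx3_ext; rewrite mxE sum3E !mxE /= -/u -/v -/w ?s10 ?s20 ?s21
    ?(mul0r, mulr0, addr0, add0r) -?expr2 ?e11 //; rewrite ?e12 ?e22 //; try by field.
  by rewrite mulrC (mulrC _ v) e12.
by rewrite /det3 !mxE /= -/u -/v -/w !(mul0r, mulr0, subr0, addr0, mulr_gt0).
Qed.

Lemma qf_gram A x : qf (A^T *m A) x = \sum_k (\sum_i A k i * x i) ^+ 2.
Proof. by rewrite qfE !sum3E !mxE !sum3E !mxE; ring. Qed.

Lemma qfZ c P x : qf (c *: P) x = c * qf P x.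
Proof. by rewrite !qfE !mxE; ring. Qed.

(** The form of c A^T A at x is c |A x|^2, and A is invertible. *)
Lemma PD_gram c A : 0 < c -> 0 < det3 A -> PD (c *: (A^T *m A)).
Proof.
move=> c0 A0; split; first by rewrite linearZ /= trmx_mul trmxK.
move=> x [i xi]; rewrite qfZ pmulr_rgt0 // qf_gram.
rewrite lt_def sumr_ge0 ?andbT => [|k _]; last exact: sqr_ge0.
apply: contra_neq xi => /psumr_eq0P s0.
have [uA _] := det3_invmx A0; pose X := \col_i x i.
have AX : A *m X = 0.
  apply/matrixP => k l; rewrite !mxE; apply/eqP; rewrite -sqrf_eq0.
  rewrite -[X in _ == X](s0 (fun m _ => sqr_ge0 _) k) //; apply/eqP; congr (_ ^+ 2).
  by apply: eq_bigr => m _; rewrite !mxE.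
have := congr1 (fun Y => (invmx A *m Y) i 0) AX.
by rewrite mulmxA mulVmx // mul1mx mulmx0 !mxE.
Qed.

Lemma det3Z c A : det3 (c *: A) = c ^+ 3 * det3 A.
Proof. by rewrite /det3 !mxE; ring. Qed.

Lemma det3M A B : det3 (A *m B) = det3 A * det3 B.
Proof. by rewrite -!det3E det_mulmx. Qed.

Lemma det3_tr A : det3 A^T = det3 A.
Proof. by rewrite -!det3E det_tr. Qed.

End Cholesky.

(** * The induced metrics as a quotient by SO(3) *)

Section Metrics.
Variable R : realType.
Local Notation H := (quat R).
Local Notation M2 := 'M[quat R]_2.
Local Notation H2 := 'cV[quat R]_2.
Implicit Types (P A D : 'M[R]_3) (z : R * 'M[R]_3) (g : tfield R 2).

Definition mlam (a : R) A : R := det3 A `^ (1 / 3) / a.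
Definition mP (a : R) A : 'M[R]_3 := (mlam a A) ^- 2 *: (A^T *m A).

Lemma mlam_gt0 a A : 0 < a -> 0 < det3 A -> 0 < mlam a A.
Proof. by move=> a0 A0; rewrite divr_gt0 ?powR_gt0. Qed.

Lemma mP_PD a A : 0 < a -> 0 < det3 A -> PD (mP a A).
Proof. by move=> a0 A0; apply: PD_gram => //; rewrite invr_gt0 exprn_gt0 ?mlam_gt0. Qed.

Lemma powR3 (x : R) : 0 < x -> (x `^ (1 / 3)) ^+ 3 = x.
Proof. by move=> x0; rewrite -powR_mulrn ?powR_ge0 // -powRrM divfK // powRr1 // ltW. Qed.

(** Since det (lam U) = lam^3 det U, the equation (det A)^(1/3) / a = lam with A = lam U forces this
    value of a. *)
Definition ma P : R := det3 (chol P) `^ (1 / 3).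
Definition mA P (lam : R) : 'M[R]_3 := lam *: chol P.

Lemma ma_gt0 P : P^T = P -> posminors P -> 0 < ma P.
Proof. by move=> PT /(cholP PT)[_ U0]; rewrite powR_gt0. Qed.

Lemma mA_gt0 P lam : P^T = P -> posminors P -> 0 < lam -> 0 < det3 (mA P lam).
Proof. by move=> PT /(cholP PT)[_ U0] l0; rewrite det3Z mulr_gt0 ?exprn_gt0. Qed.

Lemma mlamK P lam : P^T = P -> posminors P -> 0 < lam -> mlam (ma P) (mA P lam) = lam.
Proof.
move=> PT Pm l0; have [_ U0] := cholP PT Pm.
rewrite /mlam /mA /ma det3Z powRM ?exprn_ge0 ?(ltW l0) ?(ltW U0) // mulfK ?gt_eqF ?powR_gt0 //.
by rewrite powR_root // ltW.
Qed.

Lemma mPK P lam : P^T = P -> posminors P -> 0 < lam -> mP (ma P) (mA P lam) = P.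
Proof.
move=> PT Pm l0; have [UU _] := cholP PT Pm; rewrite /mP mlamK // /mA.
have -> : (lam *: chol P)^T *m (lam *: chol P) = lam ^+ 2 *: ((chol P)^T *m chol P).
  by apply/matrixP => i j; rewrite !mxE !sum3E !mxE; ring.
by rewrite UU scalerA mulVf ?scale1r // expf_neq0 // gt_eqF.
Qed.

Definition Gmet z : tfield R 2 := Field2 (mP z.1 (invmx z.2)) (mlam z.1 (invmx z.2)).

Lemma RGLp_inv z : RGLp z -> 0 < z.1 /\ 0 < det3 (invmx z.2).
Proof. by move=> [z1 z2]; have [|_ h] := @det3_invmx _ z.2; first by rewrite -det3E. Qed.

Lemma Gmet_Sym2p z : RGLp z -> Sym2p_inv (Gmet z).
Proof.
by move=> /RGLp_inv[z1 z2]; apply: Field2_Sym2p; [exact: mP_PD|exact: mlam_gt0].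
Qed.

(** For fields not known to be invariant: the pullbacks by all A in Sp(2) see every tangent vector
    of the sphere. *)
Lemma field_pull_ext k (t t' : tfield R k) : is_tfield t -> is_tfield t' ->
  (forall A : M2, Sp2 A -> pull A t = pull A t') -> t = t'.
Proof.
move=> [tt t0 _] [tt' t0' _] e; apply/funext => x; apply/funext => v.
have [Sx|nSx] := pselect (S7 x); last by rewrite t0 ?t0'.
have [<- _] := tt x Sx; have [<- _] := tt' x Sx.
rewrite /restr; case: asboolP => // Tv.
have [A SA Ax] := S7_orbit Sx; have [AA1 AA2] := SA.
have /choice[u uP] i : exists u, pp u /\ u *m o7 R = adjm A *m v i.
  have : T7 (o7 R) (adjm A *m v i).
    rewrite -(mul1mx (o7 R)) -AA2 -mulmxA Ax; apply: T7_Sp2 => //; exact: Sp2_adjm.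
  by move=> /T7_pp[u ? ?]; exists u.
have -> : v = fun i => A *m u i *m o7 R.
  by apply/funext => i; rewrite -mulmxA (uP i).2 mulmxA AA1 mul1mx.
rewrite -Ax; have := congr1 (fun f => f u) (e A SA).
by rewrite /pull !restrT // => i; exact: (uP i).1.
Qed.

(** Invariance of g comes out as a consequence: its pullbacks to p by all A are prescribed, and they
    are equal. *)
Lemma induces_Field3 a A g : 0 < a -> 0 < det3 A ->
  induces (Field3 (a ^+ 3) A) g <-> g = Field2 (mP a A) (mlam a A).
Proof.
move=> a0 A0; have F3 B : Sp2 B -> G2_metric (pull B (Field3 (a ^+ 3) A)) = T2 (mP a A) (mlam a A).
  move=> SB; rewrite pull_ev //; last exact: Field3_inv.
  by rewrite ev_Field3 G2_metric_T3.
have SF : Sym2p_inv (Field2 (mP a A) (mlam a A)).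
  by apply: Field2_Sym2p; [exact: mP_PD|exact: mlam_gt0].
split=> [[rg pg]|->].
  apply: field_pull_ext; [by case: rg|exact: Field2_field|].
  by move=> B SB; rewrite pg // F3 // pull_ev ?ev_Field2 //; exact: Field2_inv.
split=> [|B SB]; first exact: SF.1.
by rewrite F3 // pull_ev ?ev_Field2 //; exact: Field2_inv.
Qed.

Lemma G2_metrics_inv_Sym2p : @G2_metrics_inv R = @Sym2p_inv R.
Proof.
apply/seteqP; split=> g.
  move=> [_ /Omega3p_invP[C [A [C0 A0 ->]]]]; rewrite -(powR3 C0).
  rewrite induces_Field3 ?powR_gt0 // => ->.
  by apply: Field2_Sym2p; [apply: mP_PD|apply: mlam_gt0]; rewrite ?powR_gt0.
move=> /Sym2p_invP[P [lam [PP l0 ->]]]; have [PT _] := PP; have Pm := PD_minors PP.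
have a0 := ma_gt0 PT Pm; have A0 := mA_gt0 PT Pm l0.
exists (Field3 (ma P ^+ 3) (mA P lam)).
  by apply: Omega3p_inv_Field3 => //; exact: exprn_gt0.
by apply/induces_Field3 => //; rewrite mPK // mlamK.
Qed.

Lemma SO3_inv (Q : 'M[R]_3) : SO3 Q -> [/\ Q^T *m Q = 1%:M, Q \in unitmx & invmx Q = Q^T].
Proof.
move=> [QQ Q1]; have uQ : Q \in unitmx by rewrite unitmxE Q1 unitr1.
have iQ : invmx Q = Q^T by rewrite -[invmx Q]mulmx1 -QQ mulmxA mulVmx // mul1mx.
by split=> //; rewrite -iQ mulVmx.
Qed.

Lemma SO3_tr (Q : 'M[R]_3) : SO3 Q -> SO3 Q^T.
Proof. by move=> SQ; have [QQ _ _] := SO3_inv SQ; split; rewrite ?trmxK ?det_tr; case: SQ. Qed.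

Lemma SO3M (Q Q' : 'M[R]_3) : SO3 Q -> SO3 Q' -> SO3 (Q *m Q').
Proof.
move=> [a b] [c d]; split; last by rewrite det_mulmx b d mulr1.
by rewrite trmx_mul mulmxA -(mulmxA Q) c mulmx1.
Qed.

Lemma SO3_1 : SO3 (1%:M : 'M[R]_3).
Proof. by split; [rewrite trmx1 mulmx1|exact: det1]. Qed.

Lemma coset_refl D : coset D D.
Proof. by exists 1%:M; [exact: SO3_1|rewrite mulmx1]. Qed.

Lemma invmx_mul3 (D Q : 'M[R]_3) : D \in unitmx -> SO3 Q -> invmx (D *m Q) = Q^T *m invmx D.
Proof.
move=> uD SQ; have [QQ uQ iQ] := SO3_inv SQ.
have uDQ : D *m Q \in unitmx by rewrite unitmx_mul uD.
rewrite -[RHS]mulmx1 -(mulmxV uDQ) !mulmxA -(mulmxA _ _ D) mulVmx // mulmx1 QQ.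
by rewrite mul1mx.
Qed.

Lemma RGLp_unit z : RGLp z -> z.2 \in unitmx.
Proof. by move=> [_ h]; rewrite unitmxE unitfE gt_eqF. Qed.

Lemma Gmet_coset z D : RGLp z -> coset z.2 D -> Gmet (z.1, D) = Gmet z.
Proof.
move=> Rz [Q SQ <-]; have uD := RGLp_unit Rz; have [QQ _ _] := SO3_inv SQ.
have [SQ1 SQ2] := SQ.
have lE : mlam z.1 (invmx (z.2 *m Q)) = mlam z.1 (invmx z.2).
  by rewrite /mlam invmx_mul3 // det3M det3_tr -(det3E Q) SQ2 [1 * det3 _]mul1r.
rewrite /Gmet /= /mP lE; congr (Field2 (_ *: _) _).
by rewrite invmx_mul3 // trmx_mul trmxK -mulmxA (mulmxA Q) SQ1 mul1mx.
Qed.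

(** A coset is represented by an arbitrary element; [Gmet_coset] makes the choice immaterial. *)
Definition Mmap (w : R * set 'M[R]_3) : tfield R 2 := Gmet (w.1, get w.2).

Lemma Mmap_pcoset z : RGLp z -> Mmap (pcoset z) = Gmet z.
Proof.
move=> Rz; rewrite /Mmap /=; apply: Gmet_coset => //.
exact: (getI (coset_refl z.2)).
Qed.

Definition fidx2 (a b : nat) : {ffun 'I_2 -> 'I_7} :=
  [ffun i : 'I_2 => inord (nth 0%N [:: a; b] i)].

Definition tidx2 (y : 'rV[R]_#|{ffun 'I_2 -> 'I_7}|) (a b : nat) : R :=
  y 0 (enum_rank (fidx2 a b)).

Lemma tidx2E P lam a b : (a < 7)%N -> (b < 7)%N ->
  tidx2 (tcoord (T2 P lam)) a b = f2 P lam (@co R) (@conorm R) (ebas R a) (ebas R b).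
Proof.
move=> a7 b7; rewrite /tidx2 mxE enum_rankK /T2 restrT => [|i]; last exact: (@ebas_pp R _ (ltn_ord _)).
by rewrite !ffunE !basE /= !inordK.
Qed.

Definition cP (y : 'rV[R]_#|{ffun 'I_2 -> 'I_7}|) : 'M[R]_3 := \matrix_(i, j) tidx2 y i j.
Definition clam (y : 'rV[R]_#|{ffun 'I_2 -> 'I_7}|) : R := tidx2 y 3 3.

Lemma cP_T2 P lam : cP (tcoord (T2 P lam)) = P.
Proof.
have l7 (i : 'I_3) : (i < 7)%N by exact: ltn_trans (ltn_ord i) _.
apply/matrixP => i j; rewrite mxE tidx2E // /f2 /conorm !sum3E !co_ebas //.
by case: (ord3P i) => ->; case: (ord3P j) => -> /=; ring.
Qed.

Lemma clam_T2 P lam : clam (tcoord (T2 P lam)) = lam.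
Proof. by rewrite /clam tidx2E // /f2 /conorm !sum3E !co_ebas //=; ring. Qed.

Lemma metric_coordE P lam : metric_coord (Field2 P lam) = tcoord (T2 P lam).
Proof. by rewrite /metric_coord ev_Field2. Qed.

Lemma Field2_inj P P' lam lam' : Field2 P lam = Field2 P' lam' -> P = P' /\ lam = lam'.
Proof.
move=> /(congr1 (@metric_coord R)); rewrite !metric_coordE => e.
by split; [rewrite -(cP_T2 P lam) e cP_T2|rewrite -(clam_T2 P lam) e clam_T2].
Qed.

Lemma mlam3 a A : 0 < a -> 0 < det3 A -> det3 A = (mlam a A * a) ^+ 3.
Proof. by move=> a0 A0; rewrite /mlam divfK ?gt_eqF // powR3. Qed.

(** Equal lam and P give equal A^T A, hence equal det A > 0, hence equal a by [mlam3]; then D and D'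
    differ by an orthogonal factor Q of determinant 1. *)
Lemma Gmet_inj z z' : RGLp z -> RGLp z' -> Gmet z = Gmet z' -> pcoset z = pcoset z'.
Proof.
move=> Rz Rz' /Field2_inj[eP el].
have [z0 A0] := RGLp_inv Rz; have [z0' A0'] := RGLp_inv Rz'.
have [uD uD'] := (RGLp_unit Rz, RGLp_unit Rz').
have l0 := mlam_gt0 z0 A0.
have ll : mlam z.1 (invmx z.2) ^+ 2 != 0 by rewrite expf_neq0 // gt_eqF.
have eA : (invmx z.2)^T *m invmx z.2 = (invmx z'.2)^T *m invmx z'.2.
  move: eP; rewrite /mP -el => /(congr1 (fun X => mlam z.1 (invmx z.2) ^+ 2 *: X)).
  by rewrite !scalerA mulfV // !scale1r.
have ed : det3 (invmx z.2) = det3 (invmx z'.2).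
  have := congr1 (@det3 R) eA; rewrite !det3M !det3_tr -!expr2 => /eqP.
  by rewrite eqrXn2 ?ltW // => /eqP.
have ea : z.1 = z'.1.
  have := ed; rewrite (mlam3 z0 A0) (mlam3 z0' A0') -el => /eqP.
  rewrite eqrXn2 // ?(mulr_ge0 (ltW l0) (ltW z0)) ?(mulr_ge0 (ltW l0) (ltW z0')) // => /eqP; exact: (mulfI (lt0r_neq0 l0)).
rewrite /pcoset -ea; congr (_, _).
pose Q := invmx z.2 *m z'.2.
have DQ : z'.2 = z.2 *m Q by rewrite mulmxA mulmxV // mul1mx.
have SQ : SO3 Q.
  have QTQ : Q^T *m Q = 1%:M.
    by rewrite trmx_mul mulmxA -(mulmxA z'.2^T) eA !mulmxA -trmx_mul mulVmx //
      trmx1 mul1mx mulVmx.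
  have uQ : Q \in unitmx by rewrite unitmx_mul unitmx_inv uD.
  have iQ : invmx Q = Q^T by rewrite -[RHS]mulmx1 -(mulmxV uQ) mulmxA QTQ mul1mx.
  split; first by rewrite -iQ mulmxV.
  by rewrite det_mulmx det3E ed -det3E -det_mulmx mulVmx // det1.
apply/seteqP; split=> _ [Q' SQ' <-].
  exists (Q^T *m Q'); first exact: SO3M (SO3_tr SQ) SQ'.
  by have [h _] := SQ; rewrite DQ mulmxA -(mulmxA z.2) h mulmx1.
by exists (Q *m Q'); [exact: SO3M|rewrite DQ mulmxA].
Qed.

Definition sect (y : 'rV[R]_#|{ffun 'I_2 -> 'I_7}|) : R * 'M[R]_3 :=
  (ma (cP y), invmx (mA (cP y) (clam y))).

Lemma Gmet_sect P lam : P^T = P -> posminors P -> 0 < lam ->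
  RGLp (ma P, invmx (mA P lam)) /\ Gmet (ma P, invmx (mA P lam)) = Field2 P lam.
Proof.
move=> PT Pm l0; have a0 := ma_gt0 PT Pm; have A0 := mA_gt0 PT Pm l0.
split; last by rewrite /Gmet /= invmxK mPK // mlamK.
by have [_ h] := det3_invmx A0; split=> //=; rewrite det3E.
Qed.

Definition Udom : set 'rV[R]_#|{ffun 'I_2 -> 'I_7}| :=
  [set y | [/\ 0 < cP y j0 j0, 0 < minor2 (cP y), 0 < det3 (cP y) & 0 < clam y]].

Lemma sm_cP : smooth_on setT cP /\ smooth_on setT clam.
Proof.
have st a b : smooth_on setT (fun y => tidx2 y a b).
  by apply: sm_entry; [exact: openT|apply: sm_id; exact: openT].
split; last exact: st.
apply: sm_mx; first exact: openT.
move=> i j; rewrite (_ : (fun y => _) = fun y => tidx2 y i j); first exact: st.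
by apply/funext => y; rewrite mxE.
Qed.

Lemma open_Udom : open Udom.
Proof.
have [sP sl] := sm_cP.
have sE i j : smooth_on setT (fun y => cP y i j) by apply: sm_entry => //; exact: openT.
rewrite (_ : Udom = [set y | 0 < cP y j0 j0] `&` [set y | 0 < minor2 (cP y)] `&`
  [set y | 0 < \det (cP y)] `&` [set y | 0 < clam y]); last first.
  by apply/seteqP; split=> y; rewrite /Udom /= det3E; [case|case=> -[[]]].
have oT := @openT 'rV[R]_#|{ffun 'I_2 -> 'I_7}|.
do 3?[apply: openI]; apply: open_gt0 => //; last exact: sm_det.
by apply: smB => //; exact: smM.
Qed.

Lemma sm_chol (V : normedModType R) (U : set V) (f : V -> 'M[R]_3) : open U ->
  (forall y, U y -> posminors (f y)) -> smooth_on U f -> smooth_on U (fun y => chol (f y)).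
Proof.
move=> oU pf sf; have sE i j : smooth_on U (fun y => f y i j) by exact: sm_entry.
have sm2 : smooth_on U (fun y => minor2 (f y)) by apply: smB => //; exact: smM.
have sd : smooth_on U (fun y => det3 (f y)).
  by under eq_fun do rewrite -det3E; exact: sm_det.
have h1 y : U y -> 0 < f y j0 j0 by case/pf.
have h2 y : U y -> 0 < minor2 (f y) by case/pf.
have h3 y : U y -> 0 < det3 (f y) by case/pf.
have gt (F : 'M[R]_3 -> R) : (forall y, U y -> 0 < F (f y)) ->
  forall y, U y -> F (f y) != 0 by move=> h y /h /gt_eqF ->.
have i1 := smV oU (gt (fun P => P j0 j0) h1) (sE j0 j0).
have i2 := smV oU (gt (@minor2 R) h2) sm2.
have q1 y : U y -> 0 < minor2 (f y) / f y j0 j0 by move=> Uy; rewrite divr_gt0 ?h1 ?h2.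
have q2 y : U y -> 0 < det3 (f y) / minor2 (f y) by move=> Uy; rewrite divr_gt0 ?h3 ?h2.
have sq1 := smM oU sm2 i1; have sq2 := smM oU sd i2.
have su := sm_sqrt oU h1 (sE j0 j0); have sv := sm_sqrt oU q1 sq1.
have hu y : U y -> 0 < Num.sqrt (f y j0 j0) by move=> /h1; rewrite sqrtr_gt0.
have hv y : U y -> 0 < Num.sqrt (minor2 (f y) / f y j0 j0) by move=> /q1; rewrite sqrtr_gt0.
have iu := smV oU (gt (fun P => Num.sqrt (P j0 j0)) hu) su.
have iv := smV oU (gt (fun P => Num.sqrt (minor2 P / P j0 j0)) hv) sv.
apply: sm_mx => // i j.
case: (ord3P i) => ->; case: (ord3P j) => ->; under eq_fun do rewrite mxE /=;
  try exact: sm_cst; try exact: su; try exact: sv; try exact: smM; last exact: sm_sqrt.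
by apply: smM => //; apply: smB => //; apply: smM => //; exact: smM.
Qed.

Lemma sm_sect : smooth_on Udom sect.
Proof.
have [sP' sl'] := sm_cP; have oU := open_Udom.
have sP : smooth_on Udom cP by apply: sm_sub sP'.
have sl : smooth_on Udom clam by apply: sm_sub sl'.
have pm y : Udom y -> posminors (cP y) by case.
have sc : smooth_on Udom (fun y => chol (cP y)) := sm_chol oU pm sP.
have sdc : smooth_on Udom (fun y => \det (chol (cP y))) by exact: sm_det.
(* The diagonal of [chol] is positive even when its argument is not symmetric. *)
have dc y : Udom y -> 0 < \det (chol (cP y)).
  move=> /pm; move: (cP y) => P [p0 m0 d0]; rewrite det3E /det3 !mxE /= !(mul0r, mulr0, subr0, addr0).
  by rewrite !mulr_gt0 ?sqrtr_gt0 ?divr_gt0.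
apply: sm_pair => //.
  apply: (@sm_ext _ _ _ oU _ (fun y => \det (chol (cP y)) `^ (1 / 3))).
    by move=> y _; rewrite /ma -det3E.
  exact: sm_powR.
apply: sm_invmx => //.
  by move=> y Uy; rewrite detZ mulf_neq0 ?gt_eqF ?dc // exprn_gt0 //; case: Uy.
apply: sm_mx => // i j; rewrite (_ : (fun y => _) = fun y => clam y * chol (cP y) i j).
  by apply: smM => //; exact: sm_entry.
by apply/funext => y; rewrite mxE.
Qed.

Lemma Mmap_smooth : smooth_map (@RGL_coord R) (@metric_coord R) (@RGLp R) (Mmap \o @pcoset R).
Proof.
move=> z Rz; pose U := [set z : R * 'M[R]_3 | 0 < z.1] `&` [set z | 0 < \det z.2].
have oT := @openT (R * 'M[R]_3)%type.
have s1 : smooth_on setT (fun z : R * 'M[R]_3 => z.1) by apply: sm_fst => //; exact: sm_id.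
have s2 : smooth_on setT (fun z : R * 'M[R]_3 => z.2) by apply: sm_snd => //; exact: sm_id.
have oU : open U by apply: openI; apply: open_gt0 => //; exact: sm_det.
have s1U : smooth_on U (fun z : R * 'M[R]_3 => z.1) by apply: sm_sub s1.
have s2U : smooth_on U (fun z : R * 'M[R]_3 => z.2) by apply: sm_sub s2.
pose A (z : R * 'M[R]_3) := invmx z.2.
have sA : smooth_on U A by apply: sm_invmx => // y [_ /= /gt_eqF ->].
have posA y : U y -> 0 < y.1 /\ 0 < \det (A y).
  by move=> Uy; have := @RGLp_inv y Uy; rewrite -det3E.
have sl : smooth_on U (fun y => mlam y.1 (A y)).
  apply: (@sm_ext _ _ _ oU _ (fun y => \det (A y) `^ (1 / 3) * (y.1)^-1)).
    by move=> y _; rewrite det3E.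
  apply: smM => //.
    by apply: sm_powR => //; [move=> y /posA[]|exact: sm_det].
  by apply: smV => // y /posA[/gt_eqF ->].
have lpos y : U y -> mlam y.1 (A y) ^+ 2 != 0.
  by move=> /posA[a0 A0]; rewrite expf_neq0 // gt_eqF // mlam_gt0 // -det3E.
have sPij i j : smooth_on U (fun y => mP y.1 (A y) i j).
  apply: (@sm_ext _ _ _ oU _ (fun y => (mlam y.1 (A y) ^+ 2)^-1 * \sum_k A y k i * A y k j)).
    by move=> y _; rewrite !mxE; congr (_ * _); apply: eq_bigr => k _; rewrite !mxE.
  apply: smM => //; first by apply: smV => //; exact: smX.
  by apply: sm_sum => // k _; apply: smM => //; exact: sm_entry.
suff sG : smooth_on U (fun y => tcoord (T2 (mP y.1 (A y)) (mlam y.1 (A y)))).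
  exists U, (fun y => tcoord (T2 (mP y.1 (A y)) (mlam y.1 (A y)))); split=> //.
  by move=> y Ry _; rewrite /= Mmap_pcoset // metric_coordE.
apply: sm_mx => // i s; set v := fun i : 'I_2 => ebas R ((enum_val s : {ffun 'I_2 -> 'I_7}) i).
rewrite (_ : (fun z => _) = fun y : R * 'M[R]_3 =>
  f2 (mP y.1 (A y)) (mlam y.1 (A y)) (@co R) (@conorm R) (v ord0) (v ord_max)); last first.
  by apply/funext => y; rewrite mxE /T2 restrT // => k; exact: (@ebas_pp R _ (ltn_ord _)).
apply: smD => //; last by apply: smM => //; exact: sm_cst.
apply: sm_sum => // k _; apply: sm_sum => // l _.
by do 2!(apply: smM => //; last exact: sm_cst).
Qed.

Lemma Mmap_quotient_diffeo : quotient_diffeo (@RGL_coord R) (@metric_coord R)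
  (@RGLp R) (@pcoset R) (@Sym2p_inv R) Mmap.
Proof.
have sM z : RGLp z -> Mmap (pcoset z) = Gmet z by exact: Mmap_pcoset.
have inD P lam : PD P -> 0 < lam -> Udom (metric_coord (Field2 P lam)).
  by move=> /PD_minors[p0 m0 d0] l0; rewrite /Udom /= metric_coordE cP_T2 clam_T2.
have sectP P lam : PD P -> 0 < lam ->
    RGLp (sect (metric_coord (Field2 P lam))) /\
    Mmap (pcoset (sect (metric_coord (Field2 P lam)))) = Field2 P lam.
  move=> PP l0; have [Rz Gz] := Gmet_sect PP.1 (PD_minors PP) l0.
  by rewrite /sect metric_coordE cP_T2 clam_T2 sM.
split; [split|exact: Mmap_smooth|].
- by move=> _ [z Rz <-]; rewrite /= sM //; exact: Gmet_Sym2p.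
- move=> _ _ /set_mem[z Rz <-] /set_mem[z' Rz' <-]; rewrite !sM //; exact: Gmet_inj.
- move=> _ /Sym2p_invP[P [lam [PP l0 ->]]]; have [Rz Gz] := sectP P lam PP l0.
  exists (pcoset (sect (metric_coord (Field2 P lam)))); last exact: Gz.
  by exists (sect (metric_coord (Field2 P lam))).
- move=> _ /Sym2p_invP[P [lam [PP l0 ->]]].
  exists Udom, (fun g => sect (metric_coord g)); split=> //.
  + exact: open_Udom.
  + exact: inD.
  + move=> _ [/Sym2p_invP[P' [lam' [PP' l0' ->]]] U']; exists Udom, sect; split=> //.
    * exact: open_Udom.
    * exact: sm_sect.
  + by move=> _ /Sym2p_invP[P' [lam' [PP' l0' ->]]] U'; exact: sectP.
Qed.

Lemma Mmap_induces z (phi : tfield R 3) : RGLp z -> Omega3p_inv phi -> ev phi = Phi z ->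
  induces phi (Mmap (pcoset z)).
Proof.
move=> Rz Op e; have [a0 A0] := RGLp_inv Rz.
have -> : phi = Field3 (z.1 ^+ 3) (invmx z.2).
  apply: invariant_field_ext; [by case: Op => -[]|exact: Field3_field|by case: Op|exact: Field3_inv|].
  by rewrite ev_Field3 e Phi_T3.
by apply/induces_Field3 => //; rewrite Mmap_pcoset.
Qed.

End Metrics.

(** * Automorphisms of the sphere *)

Section Speed.
Variable R : realType.

Lemma cvg_halves (t : R) : (fun n => t / 2 ^+ n) @ \oo --> 0.
Proof.
rewrite (_ : (fun n => _) = geometric t 2^-1).
  by apply: cvg_geometric; rewrite ger0_norm ?invr_ge0 // invf_lt1 // ltr1n.
by apply/funext => n /=; rewrite exprVn.
Qed.

Lemma diff_quot_halves (g : R -> R) w t : derivable g 0 1 -> 'D_1 g 0 = w -> t != 0 ->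
  (fun n => (t / 2 ^+ n)^-1 * (g (t / 2 ^+ n) - g 0)) @ \oo --> w.
Proof.
move=> dg <- t0; have /cvgr_dnbhsP/(_ (fun n => t / 2 ^+ n)) := dg.
have -> : (fun n => (t / 2 ^+ n)^-1 * (g (t / 2 ^+ n) - g 0)) =
  (fun n => (t / 2 ^+ n)^-1 *: ((g \o shift 0) ((t / 2 ^+ n) *: 1) - g 0)).
  by apply/funext => n /=; rewrite addr0 [_ *: 1]mulr1.
apply; split; last exact: cvg_halves.
by move=> n; rewrite mulf_neq0 // invr_neq0 // expf_neq0 // pnatr_eq0.
Qed.

(** Up to the factor t^2, the terms are sums of squared difference quotients at 0 along t / 2^n, so
    the squared speed appears in the limit. *)
Lemma sum_sqr_halves m (g : 'I_m -> R -> R) (w : 'I_m -> R) t :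
  (forall i, derivable (g i) 0 1 /\ 'D_1 (g i) 0 = w i) -> t != 0 ->
  (fun n => 4 ^+ n * \sum_i (g i (t / 2 ^+ n) - g i 0) ^+ 2) @ \oo --> t ^+ 2 * \sum_i w i ^+ 2.
Proof.
move=> dg t0.
rewrite (_ : (fun n => _) = (fun n => t ^+ 2 *
    \sum_i ((t / 2 ^+ n)^-1 * (g i (t / 2 ^+ n) - g i 0)) ^+ 2)); last first.
  apply/funext => n; rewrite !mulr_sumr; apply: eq_bigr => i _.
  have -> : 4 = 2 ^+ 2 :> R by rewrite -natrX.
  rewrite -exprM mulnC exprM.
  have : (2 : R) ^+ n != 0 by rewrite expf_neq0 // pnatr_eq0.
  by move: (2 ^+ n) => c c0; rewrite !exprMn invfM invrK exprMn; field; rewrite t0.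
apply: cvgM; first exact: cvg_cst.
elim: (index_enum _) => [|i r IH].
  by under eq_fun do rewrite big_nil; rewrite big_nil; exact: cvg_cst.
under eq_fun do rewrite big_cons; rewrite big_cons; apply: cvgD => //.
have [d1 d2] := dg i; have h := diff_quot_halves d1 d2 t0.
by rewrite !expr2; exact: cvgM.
Qed.

Lemma cvg_half_diff (a b : R ^nat) (l : R) : a @ \oo --> l -> b @ \oo --> l ->
  (fun n => 2^-1 * (a n - b n)) @ \oo --> (0 : R).
Proof.
move=> la lb; rewrite -(mulr0 (2^-1 : R)) -(subrr l).
by apply: cvgM; [exact: cvg_cst|exact: cvgB].
Qed.

Lemma derive_dilation (h : R -> R) (rho : R) : derivable h 0 1 ->
  derivable (fun s => h (rho * s)) 0 1 /\ 'D_1 (fun s => h (rho * s)) 0 = 'D_1 h 0 * rho.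
Proof.
move=> dh; have dl : is_derive (0 : R) (1 : R) (fun s => rho * s) rho.
  have h1 : is_derive (0 : R) (1 : R) (rho \*: (@id R)) (rho *: (1 : R)) by exact: is_deriveZ.
  by move: h1; rewrite [_ *: 1]mulr1.
have dl0 : derivable (fun s : R => rho * s) 0 1 by case: dl.
have dh' : derivable h ((fun s : R => rho * s) 0) 1 by rewrite mulr0.
have e := @derive1_comp R (fun s => rho * s) h 0 dl0 dh'.
rewrite mulr0 !derive1E in e.
split; last by rewrite -[X in _ * X](@derive_val _ _ _ _ _ _ _ dl) -e.
apply/derivable1_diffP.
apply: (@differentiable_comp _ _ _ _ (fun s : R => rho * s) h); first exact/derivable1_diffP.
exact/derivable1_diffP.
Qed.

(* The error 2(1 - c) is quadratic at 0 with the same leading coefficient for c and c', and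
   each doubling of the argument multiplies the difference by at most 4. *)
Lemma double_angle_unique (c c' : R -> R) t :
  (forall t, c (t * 2) = 2 * c t ^+ 2 - 1) -> (forall t, c' (t * 2) = 2 * c' t ^+ 2 - 1) ->
  (forall t, `|c t| <= 1) -> (forall t, `|c' t| <= 1) ->
  (fun n => 4 ^+ n * (c (t / 2 ^+ n) - c' (t / 2 ^+ n))) @ \oo --> 0 -> c t = c' t.
Proof.
move=> cD cD' c1 c1' lim.
have step n : `|c t - c' t| <= `|4 ^+ n * (c (t / 2 ^+ n) - c' (t / 2 ^+ n))|.
  elim: n => [|n IH]; first by rewrite !expr0 mul1r divr1.
  apply: le_trans IH _.
  have -> : t / 2 ^+ n = t / 2 ^+ n.+1 * 2.
    by rewrite exprS; field; rewrite expf_neq0 // pnatr_eq0.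
  rewrite cD cD'; move: (t / _) => u.
  have -> : 2 * c u ^+ 2 - 1 - (2 * c' u ^+ 2 - 1) = 2 * (c u + c' u) * (c u - c' u) by ring.
  rewrite exprSr -!mulrA !normrM; apply: ler_wpM2l => //; rewrite mulrA; apply: ler_wpM2r => //.
  rewrite !normr_nat; have := ler_normD (c u) (c' u); have := c1 u; have := c1' u; lra.
apply/eqP; rewrite -subr_eq0 -normr_eq0; apply: contraT => n0.
have d0 : 0 < `|c t - c' t| by rewrite lt_def n0 normr_ge0.
move/cvgr0Pnorm_lt: lim => /(_ _ d0)[N _ /(_ N (leqnn N)) /=].
by rewrite ltNge step.
Qed.

(** By the half-angle formula 1 - cos x is twice the square of sin (x / 2), and 0 < x / 2 < pi. *)
Lemma cos_eq1 (x : R) : 0 < x < pi * 2 -> cos x != 1.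
Proof.
move=> /andP[x0 x2]; have s0 : 0 < sin (x / 2) by apply: sin_gt0_pi; rewrite divr_gt0 //= ltr_pdivrMr.
apply: contra_neq (lt0r_neq0 s0) => c1; apply/eqP; rewrite -sqrf_eq0 sin2cos2.
have := cos_mulr2n (x / 2); rewrite -[(x / 2) *+ 2]mulr_natr divfK // c1 => e.
apply/eqP; lra.
Qed.

End Speed.

(** * Great circles through o and their images *)

Section Circles.
Variable R : realType.
Local Notation H := (quat R).
Local Notation H2 := 'cV[quat R]_2.
Local Notation o := (o7 R).

Definition cmp (m : nat) (x : H2) : R := nth 0 [:: qr (x 0 0); qi (x 0 0); qj (x 0 0); qk (x 0 0);
  qr (x 1 0); qi (x 1 0); qj (x 1 0); qk (x 1 0)] m.

Lemma sum_cmp (F : nat -> R) : \sum_(m < 8) F m =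
  F 0%N + F 1%N + F 2%N + F 3%N + F 4%N + F 5%N + F 6%N + F 7%N.
Proof. by rewrite !big_ord_recr big_ord0 /= add0r. Qed.

Lemma ipxx (x : H2) : ip x x = qnorm2 (x 0 0) + qnorm2 (x 1 0).
Proof. by rewrite ip1E !qmulCr !qE. Qed.

Lemma sm_cmp (V : normedModType R) (U : set V) (Z : V -> H2) m : open U -> msm U Z ->
  smooth_on U (fun y => cmp m (Z y)).
Proof.
move=> oU mZ; have [a b c d] := mZ 0 0; have [a' b' c' d'] := mZ 1 0.
case: m => [|[|[|[|[|[|[|[|m]]]]]]]] //.
by rewrite /cmp /= nth_nil; exact: sm_cst.
Qed.

Variable v : H2.
Hypothesis Tv : T7 o v.
Hypothesis v1 : ip v v = 1.

Definition circ (t : R) : H2 := qre (cos t) *: o + qre (sin t) *: v.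

Let qv : qr (v 1 0) = 0.
Proof. by move/T7P: Tv; rewrite /cc !mxsE qconj0 qconj1 mul0r mul1r add0r. Qed.

Lemma circ_S7 t : S7 (circ t).
Proof.
rewrite /S7 /= ipxx /circ !mxsE !mulr0 !mulr1 add0r -(cos2Dsin2 t).
have h : qnorm2 (v 0 0) + qnorm2 (v 1 0) = 1 by rewrite -ipxx.
by rewrite -[X in _ = _ + X]mulr1 -[X in _ = _ + _ * X]h /qnorm2 !qE qv; ring.
Qed.

Lemma circ0 : circ 0 = o.
Proof. by rewrite /circ cos0 sin0 scale1r scale0r addr0. Qed.

(** The normalized line o + s v runs along the great circle, with s the tangent of the angle. *)
Lemma arc_circ s : Defs.arc o v s = circ (atan s).
Proof.
have ipE : ip (o + qre s *: v) (o + qre s *: v) = 1 + s ^+ 2.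
  have h : qnorm2 (v 0 0) + qnorm2 (v 1 0) = 1 by rewrite -ipxx.
  by rewrite ipxx !mxsE -[X in _ = _ + X]mulr1 -[X in _ = _ + _ * X]h /qnorm2 !qE qv; ring.
have r0 : 0 < Num.sqrt (1 + s ^+ 2) by rewrite sqrtr_gt0 ltr_wpDr ?sqr_ge0.
have sE : sin (atan s) = (Num.sqrt (1 + s ^+ 2))^-1 * s.
  have /(congr1 (fun y => cos (atan s) * y)) := atanK s.
  by rewrite /tan mulrCA mulfV ?mulr1 cos_atan // invr_neq0 // gt_eqF.
by rewrite /Defs.arc ipE /circ cos_atan sE scalerDr scalerA -qreM.
Qed.

Variable k : H2 -> H2.
Hypothesis sk : smooth_map (@rcoord R 2 1) (@rcoord R 2 1) (@S7 R) k.

Lemma diff_circ : differentiable (fun t => rcoord (circ t)) (0 : R).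
Proof.
rewrite (_ : (fun t => _) = fun t => cos t *: rcoord o + sin t *: rcoord v); last first.
  by apply/funext => t; congr (_, _, _, _); apply/matrixP => i j; rewrite !mxE !qE; ring.
have dsc (f : R -> R) (a : 'M[R]_(2, 1) * 'M[R]_(2, 1) * 'M[R]_(2, 1) * 'M[R]_(2, 1)) :
    derivable f 0 1 -> differentiable (fun t => f t *: a) (0 : R).
  move=> /derivable1_diffP df; apply: (@differentiable_comp _ _ _ _ f ( *:%R^~ a)) => //.
by apply: differentiableD; apply: dsc; exact: ex_derive.
Qed.

Lemma derivable_circ m : derivable (fun t => cmp m (k (circ t))) 0 1.
Proof.
have [U [G [oU Uo sG kG]]] := sk (S7_o R).
apply: (@near_eq_derivable _ _ _ (fun t => cmp m (unrc (G (rcoord (circ t)))))).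
- have /differentiable_continuous cc := diff_circ.
  have : \forall t \near (0 : R), U (rcoord (circ t)).
    by apply: cc; rewrite circ0; exact: open_nbhs_nbhs.
  apply: filterS => t Ut; rewrite -kG ?rcoordK //; exact: circ_S7.
- apply/derivable1_diffP.
  apply: (@differentiable_comp _ _ _ _ (fun t => rcoord (circ t)) (fun e => cmp m (unrc (G e)))).
    exact: diff_circ.
  rewrite circ0; apply: (@sm_diff _ _ U) => //; apply: sm_cmp => //.
  exact: msm_unrc.
Qed.

(** [arc] and [circ] differ by the change of parameter atan, whose derivative at 0 is 1. *)
Lemma derive_circ m : 'D_1 (fun t => cmp m (k (circ t))) 0 = cmp m (dS7 k o v).
Proof.
have e : derive1 (fun s => cmp m (k (Defs.arc o v s))) 0 = 'D_1 (fun t => cmp m (k (circ t))) 0.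
  rewrite (_ : (fun s => _) = (fun t => cmp m (k (circ t))) \o atan); last first.
    by apply/funext => s /=; rewrite arc_circ.
  rewrite derive1_comp; [|exact: derivable_atan|by rewrite atan0; exact: derivable_circ].
  by rewrite atan0 derive1_atan expr0n /= addr0 invr1 mulr1 derive1E.
rewrite -e; case: m {e} => [|[|[|[|[|[|[|[|m]]]]]]]]; rewrite /cmp /= ?mxE //=.
by rewrite nth_nil derive1E (_ : (fun _ => _) = cst 0) ?derive_cst //; apply/funext => s; rewrite nth_nil.
Qed.

Hypothesis kS : forall x, S7 x -> S7 (k x).
Hypothesis ko : k o = o.
Hypothesis kinj : forall x y, S7 x -> S7 y -> k x = k y -> x = y.

Let c t := qr (k (circ t) 1 0).
Hypothesis cD : forall t, c (t * 2) = 2 * c t ^+ 2 - 1.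

(** For unit vectors the squared chord is 2 minus twice the inner product; this links c to the speed
    of the image curve. *)
Lemma S7_dist (x : H2) : S7 x -> \sum_(m < 8) (cmp m x - cmp m o) ^+ 2 = 2 * (1 - qr (x 1 0)).
Proof.
rewrite (sum_cmp (fun m => (cmp m x - cmp m o) ^+ 2)) /S7 /= ipxx /qnorm2 /cmp /= !mxsE !qE => h.
have -> : 2 * (1 - qr (x 1 0)) = 1 + 1 - 2 * qr (x 1 0) by ring.
by rewrite -[in X in X + 1 - _]h; ring.
Qed.

Lemma S7_qr (x : H2) : S7 x -> `|qr (x 1 0)| <= 1.
Proof.
rewrite /S7 /= ipxx /qnorm2 => h.
rewrite -(@ler_pXn2r _ 2) ?nnegrE // expr1n -normrX ger0_norm ?sqr_ge0 // -h.
have := sqr_ge0 (qr (x 0 0)); have := sqr_ge0 (qi (x 0 0)); have := sqr_ge0 (qj (x 0 0)).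
have := sqr_ge0 (qk (x 0 0)); have := sqr_ge0 (qi (x 1 0)); have := sqr_ge0 (qj (x 1 0)).
have := sqr_ge0 (qk (x 1 0)); lra.
Qed.

Lemma S7_qr1 (x : H2) : S7 x -> qr (x 1 0) = 1 -> x = o.
Proof.
move=> /S7_dist + x1; rewrite x1 subrr mulr0 => /psumr_eq0P s0.
have {}s0 m : (m < 8)%N -> cmp m x = cmp m o.
  move=> m8; apply/eqP; rewrite -subr_eq0 -sqrf_eq0.
  by rewrite (s0 (fun i _ => sqr_ge0 _) (Ordinal m8)).
apply: cv2_ext; apply: quat_ext.
- exact: (s0 0%N).
- exact: (s0 1%N).
- exact: (s0 2%N).
- exact: (s0 3%N).
- exact: (s0 4%N).
- exact: (s0 5%N).
- exact: (s0 6%N).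
- exact: (s0 7%N).
Qed.

Let rho2 := \sum_(m < 8) cmp m (dS7 k o v) ^+ 2.
Let rho := Num.sqrt rho2.

(** The function c and cos (rho t) satisfy the same doubling identity. Subtracted from 1, each is
    half a squared chord: of the curve k (circ t), and of the plane circle g of speed rho. The two
    curves have equal speed at 0, so the difference at t / 2^n is o(4^-n). *)
Lemma circ_cos_rho t : c t = cos (rho * t).
Proof.
have [->|t0] := eqVneq t 0.
  by rewrite mulr0 cos0 /c circ0 ko mxsE.
have rr : rho ^+ 2 = rho2 by rewrite sqr_sqrtr // sumr_ge0 // => i _; exact: sqr_ge0.
have l1 := @sum_sqr_halves R 8 (fun m t => cmp m (k (circ t))) (fun m => cmp m (dS7 k o v)) t
  (fun m => conj (@derivable_circ m) (@derive_circ m)) t0.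
pose g (i : 'I_2) (s : R) := if i == 0 then cos (rho * s) else sin (rho * s).
have dcomp h := @derive_dilation R h rho.
have dg i : derivable (g i) 0 1 /\ 'D_1 (g i) 0 = if i == 0 then 0 else rho.
  rewrite /g; case: eqP => _.
    have [d1 d2] := dcomp _ (@derivable_cos R 0); split=> //.
    by rewrite d2 derive_val sin0 oppr0 mul0r.
  have [d1 d2] := dcomp _ (@derivable_sin R 0); split=> //.
  by rewrite d2 derive_val cos0 mul1r.
have l2 := @sum_sqr_halves R 2 g _ t dg t0.
apply: (@double_angle_unique R c (fun t => cos (rho * t))) => //.
- by move=> u; rewrite mulrA mulr_natr cos_mulr2n mulr_natl.
- by move=> u; apply: S7_qr; apply: kS; exact: circ_S7.
- by move=> u; rewrite ler_norml cos_geN1 cos_le1.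
have e2 : \sum_(i < 2) (if i == 0 then 0 else rho) ^+ 2 = rho2.
  by rewrite !big_ord_recr big_ord0 /= expr0n /= !add0r rr.
rewrite e2 in l2; have l3 := cvg_half_diff l2 l1.
rewrite (_ : (fun n => _) = (fun n => 2^-1 * (4 ^+ n * \sum_i (g i (t / 2 ^+ n) - g i 0) ^+ 2 -
    4 ^+ n * \sum_(m < 8) (cmp m (k (circ (t / 2 ^+ n))) - cmp m (k (circ 0))) ^+ 2))) //.
apply/funext => n; rewrite circ0 ko S7_dist; last by apply: kS; exact: circ_S7.
have -> : \sum_i (g i (t / 2 ^+ n) - g i 0) ^+ 2 = 2 * (1 - cos (rho * (t / 2 ^+ n))).
  rewrite !big_ord_recr big_ord0 /g /= mulr0 cos0 sin0 add0r subr0.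
  by rewrite sin2cos2; ring.
by rewrite /c; field.
Qed.

(* If [rho < 1], then [circ (2 pi) = o] contradicts [c (2 pi) <> 1]; if [rho > 1], then
   [c (2 pi / rho) = 1] contradicts injectivity. *)
Lemma rho2_1 : rho2 = 1.
Proof.
have rr : rho ^+ 2 = rho2 by rewrite sqr_sqrtr // sumr_ge0 // => i _; exact: sqr_ge0.
(* If c t = 1, then k (circ t) = o = k o, and injectivity gives circ t = o. *)
have period t : c t = 1 -> cos t = 1.
  move=> c1; have e : k (circ t) = o by apply: S7_qr1 => //; apply: kS; exact: circ_S7.
  have {e} : circ t = o by apply: kinj; [exact: circ_S7|exact: S7_o|rewrite e ko].
  move=> /(congr1 (fun x : H2 => qr (x 1 0))); rewrite /circ !mxsE mulr1 !qE qv.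
  by move=> <-; ring.
have r0 : 0 < rho.
  rewrite lt_def sqrtr_ge0 andbT; apply/eqP => r0.
  have /period : c pi = 1 by rewrite circ_cos_rho r0 mul0r cos0.
  by rewrite cospi => h; have : (-1 : R) < 1 by []; rewrite h ltxx.
have c2pi : c (pi * 2) = 1.
  have z : circ (pi * 2) = o.
    by rewrite /circ mulr_natr cos2pi sin2pi scale1r scale0r addr0.
  by rewrite /c z ko mxsE.
have [lt1|gt1|e1] := ltgtP rho 1; last by rewrite -rr e1 expr1n.
- have /eqP[] : cos (rho * (pi * 2)) != 1.
    by apply: cos_eq1; rewrite !mulr_gt0 ?pi_gt0 //= gtr_pMl // mulr_gt0 ?pi_gt0.
  by rewrite -circ_cos_rho.
- have /eqP[] : cos (pi * 2 / rho) != 1.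
    apply: cos_eq1; rewrite divr_gt0 ?mulr_gt0 ?pi_gt0 //= ltr_pdivrMr //.
    by rewrite ltr_pMr // mulr_gt0 ?pi_gt0.
  apply: period; rewrite circ_cos_rho mulrCA mulfV ?gt_eqF // mulr1.
  by rewrite mulr_natr cos2pi.
Qed.

Lemma circ_cos t : c t = cos t.
Proof. by rewrite circ_cos_rho /rho rho2_1 sqrtr1 mul1r. Qed.

End Circles.

(** * Equivariant diffeomorphisms act on metrics through SO(3) *)

Section Automorphisms.
Variable R : realType.
Local Notation H := (quat R).
Local Notation M2 := 'M[quat R]_2.
Local Notation H2 := 'cV[quat R]_2.
Local Notation o := (o7 R).
Local Notation pinvS := ('pinv_id (@S7 R)).

Lemma dS7_ext (k k' : H2 -> H2) v : (forall x, S7 x -> k x = k' x) -> T7 o v -> ip v v = 1 ->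
  dS7 k o v = dS7 k' o v.
Proof.
move=> e Tv v1; apply/matrixP => i j; rewrite !mxE.
have E s : k (Defs.arc o v s) = k' (Defs.arc o v s).
  by rewrite (arc_circ Tv v1); apply: e; exact: circ_S7.
by congr Quat; congr (derive1 _ 0); apply/funext => s; rewrite E.
Qed.

(** [push f] pulls back along [pinv_id], which agrees on the sphere with the smooth inverse k of f;
    beta is the inverse of alpha. *)
Lemma AutS7_inverse (f : H2 -> H2) : AutS7 f -> exists (k : H2 -> H2) (beta : M2 -> M2),
  [/\ smooth_map (@rcoord R 2 1) (@rcoord R 2 1) (@S7 R) k,
      (forall x, S7 x -> S7 (k x)),
      (forall x y, S7 x -> S7 y -> k x = k y -> x = y),
      (forall x, S7 x -> pinvS f x = k x) &
  [/\ forall A, Sp2 A -> Sp2 (beta A),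
      forall A B, Sp2 A -> Sp2 B -> beta (A *m B) = beta A *m beta B,
      forall A B, Sp2 A -> Sp2 B -> beta A = beta B -> A = B,
      forall h, Sp1 h -> Sp1 (beta h) &
      forall A, Sp2 A -> k (A *m o) = beta A *m o]].
Proof.
move=> [[k [fS kS [kf fk] _ sk]] [alpha [[beta [aS bS [ba ab] _ _]] aM aSp1 fa]] _].
have finj : {in S7 (R:=R) &, injective f}.
  by move=> x y /set_mem Sx /set_mem Sy e; rewrite -(kf x Sx) -(kf y Sy) e.
have fo A : Sp2 A -> S7 (A *m o) by move=> SA; apply: S7_Sp2 => //; exact: S7_o.
exists k, beta; split=> //.
- by move=> x y Sx Sy e; rewrite -(fk x Sx) -(fk y Sy) e.
- move=> x Sx; rewrite -{1}(fk x Sx); exact: (@pinvKV _ _ (id : H2 -> H2) _ f finj (k x) (mem_set (kS x Sx))).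
split=> //.
- move=> A B SA SB; have [SbA SbB] := (bS _ SA, bS _ SB).
  by rewrite -(ba _ (Sp2M SbA SbB)) aM // !ab.
- by move=> A B SA SB e; rewrite -(ab A SA) -(ab B SB) e.
- move=> h Sh; have [h' Sh' <-] : (alpha @` (@Sp1 R)) h by rewrite aSp1.
  by rewrite ba //; exact: Sp1_Sp2.
- move=> A SA; rewrite -(kf (beta A *m o)); last exact/fo/bS.
  by rewrite fa; [rewrite ab|exact: bS].
Qed.

Definition QI : H := Quat 0 1 0 0.
Definition QJ : H := Quat 0 0 1 0.
Definition QK : H := Quat 0 0 0 1.
Definition Qe (l : nat) : H := nth 0 [:: QI; QJ; QK] l.

Section InverseAut.
Variables (k : H2 -> H2) (beta : M2 -> M2).
Hypothesis sk : smooth_map (@rcoord R 2 1) (@rcoord R 2 1) (@S7 R) k.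
Hypothesis kS : forall x, S7 x -> S7 (k x).
Hypothesis kinj : forall x y, S7 x -> S7 y -> k x = k y -> x = y.
Hypothesis bS : forall A, Sp2 A -> Sp2 (beta A).
Hypothesis bM : forall A B, Sp2 A -> Sp2 B -> beta (A *m B) = beta A *m beta B.
Hypothesis binj : forall A B, Sp2 A -> Sp2 B -> beta A = beta B -> A = B.
Hypothesis bSp1 : forall h, Sp1 h -> Sp1 (beta h).
Hypothesis kb : forall A, Sp2 A -> k (A *m o) = beta A *m o.

Lemma beta1 : beta 1%:M = 1%:M.
Proof.
have [_ h] := bS (Sp2_1 R).
have := congr1 (mulmx (adjm (beta 1%:M))) (bM (Sp2_1 R) (Sp2_1 R)).
by rewrite mulmx1 mulmxA h mul1mx.
Qed.

Lemma k_o : k o = o.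
Proof. by have := kb (Sp2_1 R); rewrite beta1 mul1mx. Qed.

Definition sgn : M2 := mx2 (-1) 0 0 1.

Lemma sgn_Sp1 : Sp1 sgn.
Proof. by exists (-1) => //=; apply/unitqP; rewrite /qnorm2 !qE; ring. Qed.

Lemma sgn2 : sgn *m sgn = 1%:M.
Proof. by apply: mx2_ext; rewrite !mxsE ?mulrNN !(mul0r, mulr0, mulr1, addr0, add0r). Qed.

(* The only involution in Sp(1) is -1. *)
Lemma beta_sgn : beta sgn = sgn.
Proof.
have Ss := Sp1_Sp2 sgn_Sp1; have [h /= hh bs] := bSp1 sgn_Sp1.
have h2 : h * h = 1.
  have := bM Ss Ss; rewrite sgn2 beta1 -bs => /matrixP/(_ 0 0).
  by rewrite !mxsE mulr0 addr0.
have hr : h = qconj h by rewrite -[RHS]mul1r -h2 -mulrA hh mulr1.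
have [hi hj hk] : [/\ qi h = 0, qj h = 0 & qk h = 0].
  move: (congr1 (@qi R) hr) (congr1 (@qj R) hr) (congr1 (@qk R) hr).
  by rewrite !qE => ? ? ?; split; lra.
have hre : h = qre (qr h) by exact: qreal.
have : qr h ^+ 2 = 1.
  by have := congr1 (@qr R) h2; rewrite !qE hi hj hk => <-; ring.
move=> /eqP; rewrite sqrf_eq1 => /orP[] /eqP h1; rewrite h1 in hre; last first.
  by rewrite -bs hre /sgn (_ : qre (-1) = -1) //; apply: quat_ext; rewrite !qE ?oppr0.
have : beta sgn = beta 1%:M.
  by rewrite beta1 -bs hre qre1; apply: mx2_ext; rewrite !mxsE.
move=> /(binj Ss (Sp2_1 R)) /matrixP/(_ 0 0) /(congr1 (@qr R)); rewrite !mxsE !qE => e.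
have /eqP : (1 + 1 : R) = 0 by rewrite -{1}e addNr.
by rewrite -mulr2n pnatr_eq0.
Qed.

Definition rot1 (q : H) : M2 := mx2 1 0 0 q.

Lemma rot1_Sp2 q : qnorm2 q = 1 -> Sp2 (rot1 q).
Proof. by move=> q1; apply: Sp2_diag => //; rewrite /qnorm2 !qE; ring. Qed.

Lemma rot1M p q : rot1 p *m rot1 q = rot1 (p * q).
Proof. by apply: mx2_ext; rewrite !mxsE !(mul0r, mulr0, mulr1, addr0, add0r). Qed.

(** [rot1 q] commutes with [sgn], which beta fixes, and the matrices commuting with diag(-1, 1) are
    diagonal. *)
Lemma beta_rot1 q : qnorm2 q = 1 -> beta (rot1 q) 0 1 = 0 /\ beta (rot1 q) 1 0 = 0.
Proof.
move=> q1; have Sq := rot1_Sp2 q1; have Ss := Sp1_Sp2 sgn_Sp1.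
have comm : sgn *m rot1 q = rot1 q *m sgn.
  by apply: mx2_ext; rewrite !mxsE !(mul0r, mulr0, mulr1, mul1r, addr0, add0r).
have := congr1 beta comm; rewrite !bM // beta_sgn => e; move: (beta _) e => X e.
have z (x : H) : - x = x -> x = 0.
  move=> xx; apply: quat_ext; move: (congr1 (@qr R) xx) (congr1 (@qi R) xx)
    (congr1 (@qj R) xx) (congr1 (@qk R) xx); rewrite !qE; lra.
move: (congr1 (fun Y : M2 => Y 0 1) e) (congr1 (fun Y : M2 => Y 1 0) e).
rewrite !mxsE !(mul0r, mulr0, mulr1, mul1r, addr0, add0r) mulN1r mulrN1 => h h'.
by split; apply: z.
Qed.

(** As [beta (rot1 q)] is diagonal, TT is multiplicative on unit quaternions, and k sends (0, q) to
    (0, TT q). *)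
Definition TT (q : H) : H := beta (rot1 q) 1 1.

Lemma TTM p q : qnorm2 p = 1 -> qnorm2 q = 1 -> TT (p * q) = TT p * TT q.
Proof.
move=> p1 q1; rewrite /TT -rot1M bM; [|exact: rot1_Sp2|exact: rot1_Sp2].
by rewrite mulmx2E (beta_rot1 p1).2 mul0r add0r.
Qed.

Lemma rot1_o q : (rot1 q *m o) 0 0 = 0 /\ (rot1 q *m o) 1 0 = q.
Proof. by rewrite !mxsE !(mul0r, mulr0, mulr1, addr0, add0r). Qed.

Lemma k_rot1 q : qnorm2 q = 1 -> k (rot1 q *m o) 0 0 = 0 /\ k (rot1 q *m o) 1 0 = TT q.
Proof.
move=> q1; rewrite kb; last exact: rot1_Sp2.
have [b01 b10] := beta_rot1 q1.
by rewrite !mulmx2E b01 b10 !mxsE !(mul0r, mulr0, mulr1, addr0, add0r).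
Qed.

Lemma TT1 : TT 1 = 1.
Proof.
rewrite /TT (_ : rot1 1 = 1%:M) ?beta1 ?mxsE //.
by apply: mx2_ext; rewrite !mxsE.
Qed.

Lemma TT_unit q : qnorm2 q = 1 -> qnorm2 (TT q) = 1.
Proof.
move=> q1; have := kS (S7_Sp2 (rot1_Sp2 q1) (S7_o R)).
rewrite /S7 /= ipxx; have [-> ->] := k_rot1 q1.
by rewrite (_ : qnorm2 0 = 0) ?add0r // /qnorm2 !qE; ring.
Qed.

Definition vert (d : H) : H2 := \col_i (if i == 0 then 0 else d).

Lemma vert0 d : vert d 0 0 = 0. Proof. by rewrite mxE. Qed.
Lemma vert1 d : vert d 1 0 = d. Proof. by rewrite mxE. Qed.

Definition qcirc (d : H) (t : R) : H := qre (cos t) + qre (sin t) * d.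

Lemma qcirc_unit d t : qr d = 0 -> qnorm2 d = 1 -> qnorm2 (qcirc d t) = 1.
Proof.
move=> d0 d1; rewrite -(cos2Dsin2 t) -[X in _ = _ + X]mulr1 -[X in _ = _ + _ * X]d1.
by rewrite /qcirc /qnorm2 !qE d0; ring.
Qed.

Lemma vert_T7 d : qr d = 0 -> T7 o (vert d).
Proof. by move=> d0; apply/T7P; rewrite /cc vert0 vert1 !mxsE qconj0 qconj1 mul0r mul1r add0r. Qed.

Lemma vert_ip d : qnorm2 d = 1 -> ip (vert d) (vert d) = 1.
Proof.
by move=> d1; rewrite ipxx vert0 vert1 d1 (_ : qnorm2 0 = 0) ?add0r // /qnorm2 !qE; ring.
Qed.

Lemma circ_vert d t : circ (vert d) t = rot1 (qcirc d t) *m o.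
Proof.
have [r0 r1] := rot1_o (qcirc d t).
by apply: cv2_ext; rewrite ?r0 ?r1 /circ !mxsE ?vert0 ?vert1 ?mulr0 ?mulr1 ?addr0.
Qed.

Lemma qcircD d t : qr d = 0 -> qnorm2 d = 1 -> qcirc d (t * 2) = qcirc d t * qcirc d t.
Proof.
move=> d0 d1; have dd : d * d = -1.
  by have := qmulCr d; rewrite d1 (_ : qconj d = - d) ?mulrN => [/eqP|];
   [rewrite eqr_oppLR => /eqP ->; rewrite -qre1 | apply: quat_ext; rewrite !qE ?d0 ?oppr0].
rewrite /qcirc mulr_natr cos_mulr2n sin_mulr2n !mulrDl !mulrDr qreC.
rewrite (_ : qre (sin t) * d * (qre (sin t) * d) = - qre (sin t * sin t)); last first.
  rewrite mulrA -(mulrA (qre (sin t)) d) (qreC (sin t) d) mulrA -qreM -mulrA dd.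
  by rewrite mulrN mulr1.
rewrite (mulrA (qre (cos t)) (qre (sin t))) -!qreM -[sin t * sin t]expr2 sin2cos2.
by apply: quat_ext; rewrite !qE; ring.
Qed.

Lemma qr_sqr (x : H) : qnorm2 x = 1 -> qr (x * x) = 2 * qr x ^+ 2 - 1.
Proof. by move=> h; rewrite -[X in _ - X]h /qnorm2 !qE; ring. Qed.

(** TT is multiplicative, and a unit quaternion x satisfies Re(x^2) = 2 Re(x)^2 - 1. *)
Lemma TT_double d t : qr d = 0 -> qnorm2 d = 1 ->
  qr (k (circ (vert d) (t * 2)) 1 0) = 2 * qr (k (circ (vert d) t) 1 0) ^+ 2 - 1.
Proof.
move=> d0 d1; rewrite !circ_vert !(k_rot1 (qcirc_unit _ d0 d1)).2 qcircD //.
by rewrite TTM ?qcirc_unit // qr_sqr // TT_unit // qcirc_unit.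
Qed.

Lemma qr_TT_qcirc d t : qr d = 0 -> qnorm2 d = 1 -> qr (TT (qcirc d t)) = cos t.
Proof.
move=> d0 d1; rewrite -(k_rot1 (qcirc_unit t d0 d1)).2 -circ_vert.
apply: (circ_cos (vert_T7 d0) (vert_ip d1) sk kS k_o kinj) => u; exact: TT_double.
Qed.

Lemma qr_TT q : qnorm2 q = 1 -> qr (TT q) = qr q.
Proof.
move=> q1; pose n2 := qi q ^+ 2 + qj q ^+ 2 + qk q ^+ 2.
have n20 : 0 <= n2 by rewrite !addr_ge0 ?sqr_ge0.
have e2 : 1 - qr q ^+ 2 = n2 by rewrite -q1 /qnorm2 /n2; ring.
have qr1 : -1 <= qr q <= 1.
  rewrite -ler_norml -(@ler_pXn2r _ 2) ?nnegrE // expr1n -normrX ger0_norm ?sqr_ge0 //.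
  by rewrite -subr_ge0 e2.
have [d [d0 d1 qE']] : exists d, [/\ qr d = 0, qnorm2 d = 1 & q = qcirc d (acos (qr q))].
  rewrite /qcirc acosK ?in_itv //= sin_acos // e2.
  have [z|nz] := eqVneq n2 0.
    have [qi0 qj0 qk0] : [/\ qi q = 0, qj q = 0 & qk q = 0].
      have := sqr_ge0 (qi q); have := sqr_ge0 (qj q); have := sqr_ge0 (qk q).
      move: z; rewrite /n2 => z a b c.
      by split; apply/eqP; rewrite -sqrf_eq0; apply/eqP; lra.
    (* For real q the direction d is arbitrary. *)
    exists QI; split; rewrite // ?/qnorm2 /QI /=; first by ring.
    by rewrite z sqrtr0 mul0r addr0; exact: qreal.
  have s0 : Num.sqrt n2 != 0 by rewrite sqrtr_eq0 -ltNge lt_def nz.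
  have ss : Num.sqrt n2 ^+ 2 = n2 by rewrite sqr_sqrtr.
  exists (Quat 0 (qi q / Num.sqrt n2) (qj q / Num.sqrt n2) (qk q / Num.sqrt n2)); split=> //.
    by rewrite /qnorm2 /= !expr_div_n ss expr0n /= add0r -!mulrDl mulfV.
  by apply: quat_ext; rewrite !qE /=; field.
by rewrite {1}qE' qr_TT_qcirc // acosK ?in_itv.
Qed.

Lemma TT_conj q : qnorm2 q = 1 -> TT (qconj q) = qconj (TT q).
Proof.
move=> q1; have q1' : qnorm2 (qconj q) = 1 by rewrite qnorm2C.
rewrite -[LHS]mulr1 -qre1 -(TT_unit q1) -qmulCr mulrA -TTM // qmulCl q1 qre1 TT1.
by rewrite mul1r.
Qed.

(** A multiplicative map that commutes with conjugation and preserves real parts preserves the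
    Euclidean inner product. *)
Lemma TT_ip p q : qnorm2 p = 1 -> qnorm2 q = 1 -> qr (qconj (TT p) * TT q) = qr (qconj p * q).
Proof.
move=> p1 q1; rewrite -TT_conj // -TTM ?qnorm2C // qr_TT //.
by rewrite qnorm2M qnorm2C p1 q1 mulr1.
Qed.

(** The squared distance between the two sides involves only norms and inner products with 1 and TT
    d, which TT preserves; they make it 0. *)
Lemma TT_qcirc d t : qr d = 0 -> qnorm2 d = 1 ->
  TT (qcirc d t) = qre (cos t) + qre (sin t) * TT d.
Proof.
move=> d0 d1; have q1 := qcirc_unit t d0 d1.
have x1 := TT_unit q1; have z1 := TT_unit d1.
have xr := qr_TT_qcirc t d0 d1; have zr := qr_TT d1.
have xz := TT_ip d1 q1.
have dq : qr (qconj d * qcirc d t) = sin t.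
  rewrite -[RHS]mulr1 -[X in _ = _ * X]d1.
  by rewrite /qcirc /qnorm2 !qE d0; ring.
rewrite dq in xz; rewrite d0 in zr.
move: (TT (qcirc d t)) (TT d) x1 z1 xr zr xz => x z x1 z1 xr zr xz.
apply/eqP; rewrite -subr_eq0 -qnorm2_eq0; apply/eqP.
have cs := cos2Dsin2 t.
have -> : qnorm2 (x - (qre (cos t) + qre (sin t) * z)) =
    qnorm2 x - 2 * (cos t * qr x + sin t * qr (qconj z * x)) + cos t ^+ 2 + sin t ^+ 2 * qnorm2 z
    + 2 * cos t * sin t * qr z.
  by rewrite /qnorm2 !qE; ring.
rewrite x1 z1 xr zr xz -[RHS](subrr 1) -[X in _ = _ - X]cs; ring.
Qed.

Lemma derive_lin_circ (a b : R) : 'D_1 (fun t => cos t * a + sin t * b) 0 = b.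
Proof.
have dm (h : R -> R) x : derivable h 0 1 ->
    derivable (fun t => h t * x) 0 1 /\ 'D_1 (fun t => h t * x) 0 = 'D_1 h 0 * x.
  move=> dh; split; first exact: (@derivableM _ _ h (cst x) 0 1 dh (derivable_cst _ _ _)).
  by rewrite deriveMr // mulrC.
have [d1 e1] := dm _ a (@derivable_cos R 0); have [d2 e2] := dm _ b (@derivable_sin R 0).
by rewrite deriveD // e1 e2 !derive_val sin0 cos0 oppr0 mul0r mul1r add0r.
Qed.

Lemma cmp_ext (x y : H2) : (forall m, cmp m x = cmp m y) -> x = y.
Proof.
move=> e; apply: cv2_ext; apply: quat_ext.
- exact: (e 0%N).
- exact: (e 1%N).
- exact: (e 2%N).
- exact: (e 3%N).
- exact: (e 4%N).
- exact: (e 5%N).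
- exact: (e 6%N).
- exact: (e 7%N).
Qed.

Lemma cmp_lin m (c s : R) (x y : H2) :
  cmp m (qre c *: x + qre s *: y) = c * cmp m x + s * cmp m y.
Proof.
by case: m => [|[|[|[|[|[|[|[|m]]]]]]]]; rewrite /cmp /= ?nth_nil ?mxsE ?qE; ring.
Qed.

Lemma dk_vert d : qr d = 0 -> qnorm2 d = 1 -> dS7 k o (vert d) = vert (TT d).
Proof.
move=> d0 d1; apply: cmp_ext => m.
rewrite -(derive_circ (vert_T7 d0) (vert_ip d1) sk).
rewrite (_ : (fun t => _) = fun t => cos t * cmp m o + sin t * cmp m (vert (TT d))).
  exact: derive_lin_circ.
apply/funext => t; rewrite -cmp_lin; congr (cmp m _).
have [k0 k1] := k_rot1 (qcirc_unit t d0 d1).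
apply: cv2_ext; rewrite circ_vert ?k0 ?k1 !mxsE ?vert0 ?vert1 ?mulr0 ?addr0 //.
by rewrite mulr1 TT_qcirc.
Qed.

Definition horiz : H2 := \col_i (if i == 0 then 1 else 0).

Lemma horiz0 : horiz 0 0 = 1. Proof. by rewrite mxE. Qed.
Lemma horiz1 : horiz 1 0 = 0. Proof. by rewrite mxE. Qed.

Lemma horiz_T7 : T7 o horiz.
Proof. by apply/T7P; rewrite /cc horiz0 horiz1 !mxsE qconj0 qconj1 mul0r mulr0 add0r. Qed.

Lemma horiz_ip : ip horiz horiz = 1.
Proof. by rewrite ipxx horiz0 horiz1 /qnorm2 !qE; ring. Qed.

Definition rot2 (t : R) : M2 := mx2 (qre (cos t)) (qre (sin t)) (- qre (sin t)) (qre (cos t)).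

Lemma rot2_Sp2 t : Sp2 (rot2 t).
Proof.
by split; apply: mx2_ext; rewrite !mxsE ?qconjN ?qconjQ -1?(cos2Dsin2 t) ?qre1;
  apply: quat_ext; rewrite !qE -?(cos2Dsin2 t); ring.
Qed.

Lemma rot2D t : rot2 (t * 2) = rot2 t *m rot2 t.
Proof.
apply: mx2_ext; rewrite !mxsE mulr_natr ?cos_mulr2n ?sin_mulr2n -?(cos2Dsin2 t);
  by apply: quat_ext; rewrite !qE; ring.
Qed.

Lemma circ_horiz t : circ horiz t = rot2 t *m o.
Proof. by apply: cv2_ext; rewrite /circ !mxsE ?horiz0 ?horiz1 !(mulr0, mulr1, addr0, add0r). Qed.

(* Conjugation by [sgn] inverts [rot2 t], hence also its image under [beta]. *)
Lemma beta_rot2 t : let b := beta (rot2 t) in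
  [/\ b 1 1 = qre (qr (b 1 1)), b 1 0 = - qconj (b 0 1) &
      qnorm2 (b 0 1) + qr (b 1 1) ^+ 2 = 1].
Proof.
move=> b; have Sr := rot2_Sp2 t; have [b1 b2] := bS Sr; have Ss := Sp1_Sp2 sgn_Sp1.
have srs : sgn *m rot2 t *m (sgn *m rot2 t) = 1%:M.
  rewrite mulmxA (_ : sgn *m rot2 t *m sgn = adjm (rot2 t)) ?Sr.2 //.
  by apply: mx2_ext; rewrite !mxsE ?qconjN ?qconjQ;
    rewrite !(mul0r, mulr0, mul1r, mulr1, addr0, add0r, mulN1r, mulrN1, opprK).
have Ssr := Sp2M Ss Sr.
have sbsb : sgn *m b *m sgn *m b = 1%:M.
  by have := congr1 beta srs; rewrite (bM Ssr Ssr) (bM Ss Sr) beta_sgn beta1 !mulmxA.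
have ab : adjm b = sgn *m b *m sgn.
  by rewrite -[LHS]mul1mx -sbsb -mulmxA b1 mulmx1.
have e11 := congr1 (fun Y : M2 => Y 1 1) ab; have e10 := congr1 (fun Y : M2 => Y 1 0) ab.
have n11 := congr1 (fun Y : M2 => Y 1 1) b2.
rewrite !mxsE !(mul0r, mulr0, mul1r, mulr1, addr0, add0r) in e11 e10 n11.
have r11 : b 1 1 = qre (qr (b 1 1)).
  apply: qreal; [have := congr1 (@qi R) e11|have := congr1 (@qj R) e11|have := congr1 (@qk R) e11];
    rewrite !qE; lra.
split=> //; first by rewrite e10 mulrN1 opprK.
have := congr1 (@qr R) n11; rewrite !qmulCl !qE => <-; congr (_ + _).
by rewrite r11 /qnorm2 !qE; ring.
Qed.

(** With b = beta (rot2 t), the lower right entry of b^2 is b_11^2 - |b_01|^2, and |b_01|^2 = 1 -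
    b_11^2. *)
Lemma rot2_double t :
  qr (k (circ horiz (t * 2)) 1 0) = 2 * qr (k (circ horiz t) 1 0) ^+ 2 - 1.
Proof.
have Sr := rot2_Sp2 t; rewrite !circ_horiz (kb (rot2_Sp2 (t * 2))) (kb Sr) rot2D (bM Sr Sr).
have [b11 b10 bn] := beta_rot2 t.
rewrite !(mulmx2E _ o) !mxsE !mulr0 !mulr1 !add0r.
rewrite b10 mulNr qmulCl (_ : qnorm2 _ = 1 - qr (beta (rot2 t) 1 1) ^+ 2); last first.
  by rewrite -bn addrK.
have [y ->] : exists y, beta (rot2 t) 1 1 = qre y by eexists; exact: b11.
by rewrite !qE; ring.
Qed.

(** Along the horizontal circle the second component of k is exactly cos t, with derivative 0 at t =
    0; the unit speed is then carried by the first component. *)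
Lemma dk_horiz : dS7 k o horiz 1 0 = 0 /\ qnorm2 (dS7 k o horiz 0 0) = 1.
Proof.
have cE := circ_cos horiz_T7 horiz_ip sk kS k_o kinj rot2_double.
have r2 := rho2_1 horiz_T7 horiz_ip sk kS k_o kinj rot2_double.
have b11 t : k (circ horiz t) 1 0 = qre (cos t).
  have [e _ _] := beta_rot2 t; rewrite -cE circ_horiz kb; last exact: rot2_Sp2.
  by rewrite !mulmx2E !mxsE !mulr0 !mulr1 !add0r -e.
have w1 : dS7 k o horiz 1 0 = 0.
  have dc (m : nat) (a : R) : (forall t, cmp m (k (circ horiz t)) = cos t * a + sin t * 0) ->
      cmp m (dS7 k o horiz) = 0.
    move=> h; rewrite -(derive_circ horiz_T7 horiz_ip sk).
    by rewrite (_ : (fun t => _) = fun t => cos t * a + sin t * 0) ?derive_lin_circ //; exact/funext.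
  apply: quat_ext.
  - by apply: (dc 4%N 1) => t; rewrite /cmp /= b11 !qE; ring.
  - by apply: (dc 5%N 0) => t; rewrite /cmp /= b11 !qE; ring.
  - by apply: (dc 6%N 0) => t; rewrite /cmp /= b11 !qE; ring.
  - by apply: (dc 7%N 0) => t; rewrite /cmp /= b11 !qE; ring.
split=> //; rewrite -r2 (sum_cmp (fun m => cmp m (dS7 k o horiz) ^+ 2)) /cmp /= w1 !qE /qnorm2.
ring.
Qed.

Definition Qmx : 'M[R]_3 := \matrix_(i, l) imq l (TT (Qe i)).

Lemma Qe_unit l : (l < 3)%N -> qr (Qe l) = 0 /\ qnorm2 (Qe l) = 1.
Proof. by case: l => [|[|[|l]]] // _; rewrite /Qe /qnorm2 /=; split=> //; ring. Qed.

(** Orthonormality of the rows is [TT_ip]. The determinant is the triple product of TT i, TT j, TT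
    k, which is |TT i|^2 because TT j TT k = TT i. *)
Lemma Qmx_SO3 : SO3 Qmx.
Proof.
have U l : (l < 3)%N -> qr (TT (Qe l)) = 0.
  by move=> /Qe_unit[a b]; rewrite qr_TT.
have ipT i j : (i < 3)%N -> (j < 3)%N ->
    imq 0 (TT (Qe i)) * imq 0 (TT (Qe j)) + imq 1 (TT (Qe i)) * imq 1 (TT (Qe j)) +
    imq 2 (TT (Qe i)) * imq 2 (TT (Qe j)) = qr (qconj (Qe i) * Qe j).
  move=> i3 j3; rewrite -(TT_ip (Qe_unit i3).2 (Qe_unit j3).2) !qE (U i) // (U j) //=; ring.
have QQ : Qmx *m Qmx^T = 1%:M.
  apply/matrixP => i j; rewrite !mxE sum3E !mxE ipT //.
  by case: (ord3P i) => ->; case: (ord3P j) => ->; rewrite /Qe !qE /=; ring.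
split=> //; rewrite det3E.
have JK : TT QI = TT QJ * TT QK.
  rewrite -TTM; try by rewrite /qnorm2 /=; ring.
  by congr TT; apply: quat_ext; rewrite !qE /=; ring.
have n1 : qr (qconj (TT QI) * TT QI) = 1.
  by rewrite qmulCl TT_unit // /qnorm2 /=; ring.
rewrite {2}JK in n1; rewrite -[RHS]n1 /det3 !mxE /Qe /= ?qE.
have uI := U 0%N isT; have uJ := U 1%N isT; have uK := U 2%N isT.
rewrite /Qe /= in uI uJ uK; rewrite uI uJ uK; ring.
Qed.

(** Both sides are compared at o: vertical vectors see only P, while [horiz] and its image, whose
    second component is 0, see only lam. *)
Lemma ev_push_basis (f : H2 -> H2) P lam P' lam' :
  (forall x, S7 x -> pinvS f x = k x) -> push f (Field2 P lam) = Field2 P' lam' ->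
  P' = Qmx *m P *m Qmx^T /\ lam' = lam.
Proof.
move=> fk pE.
have pushE u : T7 o u -> ip u u = 1 -> T7 o (dS7 k o u) -> forall w, T7 o w -> ip w w = 1 ->
   T7 o (dS7 k o w) ->
  f2 P' lam' (eX o) (nX o) u w = f2 P lam (eX o) (nX o) (dS7 k o u) (dS7 k o w).
  move=> Tu u1 Tku w Tw w1 Tkw; pose v (i : 'I_2) := if i == ord0 then u else w.
  have := congr1 (fun t => t o v) pE.
  rewrite /push /pullback /Field2 !restrT; last first.
  - by move=> i; split; [exact: S7_o|rewrite /v; case: eqP].
  - rewrite fk ?k_o; last exact: S7_o.
    move=> i; split; first exact: S7_o.
    by rewrite /v; case: eqP => _; rewrite (dS7_ext fk).
  - by move=> i; split; [exact: S7_o|rewrite /v; case: eqP].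
  rewrite /v /= !(dS7_ext fk) // fk ?k_o //; exact: S7_o.
have ccv d : cc o (vert d) = d by rewrite /cc vert0 vert1 !mxsE qconj0 qconj1 mul0r mul1r add0r.
have kkv d d' : kk o (vert d) (vert d') = 0.
  by rewrite /kk !ccv /cc !vert0 !vert1 qconj0 mul0r add0r subrr.
have f2v Z l d d' : f2 Z l (eX o) (nX o) (vert d) (vert d') =
    \sum_(i < 3) \sum_(j < 3) Z i j * imq i d * imq j d'.
  rewrite /f2 /nX kkv !qE !mulr0 addr0; apply: eq_bigr => i _; apply: eq_bigr => j _.
  by rewrite /eX !ccv.
split.
- apply/matrixP => i j.
  have [i0 i1] := Qe_unit (ltn_ord i); have [j0' j1'] := Qe_unit (ltn_ord j).
  have [TTi TTj] : qr (TT (Qe i)) = 0 /\ qr (TT (Qe j)) = 0 by rewrite !qr_TT.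
  have := pushE (vert (Qe i)) (vert_T7 i0) (vert_ip i1).
  rewrite (dk_vert i0 i1) => /(_ (vert_T7 TTi) (vert (Qe j)) (vert_T7 j0') (vert_ip j1')).
  rewrite (dk_vert j0' j1') => /(_ (vert_T7 TTj)); rewrite !f2v => e.
  transitivity (\sum_(a < 3) \sum_(b < 3) P' a b * imq a (Qe i) * imq b (Qe j)).
    by rewrite !sum3E; case: (ord3P i) => ->; case: (ord3P j) => ->; rewrite /Qe /=; ring.
  by rewrite e !mxE !sum3E !mxE !sum3E !mxE; ring.
- have [w1 w0] := dk_horiz.
  have Tw : T7 o (dS7 k o horiz).
    by apply/T7P; rewrite /cc w1 !mxsE qconj0 mul0r mulr0 addr0.
  have f2h Z l (u : H2) : u 1 0 = 0 -> f2 Z l (eX o) (nX o) u u = l * (2 * qnorm2 (u 0 0)).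
    move=> u1; have c0 : cc o u = 0 by rewrite /cc u1 !mxsE qconj0 mul0r mulr0 addr0.
    rewrite f2_diag /nX /kk c0 mulr0 subr0 /cc u1 mulr0 addr0 qmulCl !qE /qf.
    rewrite big1 ?add0r // => i _; rewrite big1 // => j _.
    by rewrite /eX c0 (_ : imq i 0 = 0) ?mulr0 ?mul0r //; case: (ord3P i) => ->.
  have := pushE _ horiz_T7 horiz_ip Tw _ horiz_T7 horiz_ip Tw.
  rewrite !f2h ?horiz1 // w0 horiz0 (_ : qnorm2 1 = 1); last by rewrite /qnorm2 !qE; ring.
  by move=> /mulIf -> //; rewrite mulr1 pnatr_eq0.
Qed.

End InverseAut.

Lemma Aut_push (f : H2 -> H2) P lam : AutS7 f -> PD P -> 0 < lam ->
  exists2 Q, SO3 Q & push f (Field2 P lam) = Field2 (Q *m P *m Q^T) lam.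
Proof.
move=> Af PP l0; have [k [beta [sk kS kinj fk [bS bM binj bSp1 kb]]]] := AutS7_inverse Af.
case: Af => _ _ /(_ _ (Field2_Sym2p PP l0)) /Sym2p_invP[P' [lam' [_ _ pE]]].
exists (Qmx beta); first exact: (Qmx_SO3 sk kS kinj bS bM binj bSp1 kb).
have [eP el] := ev_push_basis sk kS kinj bS bM binj bSp1 kb fk pE.
by rewrite pE eP el.
Qed.

End Automorphisms.

(** * Every rotation is conjugation by a unit quaternion *)

Section Rotations.
Variable R : realType.
Local Notation H := (quat R).

Section UnitQuaternion.
Variables TI TJ TK : H.
Hypothesis iI : qr TI = 0.
Hypothesis iJ : qr TJ = 0.
Hypothesis iK : qr TK = 0.
Hypothesis nI : qnorm2 TI = 1.
Hypothesis nJ : qnorm2 TJ = 1.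
Hypothesis nK : qnorm2 TK = 1.
Hypothesis IJ : TI * TJ = TK.
Hypothesis JK : TJ * TK = TI.
Hypothesis KI : TK * TI = TJ.

Lemma imag_conj (d : H) : qr d = 0 -> qconj d = - d.
Proof. by move=> d0; apply: quat_ext; rewrite !qE ?d0 ?oppr0. Qed.

Lemma imag_sqr (d : H) : qr d = 0 -> qnorm2 d = 1 -> d * d = -1.
Proof.
move=> d0 d1; have := qmulCr d; rewrite d1 imag_conj // mulrN qre1 => e.
by rewrite -e opprK.
Qed.

Lemma imag_anti (a b c : H) : qr a = 0 -> qr b = 0 -> qr c = 0 -> a * b = c -> b * a = - c.
Proof.
by move=> a0 b0 c0 /(congr1 (@qconj R)); rewrite qconjM !imag_conj // mulrNN.
Qed.

(* [r - I r TI - J r TJ - K r TK] intertwines e and Te for e = I, J, K. *)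
Definition twine (r : H) : H := r - QI R * r * TI - QJ R * r * TJ - QK R * r * TK.

Lemma quat_units : [/\ QI R * QI R = -1, QJ R * QJ R = -1 & QK R * QK R = -1] /\
  [/\ QI R * QJ R = QK R, QJ R * QK R = QI R & QK R * QI R = QJ R] /\
  [/\ QJ R * QI R = - QK R, QK R * QJ R = - QI R & QI R * QK R = - QJ R].
Proof. by do !split; apply: quat_ext; rewrite !qE /=; ring. Qed.

Lemma twineP r : [/\ QI R * twine r = twine r * TI, QJ R * twine r = twine r * TJ &
  QK R * twine r = twine r * TK].
Proof.
have [[II JJ KK] [[ij jk ki] [ji kj ik]]] := quat_units.
have JI := imag_anti iI iJ iK IJ; have KJ := imag_anti iJ iK iI JK.
have IK := imag_anti iK iI iJ KI.
have tII := imag_sqr iI nI; have tJJ := imag_sqr iJ nJ; have tKK := imag_sqr iK nK.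
have lin (a b c d a' b' c' d' : H) : a = a' -> b = b' -> c = c' -> d = d' ->
  a - b - c - d = a' - b' - c' - d' by move=> -> -> -> ->.
split; rewrite /twine !mulrBr !mulrBl !mulrA -?(mulrA _ TI) -?(mulrA _ TJ) -?(mulrA _ TK)
  ?tII ?tJJ ?tKK ?IJ ?JK ?KI ?JI ?KJ ?IK ?II ?JJ ?KK ?ij ?jk ?ki ?ji ?kj ?ik
  ?mulrN1 ?mulN1r ?mulNr ?mulrN;
  move: (QI R * r) (QJ R * r) (QK R * r) => x y z;
  move: (x * TI) (x * TJ) (x * TK) (y * TI) (y * TJ) (y * TK) (z * TI) (z * TJ) (z * TK);
  move: (r * TI) (r * TJ) (r * TK) => *; apply: quat_ext; rewrite !qE; ring.
Qed.

(** Over the orthonormal basis 1, i, j, k the real linear map [twine] has trace 4, so some value is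
    nonzero; a real multiple of it has norm 1. *)
Lemma unit_intertwiner : exists2 q : H, qnorm2 q = 1 &
  [/\ QI R * q = q * TI, QJ R * q = q * TJ & QK R * q = q * TK].
Proof.
have [r r0] : exists r, twine r != 0.
  apply: contrapT => no; have z r : twine r = 0.
    by apply/eqP; apply: contrapT => /negP h; apply: no; exists r.
  have : qr (twine 1) + qr (qconj (QI R) * twine (QI R)) + qr (qconj (QJ R) * twine (QJ R)) +
      qr (qconj (QK R) * twine (QK R)) = 4.
    by rewrite /twine !qE /= iI iJ iK; ring.
  rewrite !z !mulr0 !qE !addr0 => /eqP; by rewrite eq_sym pnatr_eq0.
have n1 : 0 < qnorm2 (twine r) by rewrite lt_def qnorm2_eq0 r0 qnorm2_ge0.
pose n := Num.sqrt (qnorm2 (twine r)); have n0 : n != 0 by rewrite gt_eqF // sqrtr_gt0.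
have nn : n * n = qnorm2 (twine r) by rewrite -expr2 sqr_sqrtr // ltW.
have [a b c] := twineP r.
exists (qre n^-1 * twine r).
  rewrite qnorm2M -nn (_ : qnorm2 (qre n^-1) = n^-1 ^+ 2); first by field.
  by rewrite /qnorm2 !qE; ring.
by split; rewrite mulrA qreC -mulrA ?a ?b ?c mulrA.
Qed.

End UnitQuaternion.

Definition Qrow (Q : 'M[R]_3) (l : 'I_3) : H := Quat 0 (Q l j0) (Q l j1) (Q l j2).

(** Two unit quaternions with inner product 1 are at distance 0. *)
Lemma unit_triple (a b c : H) : qr c = 0 -> qnorm2 a = 1 -> qnorm2 b = 1 -> qnorm2 c = 1 ->
  qr (qconj (a * b) * c) = 1 -> a * b = c.
Proof.
move=> c0 a1 b1 c1 d; apply/eqP; rewrite -subr_eq0 -qnorm2_eq0; apply/eqP.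
have -> : qnorm2 (a * b - c) = qnorm2 (a * b) + qnorm2 c - 2 * qr (qconj (a * b) * c).
  by move: (a * b) => x; rewrite /qnorm2 !qE; ring.
by rewrite qnorm2M a1 b1 c1 d; ring.
Qed.

(** The determinant is the inner product of the quaternion product of two rows with the third row,
    so the rows of Q multiply like i, j, k. *)
Lemma SO3_quaternion (Q : 'M[R]_3) : SO3 Q -> exists2 q : H, qnorm2 q = 1 &
  forall l : 'I_3, Qe R l * q = q * Qrow Q l.
Proof.
move=> [QQ]; rewrite det3E => d1.
have n l : qnorm2 (Qrow Q l) = 1.
  have := congr1 (fun X : 'M[R]_3 => X l l) QQ; rewrite !mxE sum3E !mxE eqxx mulr1n => <-.
  by rewrite /qnorm2 /=; ring.
have [|||||||||q q1 [a b c]] := @unit_intertwiner (Qrow Q j0) (Qrow Q j1) (Qrow Q j2) => //.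
- apply: unit_triple => //; rewrite -[RHS]d1 /det3 !qE /=; ring.
- apply: unit_triple => //; rewrite -[RHS]d1 /det3 !qE /=; ring.
- apply: unit_triple => //; rewrite -[RHS]d1 /det3 !qE /=; ring.
by exists q => // l; case: (ord3P l) => ->.
Qed.

Lemma SO3_conj (Q : 'M[R]_3) : SO3 Q -> exists2 q : H, qnorm2 q = 1 &
  forall (p : H) (k : 'I_3), imq k (qconj q * p * q) = \sum_(l < 3) imq l p * Q l k.
Proof.
move=> /SO3_quaternion[q q1 h]; exists q => // p k.
have e (l : 'I_3) : qconj q * Qe R l * q = Qrow Q l.
  by rewrite -mulrA h mulrA qmulCl q1 qre1 mul1r.
have -> : qconj q * p * q = qre (qr p) + (qre (qi p) * Qrow Q j0 + qre (qj p) * Qrow Q j1 +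
    qre (qk p) * Qrow Q j2).
  rewrite -!e {1}(_ : p = qre (qr p) + (qre (qi p) * Qe R j0 + qre (qj p) * Qe R j1 +
      qre (qk p) * Qe R j2)); last by apply: quat_ext; rewrite /Qe !qE /=; ring.
  rewrite !mulrDr !mulrDl; congr (_ + (_ + _ + _)).
  - by rewrite qreC -mulrA qmulCl q1 qre1 mulr1.
  - by rewrite !mulrA qreC.
  - by rewrite !mulrA qreC.
  - by rewrite !mulrA qreC.
by rewrite sum3E; case: (ord3P k) => ->; rewrite /= ; ring.
Qed.

End Rotations.

(** * The automorphism attached to a unit quaternion *)

Section RotationAut.
Variable R : realType.
Local Notation H := (quat R).
Local Notation M2 := 'M[quat R]_2.
Local Notation H2 := 'cV[quat R]_2.
Local Notation o := (o7 R).
Local Notation pinvS := ('pinv_id (@S7 R)).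

(** With s = |v| the first factor is the normalization 1 / |x + t v| of [arc]; it has value 1 and
    derivative 0 at t = 0. *)
Lemma derive_arc_factor (s a b : R) :
  derive1 (fun t => cos (atan (s * t)) * (a + t * b)) 0 = b.
Proof.
have [d1 e1] := @derive_dilation R (@atan R) s (@derivable_atan R 0).
have dc : derivable (@cos R) (atan (s * 0)) 1 by exact: derivable_cos.
have e2 := @derive1_comp R (fun t => atan (s * t)) (@cos R) 0 d1 dc.
have d2 : derivable (fun t => cos (atan (s * t))) 0 1.
  apply/derivable1_diffP; apply: (@differentiable_comp _ _ _ _ (fun t => atan (s * t)) (@cos R));
  exact/derivable1_diffP.
have h : is_derive (0 : R) (1 : R) (cst a + (b \*: (@id R))) (0 + b *: (1 : R)).
  by apply: is_deriveD; exact: is_deriveZ.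
have gE : (fun t : R => a + t * b) = cst a + (b \*: (@id R)).
  by apply/funext => t /=; rewrite mulrC.
have [d3 e3] : derivable (fun t : R => a + t * b) 0 1 /\ 'D_1 (fun t : R => a + t * b) 0 = b.
  by rewrite gE; case: h => d ->; split=> //; rewrite add0r [_ *: _]mulr1.
rewrite derive1E (@deriveM _ _ (fun t => cos (atan (s * t))) (fun t => a + t * b) 0 1 d2 d3) e3.
move: e2; rewrite derive1E => ->; rewrite mulr0 atan0 cos0 mul0r addr0 derive1E.
by rewrite (@derive_val _ _ _ _ _ _ _ (is_derive_cos 0)) sin0 oppr0 mul0r scaler0 addr0 scale1r.
Qed.

Lemma ip_line (x v : H2) t : S7 x -> T7 x v ->
  ip (x + qre t *: v) (x + qre t *: v) = 1 + t ^+ 2 * ip v v.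
Proof.
move=> xx /T7P xv; move: xx; rewrite /S7 /= !ipxx !mxsE => xx; rewrite -[X in _ = X + _]xx.
have -> : qnorm2 (x 0 0 + qre t * v 0 0) + qnorm2 (x 1 0 + qre t * v 1 0) =
  qnorm2 (x 0 0) + qnorm2 (x 1 0) + t ^+ 2 * (qnorm2 (v 0 0) + qnorm2 (v 1 0)) +
  2 * t * qr (cc x v).
  by rewrite /cc; move: (x 0 0) (x 1 0) (v 0 0) (v 1 0) => *; rewrite /qnorm2 !qE; ring.
by rewrite xv mulr0 addr0.
Qed.

Lemma ip_ge0 (v : H2) : 0 <= ip v v.
Proof. by rewrite ipxx addr_ge0 ?qnorm2_ge0. Qed.

Lemma arc_S7 (x v : H2) t : S7 x -> T7 x v -> S7 (Defs.arc x v t).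
Proof.
move=> Sx Tv; have cD := ip_line t Sx Tv.
have ipZ (c : R) (y : H2) : ip (qre c *: y) (qre c *: y) = c ^+ 2 * ip y y.
  by rewrite !ipxx !mxsE /qnorm2 !qE; ring.
have p : 0 < 1 + t ^+ 2 * ip v v by rewrite ltr_wpDr // mulr_ge0 ?sqr_ge0 ?ip_ge0.
by rewrite /S7 /= /Defs.arc cD ipZ cD exprVn sqr_sqrtr ?(ltW p) // mulVf // gt_eqF.
Qed.

Lemma arc_formula (x v : H2) t : S7 x -> T7 x v ->
  Defs.arc x v t = qre (cos (atan (Num.sqrt (ip v v) * t))) *: (x + qre t *: v).
Proof.
move=> Sx Tv; rewrite /Defs.arc ip_line // cos_atan exprMn sqr_sqrtr ?ip_ge0 //.
by rewrite [ip v v * _]mulrC.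
Qed.

Lemma dS7_lin (L k : H2 -> H2) (x v : H2) : S7 x -> T7 x v -> (forall y, S7 y -> k y = L y) ->
  (forall (c : R) (y y' : H2), L (qre c *: (y + y')) = qre c *: (L y + L y')) ->
  (forall (c : R) (y : H2), L (qre c *: y) = qre c *: L y) ->
  dS7 k x v = L v.
Proof.
move=> Sx Tv kL LD LZ.
have E t : k (Defs.arc x v t) = qre (cos (atan (Num.sqrt (ip v v) * t))) *: (L x + qre t *: L v).
  by rewrite kL; [rewrite arc_formula // LD LZ|exact: arc_S7].
have D (g : H -> R) : (forall (c : R) p q, g (qre c * (p + q)) = c * (g p + g q)) ->
    (forall (c : R) p, g (qre c * p) = c * g p) -> forall i j,
    derive1 (fun t => g (k (Defs.arc x v t) i j)) 0 = g (L v i j).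
  move=> gD gZ i j; rewrite -[RHS](derive_arc_factor (Num.sqrt (ip v v)) (g (L x i j)) (g (L v i j))).
  by congr (derive1 _ 0); apply/funext => t; rewrite E !mxsE gD gZ.
apply/matrixP => i j; rewrite mxE ord1.
by apply: quat_ext; rewrite /= D // => *; rewrite !qE; ring.
Qed.

Variables (q : H) (Q : 'M[R]_3).
Hypothesis q1 : qnorm2 q = 1.
Hypothesis SQ : SO3 Q.
Hypothesis qQ : forall (p : H) (k : 'I_3), imq k (qconj q * p * q) = \sum_(l < 3) imq l p * Q l k.

Definition rq (p : H) (x : H2) : H2 := \col_i ((rot1 p *m x) i 0 * qconj p).

Lemma rq0 p x : rq p x 0 0 = x 0 0 * qconj p.
Proof. by rewrite mxE !mxsE mul1r mul0r addr0. Qed.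
Lemma rq1 p x : rq p x 1 0 = p * x 1 0 * qconj p.
Proof. by rewrite mxE !mxsE mul0r add0r. Qed.

Lemma rqK p x : qnorm2 p = 1 -> rq (qconj p) (rq p x) = x.
Proof.
move=> p1; apply: cv2_ext; rewrite ?rq0 ?rq1 !qconjK.
  by rewrite -mulrA qmulCl p1 qre1 mulr1.
by rewrite !mulrA qmulCl p1 qre1 mul1r -mulrA qmulCl p1 qre1 mulr1.
Qed.

Lemma cc_rq p x v : qnorm2 p = 1 -> cc (rq p x) (rq p v) = p * cc x v * qconj p.
Proof.
move=> p1; rewrite /cc !rq0 !rq1 !qconjM !qconjK !mulrA mulrDr mulrDl !mulrA; congr (_ + _).
by rewrite -(mulrA _ (qconj p) p) qmulCl p1 qre1 mulr1.
Qed.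

Lemma rq_S7 p x : qnorm2 p = 1 -> S7 x -> S7 (rq p x).
Proof. by move=> p1 /S7P Sx; apply/S7P; rewrite cc_rq // Sx mulr1 qmulCr p1. Qed.

Lemma qr_conj (p d : H) : qnorm2 p = 1 -> qr (p * d * qconj p) = qr d.
Proof.
move=> p1; have -> : qr (p * d * qconj p) = qnorm2 p * qr d.
  by rewrite /qnorm2 !qE; ring.
by rewrite p1 mul1r.
Qed.

Lemma rq_T7 p x v : qnorm2 p = 1 -> T7 x v -> T7 (rq p x) (rq p v).
Proof. by move=> p1 /T7P Tv; apply/T7P; rewrite cc_rq // qr_conj. Qed.

Lemma rq_smooth p : smooth_map (@rcoord R 2 1) (@rcoord R 2 1) (@S7 R) (rq p).
Proof.
apply: (smooth_map_formula (g := rq p)) => // U oU i j.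
have mU : msm U (fun y : 'M[R]_(2, 1) * 'M[R]_(2, 1) * 'M[R]_(2, 1) * 'M[R]_(2, 1) => unrc y).
  by apply: msm_unrc => //; exact: sm_id.
have := msmM oU (msm_cst _ (rot1 p)) mU => /(_ i 0) h.
rewrite (_ : (fun y => _) = fun y => (rot1 p *m unrc y) i 0 * qconj p); last first.
  by apply/funext => y; rewrite mxE.
by apply: qsmM => //; exact: qsm_cst.
Qed.

(** For unit p, the automorphism of Sp(2) that covers [rq p]: its right factor sends o to o p^-1,
    which accounts for the right multiplication in [rq p]. *)
Definition conj1 (p : H) (A : M2) : M2 := rot1 p *m A *m rot1 (qconj p).

Lemma rot1_conj (p : H) : qnorm2 p = 1 -> rot1 (qconj p) *m rot1 p = 1%:M.
Proof.
by move=> p1; rewrite rot1M qmulCl p1; apply: mx2_ext; rewrite !mxsE.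
Qed.

Lemma conj1_Sp2 p A : qnorm2 p = 1 -> Sp2 A -> Sp2 (conj1 p A).
Proof.
by move=> p1 SA; do 2?apply: Sp2M => //; apply: rot1_Sp2; rewrite ?qnorm2C.
Qed.

Lemma conj1K p A : qnorm2 p = 1 -> conj1 (qconj p) (conj1 p A) = A.
Proof.
move=> p1; rewrite /conj1 qconjK !mulmxA rot1_conj // mul1mx -mulmxA rot1_conj //.
by rewrite mulmx1.
Qed.

Lemma conj1_smooth p : smooth_map (@rcoord R 2 2) (@rcoord R 2 2) (@Sp2 R) (conj1 p).
Proof.
apply: (smooth_map_formula (g := conj1 p)) => // U oU.
have mU : msm U (fun y : 'M[R]_2 * 'M[R]_2 * 'M[R]_2 * 'M[R]_2 => unrc y).
  by apply: msm_unrc => //; exact: sm_id.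
by apply: msmM => //; [apply: msmM => //; exact: msm_cst|exact: msm_cst].
Qed.

Lemma conj1_Sp1 p A : qnorm2 p = 1 -> Sp1 A -> Sp1 (conj1 p A).
Proof.
move=> p1 [h /= hh <-]; exists h => //; apply: mx2_ext; rewrite /conj1 !mxsE;
  by rewrite !(mul0r, mulr0, mul1r, mulr1, addr0, add0r) // qmulCr p1.
Qed.

Lemma qnC : qnorm2 (qconj q) = 1. Proof. by rewrite qnorm2C. Qed.

Lemma rqKV x : rq q (rq (qconj q) x) = x.
Proof. by rewrite -{1}(qconjK q) rqK // qnC. Qed.

Lemma pinv_rq x : S7 x -> pinvS (rq q) x = rq (qconj q) x.
Proof.
move=> Sx; have inj : {in S7 (R:=R) &, injective (rq q)}.
  by move=> y z _ _ e; rewrite -(rqK y q1) e rqK.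
rewrite -{1}(rqKV x).
exact: (@pinvKV _ _ (id : H2 -> H2) _ (rq q) inj _ (mem_set (rq_S7 qnC Sx))).
Qed.

Lemma dS7_pinv_rq x v : S7 x -> T7 x v -> dS7 (pinvS (rq q)) x v = rq (qconj q) v.
Proof.
move=> Sx Tv; apply: dS7_lin => // [y|c y y'|c y]; first exact: pinv_rq.
  by apply: cv2_ext; rewrite !(mxsE, rq0, rq1) !(mulrDl, mulrDr) !mulrA ?qreC ?mulrA.
by apply: cv2_ext; rewrite !(mxsE, rq0, rq1) !mulrA ?qreC ?mulrA.
Qed.

(** The inverse of [rq q] conjugates the quaternions [cc] and [kk] by q, which rotates imaginary
    parts by Q and fixes real parts. *)
Lemma push_rq P lam : push (rq q) (Field2 P lam) = Field2 (Q *m P *m Q^T) lam.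
Proof.
apply/funext => x; apply/funext => v; rewrite /push /pullback /Field2 /tangent /restr.
case: asboolP => [h|//]; have [Sx Tv] : S7 x /\ forall i, T7 x (v i).
  by split=> [|i]; [exact: (h ord0).1|exact: (h i).2].
rewrite pinv_rq // asboolT => [|i]; last first.
  rewrite dS7_pinv_rq //; split; first exact: rq_S7 qnC Sx.
  exact: rq_T7 qnC (Tv i).
rewrite !dS7_pinv_rq //.
have ccE a b : cc (rq (qconj q) a) (rq (qconj q) b) = qconj q * cc a b * q.
  by rewrite cc_rq ?qnC // qconjK.
have kkE a b c : kk (rq (qconj q) a) (rq (qconj q) b) (rq (qconj q) c) = qconj q * kk a b c * q.
  rewrite /kk !ccE !qconjM qconjK mulrBr mulrBl; congr (_ - _).
  rewrite !mulrA -(mulrA _ q (qconj q)) qmulCr q1 qre1 mulr1 //.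
have qrc z : qr (qconj q * z * q) = qr z by rewrite -{2}(qconjK q) qr_conj ?qnC.
rewrite /f2 /nX kkE qrc; congr (_ + _).
have eE k (u : H2) : eX (rq (qconj q) x) (k : 'I_3) (rq (qconj q) u) =
    \sum_(l < 3) eX x l u * Q l k.
  by rewrite /eX ccE qQ.
transitivity (\sum_(i < 3) \sum_(j < 3) P i j *
    (\sum_(l < 3) eX x l (v ord0) * Q l i) * (\sum_(l < 3) eX x l (v ord_max) * Q l j)).
  by apply: eq_bigr => i _; apply: eq_bigr => j _; rewrite !eE.
rewrite !sum3E !mxE !sum3E !mxE !sum3E.
by move: (eX x) => e; ring.
Qed.

End RotationAut.

(** * Orbits of metrics under automorphisms *)

Section AutOrbit.
Variable R : realType.
Local Notation H2 := 'cV[quat R]_2.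

(** A Cholesky factor U of P yields the factor U Q^T of the conjugate. *)
Lemma PD_conj (P Q : 'M[R]_3) : PD P -> SO3 Q -> PD (Q *m P *m Q^T).
Proof.
move=> PP SQ; have [UU U0] := cholP PP.1 (PD_minors PP).
have [_ d1] := SQ; have -> : Q *m P *m Q^T = 1 *: ((chol P *m Q^T)^T *m (chol P *m Q^T)).
  by rewrite scale1r trmx_mul trmxK !mulmxA -(mulmxA Q (chol P)^T) UU.
by apply: PD_gram => //; rewrite det3M det3_tr -(det3E Q) d1 mulr1.
Qed.

Lemma SO3_Aut (Q : 'M[R]_3) : SO3 Q -> exists2 f, AutS7 f &
  forall P lam, push f (Field2 P lam) = Field2 (Q *m P *m Q^T) lam.
Proof.
move=> SQ; have [q q1 qQ] := SO3_conj SQ; have q1' := qnC q1.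
exists (rq q); last by move=> P lam; exact: push_rq.
split.
- exists (rq (qconj q)); split.
  + by move=> x Sx; exact: rq_S7.
  + by move=> x Sx; exact: rq_S7.
  + by split=> x _; [exact: rqK|exact: rqKV].
  + exact: rq_smooth.
  + exact: rq_smooth.
- exists (conj1 q); split.
  + exists (conj1 (qconj q)); split.
    * by move=> A SA; exact: conj1_Sp2.
    * by move=> A SA; exact: conj1_Sp2.
    * by split=> A _; [exact: conj1K|rewrite -{1}(qconjK q) conj1K].
    * exact: conj1_smooth.
    * exact: conj1_smooth.
  + move=> A B _ _; rewrite /conj1 !mulmxA.
    by rewrite -(mulmxA (rot1 q *m A) (rot1 (qconj q)) (rot1 q)) rot1_conj // mulmx1.
  + apply/seteqP; split=> [_ [A SA <-]|A SA]; first exact: conj1_Sp1.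
    exists (conj1 (qconj q) A); first exact: conj1_Sp1.
    by rewrite -{1}(qconjK q) conj1K.
  + move=> A _; apply: cv2_ext; rewrite ?rq0 ?rq1 /conj1 !mxsE;
      by rewrite !(mul0r, mulr0, mul1r, mulr1, addr0, add0r).
- move=> _ /Sym2p_invP[P [lam [PP l0 ->]]].
  by rewrite (push_rq q1 qQ); apply: Field2_Sym2p => //; exact: PD_conj.
Qed.

Lemma Aut_orbitE P lam : PD P -> 0 < lam ->
  Aut_orbit (Field2 P lam) = [set Field2 (Q *m P *m Q^T) lam | Q in @SO3 R].
Proof.
move=> PP l0; apply/seteqP; split=> [_ [f Af <-]|_ [Q SQ <-]].
  by have [Q SQ ->] := Aut_push Af PP l0; exists Q.
by have [f Af fE] := SO3_Aut SQ; exists f.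
Qed.

End AutOrbit.

(** * The moduli space *)

Section InducedMaps.
Variable R : realType.

(** The local extensions of f need not agree off A; the open set is the union of the preimages of U
    under all of them. *)
Lemma smooth_map_preimage (E F : Type) (V W : normedModType R) (cE : E -> V) (cF : F -> W)
    (A : set E) (f : E -> F) (U : set W) : smooth_map cE cF A f -> open U ->
  exists2 U' : set V, open U' & forall x, A x -> U' (cE x) <-> U (cF (f x)).
Proof.
move=> sf oU; pose loc (U1 : set V) (G : V -> W) := [/\ open U1, smooth_on U1 G &
  forall y, A y -> U1 (cE y) -> cF (f y) = G (cE y)].
exists [set e | exists U1 G, [/\ loc U1 G, U1 e & U (G e)]].
  rewrite openE => e [U1 [G [[oU1 sG fG] U1e UGe]]].
  have : nbhs e U1 by apply: open_nbhs_nbhs.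
  have cG : {for e, continuous G} by exact: sm_cont U1e.
  have : nbhs e (G @^-1` U) by apply: cG; exact: open_nbhs_nbhs.
  by apply: filterS2 => y UGy U1y; exists U1, G.
move=> x Ax; split=> [[U1 [G [[_ _ fG] U1x UGx]]]|Ux]; first by rewrite fG.
have [U1 [G [oU1 U1x sG fG]]] := sf x Ax; exists U1, G; split=> //.
by rewrite -fG.
Qed.

Section Quotients.
Context (E E' : Type) (Q Q' : choiceType) (V V' : normedModType R).
Variables (c : E -> V) (A : set E) (q : E -> Q) (c' : E' -> V') (A' : set E') (q' : E' -> Q').
Variable f : E -> E'.
Hypothesis fA : forall x, A x -> A' (f x).
Hypothesis fq : forall x y, A x -> A y -> q x = q y -> q' (f x) = q' (f y).
Hypothesis sf : smooth_map c c' A f.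

Lemma qspaceP (X : qspace c A q) : exists x (Ax : A x), X = qclass c q Ax.
Proof.
case: X => y y_in; have [x Ax xy] := set_mem y_in.
by exists x, Ax; apply: val_inj => /=.
Qed.

Lemma qclass_eq x y (Ax : A x) (Ay : A y) : q x = q y -> qclass c q Ax = qclass c q Ay.
Proof. by move=> e; apply: val_inj. Qed.

Lemma induced_map : exists F : qspace c A q -> qspace c' A' q', continuous F /\
  forall x (Ax : A x) (A'x : A' (f x)), F (qclass c q Ax) = qclass c' q' A'x.
Proof.
have /choice[F FP] (X : qspace c A q) : exists Y : qspace c' A' q',
    forall x (Ax : A x) (A'x : A' (f x)), X = qclass c q Ax -> Y = qclass c' q' A'x.
  have [x [Ax ->]] := qspaceP X; exists (qclass c' q' (fA Ax)) => y Ay A'y e.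
  by apply: val_inj; apply: fq => //; exact: (congr1 val e).
exists F; split=> [|x Ax A'x]; last exact: FP.
apply/continuousP => O [U oU UO].
have [U' oU' U'U] := smooth_map_preimage sf oU; exists U' => // x Ax.
rewrite U'U //; have -> : (F @^-1` O) (qclass c q Ax) = O (qclass c' q' (fA Ax)).
  by rewrite /preimage /= (FP _ x Ax (fA Ax)).
exact: UO.
Qed.

End Quotients.
End InducedMaps.

(** * The double quotient is homeomorphic to the moduli space *)

Section Homeomorphism.
Variable R : realType.
Implicit Types (P Q D : 'M[R]_3) (z : R * 'M[R]_3).

Lemma Gmet_mul z Q : RGLp z -> SO3 Q ->
  Gmet (z.1, Q *m z.2) = Field2 (Q *m mP z.1 (invmx z.2) *m Q^T) (mlam z.1 (invmx z.2)).
Proof.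
move=> Rz SQ; have uD := RGLp_unit Rz; have [QQ uQ iQ] := SO3_inv SQ.
have iE : invmx (Q *m z.2) = invmx z.2 *m Q^T.
  have uDQ : Q *m z.2 \in unitmx by rewrite unitmx_mul uD uQ.
  rewrite -[RHS]mulmx1 -(mulmxV uDQ) !mulmxA -(mulmxA _ _ Q) QQ mulmx1 mulVmx //.
  by rewrite mul1mx.
have lE : mlam z.1 (invmx z.2 *m Q^T) = mlam z.1 (invmx z.2).
  by rewrite /mlam det3M det3_tr -(det3E Q) SQ.2 [det3 _ * 1]mulr1.
rewrite /Gmet /= iE /mP lE; congr (Field2 _ _).
by rewrite trmx_mul trmxK -scalemxAr -scalemxAl !mulmxA.
Qed.

Lemma Aut_orbit_conj P lam Q : PD P -> 0 < lam -> SO3 Q ->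
  Aut_orbit (Field2 (Q *m P *m Q^T) lam) = Aut_orbit (Field2 P lam).
Proof.
move=> PP l0 SQ; rewrite !Aut_orbitE //; last exact: PD_conj.
have assoc (S T : 'M[R]_3) : S *m (T *m P *m T^T) *m S^T = S *m T *m P *m (S *m T)^T.
  by rewrite trmx_mul !mulmxA.
apply/seteqP; split=> [_ [S SS <-]|_ [S SS <-]].
  by exists (S *m Q); [exact: SO3M|rewrite assoc].
exists (S *m Q^T); first by apply: SO3M => //; exact: SO3_tr.
have [QQ _ _] := SO3_inv SQ; have e : S *m Q^T *m Q = S by rewrite -mulmxA QQ mulmx1.
by rewrite assoc e.
Qed.

Lemma SO3orbit_mul Q D : SO3 Q -> SO3orbit (coset (Q *m D)) = SO3orbit (coset D).
Proof.
move=> SQ; have cE (S : 'M[R]_3) : [set S *m X | X in coset (Q *m D)] = [set S *m Q *m X | X in coset D].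
  apply/seteqP; split=> [_ [_ [T ST <-] <-]|_ [_ [T ST <-] <-]].
    by exists (D *m T); [exists T|rewrite !mulmxA].
  by exists (Q *m D *m T); [exists T|rewrite !mulmxA].
apply/seteqP; split=> [_ [S SS <-]|_ [S SS <-]].
  by exists (S *m Q); [exact: SO3M|rewrite cE].
exists (S *m Q^T); first by apply: SO3M => //; exact: SO3_tr.
by have [QQ _ _] := SO3_inv SQ; rewrite cE -mulmxA QQ mulmx1.
Qed.

Lemma RGLp_mul z Q : RGLp z -> SO3 Q -> RGLp (z.1, Q *m z.2).
Proof. by move=> [z1 z2] [_ Q1]; split=> //=; rewrite det_mulmx Q1 mul1r. Qed.

(** Equality of orbits is tested on one representative: [Gmet_mul] turns left multiplication of D
    into conjugation of P, and [Gmet_inj] returns from metrics to cosets. *)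
Lemma porbit_Aut_orbit z z' : RGLp z -> RGLp z' ->
  Defs.porbit z = Defs.porbit z' <-> Aut_orbit (Gmet z) = Aut_orbit (Gmet z').
Proof.
move=> Rz Rz'; have [a0 A0] := RGLp_inv Rz; have [a0' A0'] := RGLp_inv Rz'.
have PP := mP_PD a0 A0; have l0 := mlam_gt0 a0 A0.
have PP' := mP_PD a0' A0'; have l0' := mlam_gt0 a0' A0'.
have id1 (C : set 'M[R]_3) : [set 1%:M *m X | X in C] = C.
  by apply/seteqP; split=> [_ [X CX <-]|X CX]; [rewrite mul1mx|exists X; rewrite ?mul1mx].
split=> [[e1 e2]|e].
  have : SO3orbit (coset z.2) (coset z'.2) by rewrite e2; exists 1%:M; [exact: SO3_1|exact: id1].
  move=> [Q SQ eQ]; have : coset z'.2 (Q *m z.2).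
    by rewrite -eQ; exists z.2 => //; exact: coset_refl.
  by move=> /(Gmet_coset Rz') <-; rewrite -e1 Gmet_mul // Aut_orbit_conj.
have : Aut_orbit (Gmet z) (Gmet z').
  rewrite e Aut_orbitE //; exists 1%:M; first exact: SO3_1.
  by rewrite mul1mx trmx1 mulmx1.
rewrite Aut_orbitE // => -[Q SQ]; rewrite -Gmet_mul // => /Gmet_inj.
move=> /(_ (RGLp_mul Rz SQ) Rz')[e1 e2].
by rewrite /Defs.porbit -e2 -e1 SO3orbit_mul.
Qed.

(** [Mmap] and the Cholesky section [sect] respect the equivalences and are inverse up to them, so
    they induce inverse continuous maps. *)
Lemma moduli_homeomorphism : exists N : double_quotient R -> moduli R, homeomorphism N /\
  forall z (Az : RGLp z) (Ag : Sym2p_inv (Mmap (pcoset z))),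
    N (double_class Az) = moduli_class Ag.
Proof.
have sectP (g : tfield R 2) : Sym2p_inv g -> RGLp (sect (metric_coord g)) /\ Gmet (sect (metric_coord g)) = g.
  move=> /Sym2p_invP[P [lam [PP l0 ->]]]; have [Rz Gz] := Gmet_sect PP.1 (PD_minors PP) l0.
  by rewrite /sect metric_coordE cP_T2 clam_T2.
have MA z : RGLp z -> Sym2p_inv (Mmap (pcoset z)).
  by move=> Rz; rewrite Mmap_pcoset //; exact: Gmet_Sym2p.
have Mq z z' : RGLp z -> RGLp z' -> Defs.porbit z = Defs.porbit z' ->
    Aut_orbit (Mmap (pcoset z)) = Aut_orbit (Mmap (pcoset z')).
  by move=> Rz Rz'; rewrite (Mmap_pcoset Rz) (Mmap_pcoset Rz') => /(porbit_Aut_orbit Rz Rz').1.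
have sq (g g' : tfield R 2) : Sym2p_inv g -> Sym2p_inv g' -> Aut_orbit g = Aut_orbit g' ->
    Defs.porbit (sect (metric_coord g)) = Defs.porbit (sect (metric_coord g')).
  move=> /sectP[Rz gE] /sectP[Rz' gE'] e.
  by apply: (porbit_Aut_orbit Rz Rz').2; rewrite gE gE'.
have ssect : smooth_map (@metric_coord R) (@RGL_coord R) (@Sym2p_inv R)
    (fun g => sect (metric_coord g)).
  move=> _ /Sym2p_invP[P [lam [PP l0 ->]]]; exists (@Udom R), (@sect R); split=> //.
  - exact: open_Udom.
  - by have [? ? ?] := PD_minors PP; rewrite /Udom /= metric_coordE cP_T2 clam_T2.
  - exact: sm_sect.
have [N [cN NE]] := induced_map MA Mq (@Mmap_smooth R).
have [N' [cN' NE']] := induced_map (fun g h => (sectP g h).1) sq ssect.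
exists N; split; last by move=> z Az Ag; exact: NE.
split=> //; exists N'; split=> // X.
- have [z [Az eX]] := @qspaceP _ _ _ _ (@RGL_coord R) (@RGLp R) (@Defs.porbit R) X; rewrite eX (NE z Az (MA z Az)).
  have [Rs Gs] := sectP _ (MA z Az); rewrite (NE' _ (MA z Az) Rs).
  apply: qclass_eq; apply: (porbit_Aut_orbit Rs Az).2.
  by rewrite Gs (Mmap_pcoset Az).
- have [g [Ag eX]] := @qspaceP _ _ _ _ (@metric_coord R) (@Sym2p_inv R) (@Aut_orbit R) X; rewrite eX; have [Rs Gs] := sectP _ Ag.
  rewrite (NE' _ Ag Rs) (NE _ Rs (MA _ Rs)); apply: qclass_eq.
  by rewrite (Mmap_pcoset Rs) Gs.
Qed.

End Homeomorphism.

(** * Diagonalization and the largest eigenvalue *)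

Section Spectral.
Variable R : realType.
Implicit Types (P S : 'M[R]_3) (x y : 'I_3 -> R).

Definition dot x y : R := x j0 * y j0 + x j1 * y j1 + x j2 * y j2.

Definition bf P x y : R := \sum_i \sum_j P i j * x i * y j.

Lemma bfE P x y : bf P x y =
  (P j0 j0 * x j0 * y j0 + P j0 j1 * x j0 * y j1 + P j0 j2 * x j0 * y j2) +
  (P j1 j0 * x j1 * y j0 + P j1 j1 * x j1 * y j1 + P j1 j2 * x j1 * y j2) +
  (P j2 j0 * x j2 * y j0 + P j2 j1 * x j2 * y j1 + P j2 j2 * x j2 * y j2).
Proof. by rewrite /bf !sum3E. Qed.

Definition dg (a b c : R) : 'M[R]_3 := mx3 [:: [:: a; 0; 0]; [:: 0; b; 0]; [:: 0; 0; c]].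

(** For small t the linear term dominates; t = p / (|q| + 1) is small enough. *)
Lemma lin_quadratic0 (p q : R) : (forall t : R, 2 * t * p + t ^+ 2 * q <= 0) -> p = 0.
Proof.
move=> h; apply/eqP; rewrite -sqrf_eq0; apply/eqP/le_anti; rewrite sqr_ge0 andbT.
have q1 : 0 < `|q| + 1 by rewrite ltr_wpDl.
have := h (p / (`|q| + 1)).
have -> : 2 * (p / (`|q| + 1)) * p + (p / (`|q| + 1)) ^+ 2 * q =
  (p ^+ 2 / (`|q| + 1) ^+ 2) * (2 * (`|q| + 1) + q) by field; rewrite gt_eqF.
have a0 : 0 < 2 * (`|q| + 1) + q.
  by have := ler_norm (- q); rewrite normrN; have := normr_ge0 q; lra.
by rewrite pmulr_lle0 // pmulr_lle0 // invr_gt0 exprn_gt0.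
Qed.

(** First variation: moving the maximizer v along w adds the linear term 2 t bf P v w, which must
    vanish. *)
Lemma max_orthogonal P m v w : P^T = P -> (forall x, qf P x <= m * dot x x) ->
  qf P v = m * dot v v -> dot v w = 0 -> bf P v w = 0.
Proof.
move=> PT mP vm vw; apply: (@lin_quadratic0 _ (qf P w - m * dot w w)) => t.
have := mP (fun i => v i + t * w i); rewrite -subr_le0; congr (_ <= 0).
have -> : qf P (fun i => v i + t * w i) - m * dot (fun i => v i + t * w i) (fun i => v i + t * w i) =
  (qf P v - m * dot v v) + 2 * t * (bf P v w - m * dot v w) + t ^+ 2 * (qf P w - m * dot w w).
  by rewrite !qfE bfE /dot (symE j0 j1 PT) (symE j0 j2 PT) (symE j1 j2 PT); ring.
by rewrite vm subrr add0r vw mulr0 subr0.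
Qed.

Lemma qf_scale P c x : qf P (fun i => c * x i) = c ^+ 2 * qf P x.
Proof. by rewrite !qfE; ring. Qed.

Lemma dot_scale c x : dot (fun i => c * x i) (fun i => c * x i) = c ^+ 2 * dot x x.
Proof. by rewrite /dot; ring. Qed.

Lemma dot_ge0 x : 0 <= dot x x.
Proof. by rewrite /dot -!expr2 !addr_ge0 ?sqr_ge0. Qed.

Lemma dot_eq0 x : dot x x = 0 -> forall i, x i = 0.
Proof.
rewrite /dot -!expr2 => h i; have := sqr_ge0 (x j0); have := sqr_ge0 (x j1).
have := sqr_ge0 (x j2) => a b c.
by apply/eqP; rewrite -sqrf_eq0; apply/eqP; case: (ord3P i) => ->; lra.
Qed.

Lemma unit_bound P m : (forall x, dot x x = 1 -> qf P x <= m) -> forall x, qf P x <= m * dot x x.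
Proof.
move=> h x; have [/dot_eq0 z|n0] := eqVneq (dot x x) 0.
  by rewrite qfE /dot !z !(mulr0, mul0r, addr0).
have d0 : 0 < dot x x by rewrite lt_def n0 dot_ge0.
pose n := Num.sqrt (dot x x); have nn : n ^+ 2 = dot x x by rewrite sqr_sqrtr // ltW.
have nn0 : n != 0 by rewrite gt_eqF // sqrtr_gt0.
have := h (fun i => n^-1 * x i); rewrite dot_scale qf_scale exprVn nn mulVf // => /(_ erefl).
by rewrite mulrC ler_pdivrMr.
Qed.

Lemma max_vector P : exists v, dot v v = 1 /\ forall x, qf P x <= qf P v * dot x x.
Proof.
pose A : set 'rV[R]_3 := [set v | dot (v 0) (v 0) = 1].
have sm2 (i j : 'I_3) : smooth_on setT (fun v : 'rV[R]_3 => v 0 i * v 0 j).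
  have sE k : smooth_on setT (fun v : 'rV[R]_3 => v 0 k).
    by apply: sm_entry; [exact: openT|apply: sm_id; exact: openT].
  by apply: smM => //; exact: openT.
have cq Z : continuous (fun v : 'rV[R]_3 => qf Z (v 0)).
  have s : smooth_on setT (fun v : 'rV[R]_3 => qf Z (v 0)).
    apply: sm_sum; first exact: openT.
    move=> i _; apply: sm_sum; first exact: openT.
    move=> j _; under eq_fun do rewrite -mulrA.
    by apply: smM => //; [exact: openT|exact: sm_cst].
  by move=> v; exact: (sm_cont s).
have cd : continuous (fun v : 'rV[R]_3 => dot (v 0) (v 0)).
  have s : smooth_on setT (fun v : 'rV[R]_3 => dot (v 0) (v 0)).
    by have oT := @openT 'rV[R]_3; apply: smD => //; apply: smD.
  by move=> v; exact: (sm_cont s).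
have [|||c /set_mem Ac cmax] := @EVT_max_rV R 3 (fun v => qf P (v 0)) A.
- exists (\row_i (i == j0)%:R); rewrite /A /= /dot !mxE /=; ring.
- apply: bounded_closed_compact; last first.
    apply: (@closed_comp _ _ (fun v : 'rV[R]_3 => dot (v 0) (v 0)) [set x | x = 1]).
      by move=> x _; exact: cd.
    exact: closed_eq.
  exists 1; split; first exact: num_real.
  move=> M M1 v Av; apply: le_trans (ltW M1).
  change (mx_norm v <= 1); rewrite mx_normrE; apply/bigmax_leP; split=> // -[i j] _ /=; rewrite ord1.
  rewrite -(@ler_pXn2r _ 2) ?nnegrE // expr1n -normrX ger0_norm ?sqr_ge0 //.
  have := sqr_ge0 (v 0 j0); have := sqr_ge0 (v 0 j1); have := sqr_ge0 (v 0 j2).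
  by move: Av; rewrite /A /= /dot -!expr2; case: (ord3P j) => ->; lra.
- exact: continuous_subspaceT.
exists (c 0); split=> //; apply: unit_bound => x x1.
have xE : (\row_i x i) 0 = x :> ('I_3 -> R) by apply/funext => i; rewrite mxE.
by have := cmax (\row_i x i); rewrite xE; apply; apply/mem_set; rewrite /A /= xE.
Qed.

Lemma unit_orthogonal v : dot v v = 1 -> exists w, dot w w = 1 /\ dot v w = 0.
Proof.
move=> v1; have [z|nz] := eqVneq (v j0 ^+ 2 + v j1 ^+ 2) 0.
  exists (vec3 1 0 0); rewrite /dot /vec3 /=; split; first by ring.
  have : v j0 = 0.
    have := sqr_ge0 (v j0); have := sqr_ge0 (v j1) => a b.
    by apply/eqP; rewrite -sqrf_eq0; apply/eqP; lra.
  by move=> ->; ring.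
have p : 0 < v j0 ^+ 2 + v j1 ^+ 2 by rewrite lt_def nz addr_ge0 ?sqr_ge0.
pose n := Num.sqrt (v j0 ^+ 2 + v j1 ^+ 2).
have nn : n ^+ 2 = v j0 ^+ 2 + v j1 ^+ 2 by rewrite sqr_sqrtr // ltW.
have n0 : n != 0 by rewrite gt_eqF // sqrtr_gt0.
exists (vec3 (- v j1 / n) (v j0 / n) 0); rewrite /dot /vec3 /=; split; last by field.
transitivity ((v j0 ^+ 2 + v j1 ^+ 2) / n ^+ 2); first by field.
by rewrite nn mulfV.
Qed.

(** A maximizer v and a minimizer w of the form on the unit sphere are eigenvectors and can be taken
    orthogonal; their cross product completes them, and the value there lies between the extreme
    ones. *)
Lemma PD_diagonalize P : PD P -> exists S a b c,
  [/\ SO3 S, P = S *m dg a b c *m S^T & [/\ b <= a, c <= b & 0 < c]].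
Proof.
move=> PP; have [PT pos] := PP.
have [v [v1 vmax]] := max_vector P; pose a := qf P v.
have [w0 [w01 w0min]] : exists w, dot w w = 1 /\ forall x, qf P w * dot x x <= qf P x.
  have [w [w1 wm]] := max_vector (- P); exists w; split=> // x.
  have N y : qf (- P) y = - qf P y by rewrite !qfE !mxE; ring.
  by have := wm x; rewrite !N mulNr lerN2.
have [w [w1 wmin vw]] : exists w, [/\ dot w w = 1, forall x, qf P w * dot x x <= qf P x & dot v w = 0].
  (* If maximum and minimum agree, the form is constant on unit vectors and any w orthogonal to v
     will do; otherwise eigenvectors of distinct eigenvalues are orthogonal. *)
  have [e|ne] := eqVneq (qf P w0) a.
    have [w [w1 vw]] := unit_orthogonal v1; exists w; split=> // x.
    have := vmax w; have := w0min w; rewrite w1 !mulr1 e => h1 h2.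
    by rewrite (_ : qf P w = qf P w0) ?w0min //; apply: le_anti; rewrite e h1 h2.
  exists w0; split=> //.
  have h1 : bf P v w0 = a * dot v w0.
    have := @max_orthogonal P a v (fun i => w0 i - dot v w0 * v i) PT vmax.
    rewrite v1 mulr1 => /(_ erefl).
    have -> : dot v (fun i => w0 i - dot v w0 * v i) = dot v w0 * (1 - dot v v).
      by rewrite /dot; ring.
    rewrite v1 subrr mulr0 => /(_ erefl) => e; have : bf P v w0 - dot v w0 * qf P v = 0.
      by rewrite -e bfE bfE qfE; ring.
    by move/eqP; rewrite subr_eq0 => /eqP ->; rewrite mulrC.
  have h2 : bf P w0 v = qf P w0 * dot v w0.
    have NT : (- P)^T = - P by rewrite -{2}PT; apply/matrixP => i j; rewrite !mxE.
    have N y : qf (- P) y = - qf P y by rewrite !qfE !mxE; ring.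
    have := @max_orthogonal (- P) (- qf P w0) w0 (fun i => v i - dot v w0 * w0 i) NT.
    have h x : qf (- P) x <= - qf P w0 * dot x x by rewrite N mulNr lerN2.
    rewrite w01 mulr1 N => /(_ h erefl).
    have -> : dot w0 (fun i => v i - dot v w0 * w0 i) = dot v w0 * (1 - dot w0 w0).
      by rewrite /dot; ring.
    rewrite w01 subrr mulr0 => /(_ erefl) => e; have : bf P w0 v - dot v w0 * qf P w0 = 0.
      rewrite -[RHS]oppr0 -e bfE bfE qfE !mxE; ring.
    by move/eqP; rewrite subr_eq0 => /eqP ->; rewrite mulrC.
  have sym : bf P w0 v = bf P v w0.
    by rewrite !bfE (symE j0 j1 PT) (symE j0 j2 PT) (symE j1 j2 PT); ring.
  move: h2; rewrite sym h1 => /eqP; rewrite -subr_eq0 -mulrBl mulf_eq0 subr_eq0 eq_sym.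
  by rewrite (negbTE ne) => /eqP.
(* The cross product of w and v, in this order, so that the columns v, u, w have determinant 1. *)
pose u := vec3 (w j1 * v j2 - w j2 * v j1) (w j2 * v j0 - w j0 * v j2) (w j0 * v j1 - w j1 * v j0).
have uv : dot v u = 0 by rewrite /dot /u /vec3 /=; ring.
have uw : dot w u = 0 by rewrite /dot /u /vec3 /=; ring.
have u1 : dot u u = 1.
  transitivity (dot v v * dot w w - dot v w ^+ 2); first by rewrite /dot /u /vec3 /=; ring.
  by rewrite v1 w1 vw expr0n /= subr0 mulr1.
have bvu : bf P v u = 0 by apply: (max_orthogonal PT vmax) => //; rewrite v1 mulr1.
have bvw : bf P v w = 0 by apply: (max_orthogonal PT vmax) => //; rewrite v1 mulr1.
have bwu : bf P w u = 0.
  have N y : qf (- P) y = - qf P y by rewrite !qfE !mxE; ring.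
  have NT : (- P)^T = - P by rewrite -{2}PT; apply/matrixP => i j; rewrite !mxE.
  have := @max_orthogonal (- P) (- qf P w) w u NT.
  have h x : qf (- P) x <= - qf P w * dot x x by rewrite N mulNr lerN2.
  rewrite w1 mulr1 N => /(_ h erefl uw) => e; rewrite -[RHS]oppr0 -e !bfE !mxE; ring.
pose S : 'M[R]_3 := mx3 [:: [:: v j0; u j0; w j0]; [:: v j1; u j1; w j1]; [:: v j2; u j2; w j2]].
have StS : S^T *m S = 1%:M.
  move: v1 u1 w1 uv uw vw; rewrite /dot => v1 u1 w1 uv uw vw.
  apply: mx3_ext; rewrite !mxE sum3E !mxE /=.
  - exact: v1.
  - exact: uv.
  - exact: vw.
  - by rewrite -[RHS]uv; ring.
  - exact: u1.
  - by rewrite -[RHS]uw; ring.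
  - by rewrite -[RHS]vw; ring.
  - exact: uw.
  - exact: w1.
have SSt : S *m S^T = 1%:M by exact: mulmx1C.
have dS : \det S = 1.
  rewrite det3E; transitivity (dot v v * dot w w - dot v w ^+ 2).
    by rewrite /det3 !mxE /dot /u /vec3 /=; ring.
  by rewrite v1 w1 vw expr0n /= subr0 mulr1.
have D : S^T *m P *m S = dg a (qf P u) (qf P w).
  have s10 := symE j0 j1 PT; have s20 := symE j0 j2 PT; have s21 := symE j1 j2 PT.
  rewrite bfE in bvu; rewrite bfE in bvw; rewrite bfE in bwu; rewrite /a !qfE.
  rewrite s10 s20 s21 in bvu bvw bwu *; rewrite /S; clear -bvu bvw bwu s10 s20 s21.
  move: u bvu bwu => u bvu bwu.
  apply: mx3_ext; rewrite !mxE sum3E !mxE !sum3E !mxE /= s10 s20 s21.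
  - ring.
  - by rewrite -[RHS]bvu; ring.
  - by rewrite -[RHS]bvw; ring.
  - by rewrite -[RHS]bvu; ring.
  - ring.
  - by rewrite -[RHS]bwu; ring.
  - by rewrite -[RHS]bvw; ring.
  - by rewrite -[RHS]bwu; ring.
  - ring.
exists S, a, (qf P u), (qf P w); split; first by [].
  by rewrite -D !mulmxA SSt mul1mx -mulmxA SSt mulmx1.
split.
- by have := vmax u; rewrite u1 mulr1.
- by have := wmin u; rewrite u1 mulr1.
- apply: pos; apply: contrapT => no; have z i : w i = 0.
    by apply/eqP; apply: contrapT => /negP h; apply: no; exists i.
  by move: w1; rewrite /dot !z !mulr0 !addr0 => /eqP; rewrite eq_sym oner_eq0.
Qed.

Definition lmax P : R := sup [set qf P x | x in [set x | dot x x = 1]].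

Lemma lmax_eq P v : dot v v = 1 -> (forall x, qf P x <= qf P v * dot x x) -> lmax P = qf P v.
Proof.
move=> v1 vmax; have ub : ubound [set qf P x | x in [set x | dot x x = 1]] (qf P v).
  by move=> _ [x x1 <-]; have := vmax x; rewrite x1 mulr1.
have ne : [set qf P x | x in [set x | dot x x = 1]] (qf P v) by exists v.
apply: le_anti; rewrite ge_sup //=; last by exists (qf P v).
by apply: sup_upper_bound => //; split; exists (qf P v).
Qed.

Lemma qf_dg S a b c x : qf (S *m dg a b c *m S^T) x =
  a * (S j0 j0 * x j0 + S j1 j0 * x j1 + S j2 j0 * x j2) ^+ 2 +
  b * (S j0 j1 * x j0 + S j1 j1 * x j1 + S j2 j1 * x j2) ^+ 2 +
  c * (S j0 j2 * x j0 + S j1 j2 * x j1 + S j2 j2 * x j2) ^+ 2.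
Proof. by rewrite qfE !mxE !sum3E !mxE !sum3E !mxE /=; ring. Qed.

(** A column of S attains the bound. The alternative m = c serves -P, whose eigenvalues come in
    reverse order. *)
Lemma lmax_dg S a b c m : SO3 S -> a <= m -> b <= m -> c <= m -> m = a \/ m = c ->
  lmax (S *m dg a b c *m S^T) = m.
Proof.
move=> SS am bm cm mac; have [StS _ _] := SO3_inv SS; have [SSt _] := SS.
have E i j : (S^T *m S) i j = (i == j)%:R by rewrite StS mxE.
have E' i j : (S *m S^T) i j = (i == j)%:R by rewrite SSt mxE.
have [v [v1 vm]] : exists v, dot v v = 1 /\ qf (S *m dg a b c *m S^T) v = m.
  have col k : dot (fun i => S i k) (fun i => S i k) = 1.
    by have := E k k; rewrite mxE sum3E !mxE eqxx.
  have e01 := E j0 j1; have e02 := E j0 j2; have e12 := E j1 j2.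
  have e00 := E j0 j0; have e11 := E j1 j1; have e22 := E j2 j2.
  rewrite !mxE !sum3E !mxE /= in e01 e02 e12 e00 e11 e22.
  case: mac => ->; [exists (fun i => S i j0)|exists (fun i => S i j2)]; split=> //;
    rewrite qf_dg.
  - have f1 : S j0 j1 * S j0 j0 + S j1 j1 * S j1 j0 + S j2 j1 * S j2 j0 = 0.
      by rewrite -[RHS]e01; ring.
    have f2' : S j0 j2 * S j0 j0 + S j1 j2 * S j1 j0 + S j2 j2 * S j2 j0 = 0.
      by rewrite -[RHS]e02; ring.
    by rewrite e00 f1 f2'; ring.
  - by rewrite e22 e02 e12; ring.
rewrite -vm; apply: lmax_eq => // x; rewrite vm qf_dg.
have -> : dot x x = (S j0 j0 * x j0 + S j1 j0 * x j1 + S j2 j0 * x j2) ^+ 2 +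
  (S j0 j1 * x j0 + S j1 j1 * x j1 + S j2 j1 * x j2) ^+ 2 +
  (S j0 j2 * x j0 + S j1 j2 * x j1 + S j2 j2 * x j2) ^+ 2.
  transitivity (qf (S *m S^T) x); first by rewrite SSt qfE !mxE /dot /=; ring.
  by rewrite qfE !mxE !sum3E !mxE; ring.
by rewrite !mulrDr; apply: lerD; [apply: lerD|]; apply: ler_wpM2r => //; exact: sqr_ge0.
Qed.

Lemma norm_entry m n (A : 'M[R]_(m, n)) i j : `|A i j| <= `|A|.
Proof.
change (`|A i j| <= mx_norm A); rewrite mx_normrE.
exact: (le_bigmax _ (fun ij => `|A ij.1 ij.2|) (i, j)).
Qed.

Lemma dot1_le x i : dot x x = 1 -> `|x i| <= 1.
Proof.
move=> h; rewrite -(@ler_pXn2r _ 2) ?nnegrE // expr1n -normrX ger0_norm ?sqr_ge0 //.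
have := sqr_ge0 (x j0); have := sqr_ge0 (x j1); have := sqr_ge0 (x j2).
by move: h; rewrite /dot -!expr2; case: (ord3P i) => ->; lra.
Qed.

(** Nine terms, each an entry bounded by the maximum norm times two coordinates of modulus at most
    1. *)
Lemma qf_bound P x : dot x x = 1 -> qf P x <= 9 * `|P|.
Proof.
move=> x1; have -> : 9 * `|P| = \sum_(i < 3) \sum_(j < 3) `|P| by rewrite !sum3E; ring.
apply: ler_sum => i _; apply: ler_sum => j _; apply: le_trans (ler_norm _) _.
rewrite !normrM -[leRHS]mulr1; apply: ler_pM => //; last exact: dot1_le.
rewrite -[leRHS]mulr1; apply: ler_pM => //; [exact: norm_entry|exact: dot1_le].
Qed.

Lemma lmax_ub P x : dot x x = 1 -> qf P x <= lmax P.
Proof.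
move=> x1; apply: sup_upper_bound; last by exists x.
by split; [exists (qf P x), x|exists (9 * `|P|) => _ [y y1 <-]; exact: qf_bound].
Qed.

Lemma lmax_lip P P' : lmax P <= lmax P' + 9 * `|P - P'|.
Proof.
apply: ge_sup.
  by exists (qf P (vec3 1 0 0)), (vec3 1 0 0) => //; rewrite /= /dot /vec3 /=; ring.
move=> _ [x x1 <-]; have -> : qf P x = qf P' x + qf (P - P') x by rewrite !qfE !mxE; ring.
by apply: lerD; [exact: lmax_ub|exact: qf_bound].
Qed.

Lemma lmax_continuous : continuous lmax.
Proof.
move=> P; have FP : Filter (nbhs P) by exact: nbhs_filter.
apply: (cvgrPdist_le (F := nbhs P) (FF := FP) lmax (lmax P)).2 => e e0.
have nb : nbhs P [set P' | `|P - P'| <= e / 9].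
  by apply: (@cvgr_dist_le _ _ _ (nbhs P) _ id P); [exact: cvg_id|rewrite divr_gt0].
apply: (filterS _ nb) => P' /= h.
have h1 := lmax_lip P P'; have h2 := lmax_lip P' P; rewrite distrC in h2.
by rewrite ler_norml; apply/andP; split; lra.
Qed.

End Spectral.

(** * A chart by eigenvalues *)

Section Chart.
Variable R : realType.
Local Notation T := 'rV[R]_#|{ffun 'I_2 -> 'I_7}|.
Local Notation i0 := (@Ordinal 4 0 isT).
Local Notation i1 := (@Ordinal 4 1 isT).
Local Notation i2 := (@Ordinal 4 2 isT).
Local Notation i3 := (@Ordinal 4 3 isT).

Definition row4 (a b c d : R) : 'rV[R]_4 := \row_i nth 0 [:: a; b; c; d] i.

Lemma row4_ext (x y : 'rV[R]_4) : x 0 i0 = y 0 i0 -> x 0 i1 = y 0 i1 -> x 0 i2 = y 0 i2 ->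
  x 0 i3 = y 0 i3 -> x = y.
Proof.
move=> h0 h1 h2 h3; apply/matrixP => i [[|[|[|[|//]]]] jlt]; rewrite ord1.
- by rewrite (_ : Ordinal jlt = i0) //; exact/val_inj.
- by rewrite (_ : Ordinal jlt = i1) //; exact/val_inj.
- by rewrite (_ : Ordinal jlt = i2) //; exact/val_inj.
- by rewrite (_ : Ordinal jlt = i3) //; exact/val_inj.
Qed.

Definition chart3 (a b c lam : R) : 'rV[R]_4 := row4 (Num.min (a - b) (b - c)) (a - 2 * b + c) c lam.

(* The moduli of P are its ordered eigenvalues; the gaps s, t >= 0 between them are encoded by
   (min s t, s - t), which turns the quadrant into a half plane. *)
Definition eig1 (P : 'M[R]_3) : R := lmax P.
Definition eig3 (P : 'M[R]_3) : R := - lmax (- P).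
(** Defined through the trace, so that its continuity follows from that of the extreme
    eigenvalues. *)
Definition eig2 (P : 'M[R]_3) : R := P j0 j0 + P j1 j1 + P j2 j2 - eig1 P - eig3 P.

Definition invar (y : T) : 'rV[R]_4 :=
  chart3 (eig1 (cP y)) (eig2 (cP y)) (eig3 (cP y)) (clam y).

Lemma eig_dg (S : 'M[R]_3) a b c : SO3 S -> b <= a -> c <= b ->
  let P := S *m dg a b c *m S^T in [/\ eig1 P = a, eig2 P = b & eig3 P = c].
Proof.
move=> SS ba cb P; have ca := le_trans cb ba.
have e1 : eig1 P = a by apply: lmax_dg => //; left.
have e3 : eig3 P = c.
  have NP : - P = S *m dg (- a) (- b) (- c) *m S^T.
    have -> : dg (- a) (- b) (- c) = - dg a b c.
      by apply: mx3_ext; rewrite !mxE /= ?oppr0.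
    by rewrite mulmxN mulNmx.
  by rewrite /eig3 NP (@lmax_dg _ S _ _ _ (- c)) ?opprK ?lerN2 //; right.
split=> //; rewrite /eig2 e1 e3.
have [StS _ _] := SO3_inv SS.
have tr : \tr P = a + b + c.
  by rewrite mxtrace_mulC mulmxA StS mul1mx /mxtrace sum3E !mxE.
have trE : P j0 j0 + P j1 j1 + P j2 j2 = \tr P by rewrite /mxtrace sum3E.
by rewrite trE tr; ring.
Qed.

Lemma invar_Field2 (S : 'M[R]_3) a b c lam : SO3 S -> b <= a -> c <= b ->
  invar (metric_coord (Field2 (S *m dg a b c *m S^T) lam)) = chart3 a b c lam.
Proof.
move=> SS ba cb; have [e1 e2 e3] := eig_dg SS ba cb.
by rewrite /invar metric_coordE cP_T2 clam_T2 e1 e2 e3.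
Qed.

(** The gaps are recovered by s = min(s, t) + max(s - t, 0) and t = min(s, t) + max(t - s, 0). *)
Definition gap_s (y : 'rV[R]_4) : R := y 0 i0 + Num.max (y 0 i1) 0.
Definition gap_t (y : 'rV[R]_4) : R := y 0 i0 + Num.max (- y 0 i1) 0.
Definition chartP (y : 'rV[R]_4) : 'M[R]_3 :=
  dg (y 0 i2 + gap_t y + gap_s y) (y 0 i2 + gap_t y) (y 0 i2).

Definition Uchart : set 'rV[R]_4 := [set y | 0 < y 0 i2 /\ 0 < y 0 i3].

Lemma chartP_chart3 a b c lam : b <= a -> c <= b -> chartP (chart3 a b c lam) = dg a b c.
Proof.
move=> ba cb; rewrite /chartP /gap_s /gap_t /chart3 !mxE /=.
have [h|h] := leP (a - b) (b - c).
- rewrite (_ : Num.max (a - 2 * b + c) 0 = 0); last by apply: max_r; lra.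
  rewrite (_ : Num.max (- (a - 2 * b + c)) 0 = - (a - 2 * b + c)); last by apply: max_l; lra.
  by congr (dg _ _ _); ring.
- rewrite (_ : Num.max (a - 2 * b + c) 0 = a - 2 * b + c); last by apply: max_l; lra.
  rewrite (_ : Num.max (- (a - 2 * b + c)) 0 = 0); last by apply: max_r; lra.
  by congr (dg _ _ _); ring.
Qed.

Lemma chart3_image a b c lam : b <= a -> c <= b -> 0 < c -> 0 < lam ->
  (Uchart `&` @half_space R 4) (chart3 a b c lam).
Proof.
move=> ba cb c0 l0; split; first by rewrite /Uchart /= !mxE.
move=> i ie; rewrite (_ : i = i0); last exact/val_inj.
by rewrite mxE /= le_min !subr_ge0 ba.
Qed.

Lemma chart3_gaps y : (Uchart `&` @half_space R 4) y ->
  [/\ 0 <= gap_s y, 0 <= gap_t y &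
   chart3 (y 0 i2 + gap_t y + gap_s y) (y 0 i2 + gap_t y) (y 0 i2) (y 0 i3) = y].
Proof.
move=> [[y2 y3] /(_ i0 erefl) y0].
rewrite /gap_s /gap_t /chart3; move: y0 => /= y0.
have [h|h] := leP 0 (y 0 i1).
- rewrite (_ : Num.max (- y 0 i1) 0 = 0); last by apply: max_r; lra.
  split; [lra|lra|]; apply: row4_ext; rewrite !mxE //=; last by ring.
  rewrite (_ : Num.min _ _ = y 0 i2 + (y 0 i0 + 0) - y 0 i2); first by ring.
  by apply: min_r; lra.
- rewrite (_ : Num.max (- y 0 i1) 0 = - y 0 i1); last by apply: max_l; lra.
  split; [lra|lra|]; apply: row4_ext; rewrite !mxE //=; last by ring.
  rewrite (_ : Num.min _ _ = y 0 i2 + (y 0 i0 - y 0 i1) + (y 0 i0 + 0) - (y 0 i2 + (y 0 i0 - y 0 i1))).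
    by ring.
  by apply: min_l; lra.
Qed.

End Chart.

(** * Continuous functions on quotients *)

Section Continuity.
Variable R : realType.

Section Real.
Variable X : topologicalType.
Implicit Types f g : X -> R.

Lemma ctsD f g : continuous f -> continuous g -> continuous (fun x => f x + g x).
Proof. by move=> cf cg x; exact: (cvgD (cf x) (cg x)). Qed.
Lemma ctsN f : continuous f -> continuous (fun x => - f x).
Proof. by move=> cf x; exact: (cvgN (cf x)). Qed.
Lemma ctsM f g : continuous f -> continuous g -> continuous (fun x => f x * g x).
Proof. by move=> cf cg x; exact: (cvgM (cf x) (cg x)). Qed.
Lemma cts_cst (c : R) : continuous (fun _ : X => c).
Proof. by move=> x; exact: cvg_cst. Qed.
Lemma cts_max f g : continuous f -> continuous g -> continuous (fun x => Num.max (f x) (g x)).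
Proof. by move=> cf cg x; exact: (continuous_max (cf x) (cg x)). Qed.
Lemma cts_min f g : continuous f -> continuous g -> continuous (fun x => Num.min (f x) (g x)).
Proof. by move=> cf cg x; exact: (continuous_min (cf x) (cg x)). Qed.

Lemma cts_sum I (r : seq I) (F : I -> X -> R) : (forall i, continuous (F i)) ->
  continuous (fun x => \sum_(i <- r) F i x).
Proof.
move=> cF; elim: r => [|i r IH].
  by rewrite (_ : (fun x => _) = fun=> 0); [exact: cts_cst|apply/funext => x; rewrite big_nil].
rewrite (_ : (fun x => _) = fun x => F i x + \sum_(j <- r) F j x); first exact: ctsD.
by apply/funext => x; rewrite big_cons.
Qed.

Lemma cts_rV n (f : X -> 'rV[R]_n) : (forall i, continuous (fun x => f x 0 i)) -> continuous f.
Proof.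
move=> cf; have fE : f = fun x => \sum_i f x 0 i *: delta_mx 0 i.
  by apply/funext => y; exact: row_sum_delta.
suff h : continuous (fun x => \sum_i f x 0 i *: delta_mx 0 i : 'rV[R]_n) by rewrite fE.
move=> x; rewrite /continuous_at; elim: (index_enum _) => [|i r IH].
  by under eq_fun do rewrite big_nil; rewrite big_nil; exact: cvg_cst.
under eq_fun do rewrite big_cons; rewrite big_cons; apply: cvgD => //.
by apply: cvgZ; [exact: cf|exact: cvg_cst].
Qed.
End Real.

Lemma cts_entry m n i j : continuous (fun A : 'M[R]_(m, n) => A i j).
Proof.
have s : smooth_on setT (fun A : 'M[R]_(m, n) => A i j).
  by apply: sm_entry; [exact: openT|apply: sm_id; exact: openT].
by move=> A; exact: (sm_cont s).
Qed.

Section QuotientFunction.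
Context (E : Type) (Q : choiceType) (V : topologicalType) (W : topologicalType).
Variables (c : E -> V) (A : set E) (q : E -> Q) (F : V -> W).
Hypothesis cF : continuous F.
Hypothesis Fq : forall x y, A x -> A y -> q x = q y -> F (c x) = F (c y).

Lemma quotient_function : exists h : qspace c A q -> W, continuous h /\
  forall x (Ax : A x), h (qclass c q Ax) = F (c x).
Proof.
have qP (X : qspace c A q) : exists x (Ax : A x), X = qclass c q Ax.
  by case: X => y y_in; have [x Ax xy] := set_mem y_in; exists x, Ax; apply: val_inj.
have /choice[h hP] (X : qspace c A q) : exists w : W,
    forall x (Ax : A x), X = qclass c q Ax -> w = F (c x).
  have [x [Ax ->]] := qP X; exists (F (c x)) => y Ay e.
  by apply: Fq => //; exact: (congr1 val e).
exists h; split=> [|x Ax]; last exact: hP.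
apply/continuousP => O oO; exists (F @^-1` O).
  by move/continuousP: cF; apply.
by move=> x Ax; rewrite /preimage /= (hP _ x Ax).
Qed.

End QuotientFunction.
End Continuity.

(** * Continuity of the chart and of its inverse *)

Section ChartMaps.
Variable R : realType.
Local Notation T := 'rV[R]_#|{ffun 'I_2 -> 'I_7}|.
Local Notation i0 := (@Ordinal 4 0 isT).
Local Notation i1 := (@Ordinal 4 1 isT).
Local Notation i2 := (@Ordinal 4 2 isT).
Local Notation i3 := (@Ordinal 4 3 isT).

Lemma continuous_invar : continuous (@invar R).
Proof.
have [sP sl] := sm_cP R.
have cP' : continuous (@cP R) by move=> y; exact: (sm_cont sP).
have cl : continuous (@clam R) by move=> y; exact: (sm_cont sl).
have cN : continuous (fun P : 'M[R]_3 => - P) by move=> P; exact: (@continuousN _ _ _ id P (@cvg_id _ _)).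
have c1 : continuous (fun y : T => eig1 (cP y)).
  by move=> y; apply: (@continuous_comp _ _ _ (@cP R) (@lmax R)); [exact: cP'|exact: lmax_continuous].
have c3 : continuous (fun y : T => eig3 (cP y)).
  apply: ctsN => y; apply: (@continuous_comp _ _ _ (fun y => - cP y) (@lmax R)).
    by apply: (@continuous_comp _ _ _ (@cP R) -%R); [exact: cP'|exact: cN].
  exact: lmax_continuous.
have cE i j : continuous (fun y : T => cP y i j).
  by move=> y; apply: (@continuous_comp _ _ _ (@cP R) (fun A : 'M[R]_3 => A i j)); [exact: cP'|exact: cts_entry].
have c2 : continuous (fun y : T => eig2 (cP y)).
  by rewrite /eig2; do 4?[apply: ctsD => //]; exact: ctsN.
apply: cts_rV => -[[|[|[|[|//]]]] ilt].
- rewrite (_ : (fun y => _) = fun y : T => Num.min (eig1 (cP y) - eig2 (cP y)) (eig2 (cP y) - eig3 (cP y))).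
    by apply: cts_min; apply: ctsD => //; exact: ctsN.
  by apply/funext => y; rewrite mxE.
- rewrite (_ : (fun y => _) = fun y : T => eig1 (cP y) - 2 * eig2 (cP y) + eig3 (cP y)).
    apply: ctsD => //; apply: ctsD => //; apply: ctsN; apply: ctsM => //; exact: cts_cst.
  by apply/funext => y; rewrite mxE.
- rewrite (_ : (fun y => _) = fun y : T => eig3 (cP y)) //.
  by apply/funext => y; rewrite mxE.
- rewrite (_ : (fun y => _) = @clam R) //.
  by apply/funext => y; rewrite mxE.
Qed.

Lemma continuous_chartP : continuous (fun y : 'rV[R]_4 => tcoord (T2 (chartP y) (y 0 i3))).
Proof.
have ce i : continuous (fun y : 'rV[R]_4 => y 0 i) by exact: cts_entry.
have cs : continuous (@gap_s R) by apply: ctsD => //; apply: cts_max => //; exact: cts_cst.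
have ct : continuous (@gap_t R).
  by apply: ctsD => //; apply: cts_max; [exact: ctsN|exact: cts_cst].
have cd i j : continuous (fun y : 'rV[R]_4 => chartP y i j).
  case: (ord3P i) => ->; case: (ord3P j) => ->;
    [ rewrite (_ : (fun y => _) = fun y : 'rV[R]_4 => y 0 i2 + gap_t y + gap_s y)
    | rewrite (_ : (fun y => _) = fun=> 0) | rewrite (_ : (fun y => _) = fun=> 0)
    | rewrite (_ : (fun y => _) = fun=> 0)
    | rewrite (_ : (fun y => _) = fun y : 'rV[R]_4 => y 0 i2 + gap_t y)
    | rewrite (_ : (fun y => _) = fun=> 0) | rewrite (_ : (fun y => _) = fun=> 0)
    | rewrite (_ : (fun y => _) = fun=> 0)
    | rewrite (_ : (fun y => _) = fun y : 'rV[R]_4 => y 0 i2) ];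
    try (by apply/funext => y; rewrite mxE); try exact: cts_cst => //.
  - by apply: ctsD => //; apply: ctsD.
  - exact: ctsD.
  - exact: ce.
apply: cts_rV => s; set v := fun i : 'I_2 => ebas R ((enum_val s : {ffun 'I_2 -> 'I_7}) i).
rewrite (_ : (fun y => _) = fun y : 'rV[R]_4 =>
  f2 (chartP y) (y 0 i3) (@co R) (@conorm R) (v ord0) (v ord_max)); last first.
  by apply/funext => y; rewrite mxE /T2 restrT // => k; exact: (@ebas_pp R _ (ltn_ord _)).
apply: ctsD; last by apply: ctsM => //; exact: cts_cst.
apply: cts_sum => i; apply: cts_sum => j.
by do 2!(apply: ctsM; last exact: cts_cst).
Qed.

Lemma PD_dg (a b c : R) : b <= a -> c <= b -> 0 < c -> PD (dg a b c).
Proof.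
move=> ba cb c0; have b0 := lt_le_trans c0 cb; have a0 := lt_le_trans b0 ba.
split; first by apply: mx3_ext; rewrite !mxE.
move=> x [i xi]; rewrite qfE !mxE /= !(mul0r, addr0, add0r) -!mulrA -!expr2.
have [p0 p1 p2] : [/\ 0 <= a * x j0 ^+ 2, 0 <= b * x j1 ^+ 2 & 0 <= c * x j2 ^+ 2].
  by split; apply: mulr_ge0; rewrite ?sqr_ge0 ?ltW.
have q : 0 < x i ^+ 2 by rewrite lt_def sqrf_eq0 xi sqr_ge0.
have : 0 < [:: a; b; c]`_i * x i ^+ 2 by rewrite mulr_gt0 //; case: (ord3P i) => ->.
by case: (ord3P i) => -> /=; lra.
Qed.

Lemma chartP_Sym2p y : (@Uchart R `&` @half_space R 4) y ->
  Sym2p_inv (Field2 (chartP y) (y 0 i3)).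
Proof.
move=> Wy; have [s0 t0 _] := chart3_gaps Wy; case: Wy => -[y2 y3] _.
by apply: Field2_Sym2p => //; apply: PD_dg => //; lra.
Qed.

(** One chart covers the moduli space: each class contains a metric whose P is diagonal with
    decreasing entries, and these entries together with lam are invariants of the class. *)
Lemma moduli_chart : exists (h : moduli R -> 'rV[R]_4) (h' : 'rV[R]_4 -> moduli R),
  [/\ set_bij setT (@Uchart R `&` @half_space R 4) h, {in setT, cancel h h'},
      continuous h & {within @Uchart R `&` @half_space R 4, continuous h'}].
Proof.
have inv (g : tfield R 2) : Sym2p_inv g -> exists a b c lam,
    [/\ b <= a, c <= b, 0 < c & 0 < lam] /\ invar (metric_coord g) = chart3 a b c lam /\
    forall (Ag : Sym2p_inv g) (Ad : Sym2p_inv (Field2 (dg a b c) lam)),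
      moduli_class Ag = moduli_class Ad.
  move=> /Sym2p_invP[P [lam [PP l0 gE]]].
  have [S [a [b [c [SS PE [ba cb c0]]]]]] := PD_diagonalize PP.
  exists a, b, c, lam; split=> //; rewrite gE PE invar_Field2 //; split=> // Ag Ad.
  by apply: val_inj => /=; apply: Aut_orbit_conj => //; exact: PD_dg.
have Fq (g g' : tfield R 2) : Sym2p_inv g -> Sym2p_inv g' -> Aut_orbit g = Aut_orbit g' ->
    invar (metric_coord g) = invar (metric_coord g').
  move=> /Sym2p_invP[P [lam [PP l0 ->]]] /Sym2p_invP[P' [lam' [PP' l0' ->]]] e.
  have : Aut_orbit (Field2 P lam) (Field2 P' lam').
    rewrite e Aut_orbitE //; exists 1%:M; first exact: SO3_1.
    by rewrite mul1mx trmx1 mulmx1.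
  rewrite Aut_orbitE // => -[Q SQ <-].
  have [S [a [b [c [SS -> [ba cb c0]]]]]] := PD_diagonalize PP.
  rewrite invar_Field2 // (_ : Q *m _ *m Q^T = Q *m S *m dg a b c *m (Q *m S)^T).
    by rewrite invar_Field2 //; exact: SO3M.
  by rewrite trmx_mul !mulmxA.
have [h [ch hE]] := quotient_function continuous_invar Fq.
(* The default value of h' where the diagonal tensor is not a metric. *)
have X0 : moduli R.
  have A0 : Sym2p_inv (Field2 (dg (1 : R) 1 1) 1) by apply: Field2_Sym2p => //; exact: PD_dg.
  exact: (moduli_class A0).
have /choice[h' h'E] (y : 'rV[R]_4) : exists Y : moduli R,
    forall Ay : Sym2p_inv (Field2 (chartP y) (y 0 i3)), Y = moduli_class Ay.
  have [Ay|nAy] := pselect (Sym2p_inv (Field2 (chartP y) (y 0 i3))).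
    by exists (moduli_class Ay) => Ay'; apply: val_inj.
  by exists X0.
have hK : cancel h h'.
  move=> X; have [g [Ag ->]] := @qspaceP _ _ _ _ (@metric_coord R) (@Sym2p_inv R) (@Aut_orbit R) X.
  have [a [b [c [lam [[ba cb c0 l0] [iE mE]]]]]] := inv g Ag.
  rewrite hE iE; have W := chart3_image ba cb c0 l0.
  rewrite (h'E _ (chartP_Sym2p W)).
  have Ad : Sym2p_inv (Field2 (dg a b c) lam) by apply: Field2_Sym2p => //; exact: PD_dg.
  rewrite [RHS](mE Ag Ad); apply: val_inj => /=.
  by rewrite chartP_chart3 // mxE.
have W_h X : (@Uchart R `&` @half_space R 4) (h X).
  have [g [Ag ->]] := @qspaceP _ _ _ _ (@metric_coord R) (@Sym2p_inv R) (@Aut_orbit R) X.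
  have [a [b [c [lam [[ba cb c0 l0] [iE _]]]]]] := inv g Ag.
  by rewrite hE iE; exact: chart3_image.
have h'K y : (@Uchart R `&` @half_space R 4) y -> h (h' y) = y.
  move=> Wy; rewrite (h'E _ (chartP_Sym2p Wy)) /moduli_class hE.
  have [s0 t0 cE] := chart3_gaps Wy; rewrite -[RHS]cE /chartP.
  set D := dg _ _ _; have -> : D = 1%:M *m D *m (1%:M)^T by rewrite mul1mx trmx1 mulmx1.
  by rewrite invar_Field2 //; [exact: SO3_1|lra|lra].
exists h, h'; split=> //.
- split; first by move=> X _; exact: W_h.
    by move=> X Y _ _ e; rewrite -(hK X) e hK.
  by move=> y Wy; exists (h' y) => //; exact: h'K.
apply/subspace_continuousP => y Wy N Ny.
have [V [oV Vy] VN] : exists2 V, open_nbhs (h' y) V & V `<=` N.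
  by have : nbhs (h' y) N := Ny; rewrite nbhsE.
(* An open set of [moduli] comes from an open set U of metric coordinates, which is pulled back
   along the diagonal metrics. *)
have [U oU UV] := oV.
have Uy : U (tcoord (T2 (chartP y) (y 0 i3))).
  rewrite -metric_coordE; apply/(UV _ (chartP_Sym2p Wy)).
  by move: Vy; rewrite (h'E _ (chartP_Sym2p Wy)).
have nU : nbhs y ((fun y : 'rV[R]_4 => tcoord (T2 (chartP y) (y 0 i3))) @^-1` U).
  by apply: continuous_chartP; exact: open_nbhs_nbhs.
change (within (@Uchart R `&` @half_space R 4) (nbhs y) (h' @^-1` N)).
rewrite /within /=; apply: (filterS _ nU) => z Uz Wz; apply: VN.
rewrite (h'E _ (chartP_Sym2p Wz)); apply/(UV _ (chartP_Sym2p Wz)).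
by rewrite metric_coordE.
Qed.

End ChartMaps.

(** * The moduli space is a 4-manifold with boundary *)

Section Manifold.
Variable R : realType.

Lemma hausdorff_injective (X Y : topologicalType) (h : X -> Y) :
  continuous h -> injective h -> hausdorff_space Y -> hausdorff_space X.
Proof.
move=> ch ih; rewrite !open_hausdorff => hY x y xy.
have [|[A B] [/set_mem Ax /set_mem By] [oA oB AB]] := hY (h x) (h y).
  by apply: contra_neq xy => /ih.
have op := (continuousP h).1 ch.
exists (h @^-1` A, h @^-1` B); first by split; apply/mem_set.
split=> /=; [exact: op|exact: op|].
by move: AB; rewrite -preimage_setI => /eqP ->; rewrite preimage_set0.
Qed.

(** With 2 / (k + 1) < e, a ball of radius 1 / (k + 1) containing y lies in the ball of radius e
    around y; density of the rationals provides its center. *)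
Lemma rational_ball n (y : 'rV[R]_n) (N : set 'rV[R]_n) : nbhs y N ->
  exists (c : 'rV[rat]_n) (k : nat), ball (map_mx ratr c : 'rV[R]_n) (k.+1%:R^-1) y /\
    ball (map_mx ratr c : 'rV[R]_n) (k.+1%:R^-1) `<=` N.
Proof.
move=> /nbhs_ballP[e /= e0 eN]; have e2 : 0 < e / 2 by rewrite divr_gt0.
have [k _ /(_ k (leqnn k)) /= ke] := near_infty_natSinv_lt (PosNum e2).
have k0 : 0 < k.+1%:R^-1 :> R by rewrite invr_gt0.
have /choice[c cP] (i : 'I_n) : exists q : rat, ball (ratr q : R) (k.+1%:R^-1) (y 0 i).
  have [|q] := @rat_in_itvoo R (y 0 i - k.+1%:R^-1) (y 0 i + k.+1%:R^-1).
    by move: k0; set d := k.+1%:R^-1; lra.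
  rewrite in_itv /= => /andP[q1 q2]; exists q; move: q1 q2; set d := k.+1%:R^-1 => q1 q2.
  by rewrite /ball /= ltr_norml; apply/andP; split; lra.
have yc : ball (map_mx ratr (\row_i c i) : 'rV[R]_n) (k.+1%:R^-1) y.
  by split=> // i j; rewrite !mxE ord1; exact: cP.
exists (\row_i c i), k; split=> // z zc; apply: eN.
apply: (@le_ball _ _ _ (k.+1%:R^-1 + k.+1%:R^-1)); first by move: ke; set d := k.+1%:R^-1 => /= ke; lra.
exact: ball_triangle (ball_sym yc) zc.
Qed.

(** The global chart h transports the Hausdorff property and a countable base, the preimages of
    balls with rational centers and radii 1 / (k + 1). *)
Lemma moduli_manifold : manifold_with_boundary R 4 (moduli R).
Proof.
have [h [h' [[hW hi hs] hK ch ch']]] := moduli_chart R.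
have h'h x : h' (h x) = x by apply: hK; exact: in_setT.
have hinj : injective h by move=> x y e; rewrite -(h'h x) e h'h.
have op := (continuousP h).1 ch.
split.
- apply: (hausdorff_injective ch hinj); exact: norm_hausdorff.
- pose f (p : 'rV[rat]_4 * nat) : set (moduli R) :=
    h @^-1` ball (map_mx ratr p.1 : 'rV[R]_4) (p.2.+1%:R^-1).
  exists [set f p | p in setT].
    by apply: card_le_trans (card_image_le _ _) _; exact: countableP.
  split=> [_ [p _ <-]|x N xN]; first by apply: op; exact: ball_open.
  have : nbhs (h x) [set z | (@Uchart R `&` @half_space R 4) z -> N (h' z)].
    have /subspace_continuousP/(_ (h x) (hW x I)) := ch'.
    have xN' : nbhs (h' (h x)) N by rewrite h'h.
    by move=> /(_ N xN').
  move=> /rational_ball[c [k [cx cN]]].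
  exists (f (c, k)) => /=; first by split=> //; exists (c, k).
  by move=> z /cN /(_ (hW z I)); rewrite h'h.
- move=> x; exists setT, (@Uchart R), h, h'; split=> //; first exact: openT.
    rewrite (_ : @Uchart R = [set y | 0 < y 0 (@Ordinal 4 2 isT)] `&`
      [set y | 0 < y 0 (@Ordinal 4 3 isT)]); last by apply/seteqP; split=> y [].
    have sm i : smooth_on setT (fun y : 'rV[R]_4 => y 0 i).
      by apply: sm_entry; [exact: openT|apply: sm_id; exact: openT].
    by apply: openI; exact: open_gt0.
  by split=> //; exact: continuous_subspaceT.
Qed.

End Manifold.

Theorem theorem1 (R : realType) :
  [/\ set_bij (@Omega3p_inv R) (@Lambda3p_inv R) (@ev R 3),
      diffeo (@RGL_coord R) (@tcoord R 3) (@RGLp R) (@Lambda3p_inv R) (@Phi R),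
      @G2_metrics_inv R = @Sym2p_inv R &
      exists M : R * set 'M[R]_3 -> tfield R 2,
        [/\ forall (z : R * 'M[R]_3) (phi : tfield R 3),
              RGLp z -> Omega3p_inv phi -> ev phi = Phi z ->
              induces phi (M (pcoset z)),
            quotient_diffeo (@RGL_coord R) (@metric_coord R)
              (@RGLp R) (@pcoset R) (@Sym2p_inv R) M,
            exists N : double_quotient R -> moduli R,
              homeomorphism N /\
              forall (z : R * 'M[R]_3) (Az : RGLp z)
                     (Ag : Sym2p_inv (M (pcoset z))),
                N (double_class Az) = moduli_class Ag &
            manifold_with_boundary R 4 (moduli R)]].
Proof.
split; [exact: Omega3p_inv_bij|exact: Phi_diffeo|exact: G2_metrics_inv_Sym2p|].
exists (@Mmap R); split; [exact: Mmap_induces|exact: Mmap_quotient_diffeo| |].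
- exact: moduli_homeomorphism.
- exact: moduli_manifold.
Qed.
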